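(* Let $X^{(1)},\dots,X^{(n)}$ be i.i.d. copies of $X\sim\mathrm{NPN}_d(f,\Sigma^* )$ and $\Theta^*=(\Sigma^* )^{-1}$. Suppose that Assumptions 1, 2 and 3 (stated in the context) hold, that $n\gtrsim s\log d$, and let $\lambda\asymp\sqrt{\log d/n}$ (with suitably chosen constant). Then, with probability at least $1-8/d$, $$\big\|\widehat\Theta^{(\ell)}-\Theta^*\big\|_F\le4\|\Theta^*\|_2^2\,\big\|\nabla\mathcal L(\Theta^* )_S\big\|_F+\tfrac12\big\|\widehat\Theta^{(\ell-1)}-\Theta^*\big\|_F,\qquad1\le\ell\le T.$$ If $T\gtrsim\log(\lambda\sqrt n)\gtrsim\log\log d$, then $$\big\|\widehat\Theta^{(T)}-\Theta^*\big\|_F=\mathcal O_{\mathbb P}\big(\sqrt{s/n}\big).$$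
   Context: Notation. $\|\cdot\|_F$ is the Frobenius norm, $\|\cdot\|_2$ the spectral norm, $\|\cdot\|_\infty$ the $\ell_\infty\to\ell_\infty$ operator norm (maximum absolute row sum), $\langle A,B\rangle=\mathrm{tr}(A^{\mathrm T}B)$, $\odot$ the Hadamard product, $\|A\|_{1,\mathrm{off}}=\sum_{i\ne j}|A_{ij}|$, $a\vee b=\max\{a,b\}$. For an index set $\mathcal E$, $A_{\mathcal E}$ agrees with $A$ on $\mathcal E$ and is $0$ elsewhere. $\mathcal S_+^d$ is the set of symmetric positive definite $d\times d$ matrices. Model. Let $f=(f_1,\dots,f_d)$ be strictly increasing univariate functions and $\Sigma^*\in\mathbb R^{d\times d}$ a positive definite correlation matrix (unit diagonal). $X=(X_1,\dots,X_d)^{\mathrm T}\sim\mathrm{NPN}_d(f,\Sigma^* )$ (nonparanormal) means $(f_1(X_1),\dots,f_d(X_d))^{\mathrm T}\sim\mathcal N(0,\Sigma^* )$. $S=\{(i,j):i\ne j,\ \Theta^*_{ij}\ne0\}$. Estimators. The Kendall's tau statistics are $$\widehat\tau_{jk}=\frac{2}{n(n-1)}\sum_{1\le i<i'\le n}\mathrm{sign}\big((X^{(i)}_j-X^{(i')}_j)(X^{(i)}_k-X^{(i')}_k)\big),$$ and $\widehat S^\tau$ has entries $\widehat S^\tau_{jk}=\sin(\widehat\tau_{jk}\pi/2)$ for $j\ne k$ and $\widehat S^\tau_{jj}=1$. Put $\mathcal L(\Theta)=\langle\Theta,\widehat S^\tau\rangle-\log\det\Theta$, so $\nabla\mathcal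 L(\Theta^* )=\widehat S^\tau-\Sigma^*$. Given $\lambda>0$ and a weight function $\mathrm w$, put $\widehat\Theta^{(0)}=0$, so that $\lambda^{(0)}_{ij}=\lambda$ for $i\ne j$, and for $\ell=1,\dots,T$ $$\widehat\Theta^{(\ell)}=\operatorname*{argmin}_{\Theta\in\mathcal S_+^d}\big\{\mathcal L(\Theta)+\|\lambda^{(\ell-1)}\odot\Theta\|_{1,\mathrm{off}}\big\},\qquad\lambda^{(\ell)}_{ij}=\lambda\,\mathrm w\big(|\widehat\Theta^{(\ell)}_{ij}|\big)\ (i\ne j).$$ Assumptions. Let $c=2\big(32\|\Theta^*\|_2^2+\|\Sigma^*\|_\infty^2\vee1\big)$ and $u=c\lambda$. Assumption 1: $|S|\le s$, $\|\Sigma^*\|_\infty\le M<\infty$, and $0<\varepsilon_2\le\lambda_{\min}(\Theta^* )\le\lambda_{\max}(\Theta^* )\le1/\varepsilon_2<\infty$ (extreme eigenvalues); bounds on the diagonal of $\Sigma^*$ are automatic since it has unit diagonal. $M,\varepsilon_2$ are treated as constants. Assumption 2: $\mathrm w:\mathbb R\to\mathbb R$ is nonincreasing, $0\le\mathrm w(t)\le1$ for $t\ge0$, $\mathrm w(t)=1$ for $t\le0$; there is a constant $\alpha$ with $\mathrm w(\alpha\lambda)=0$; and $\mathrm w(u)\ge1/2$. Assumption 3: $\min_{(i,j)\in S}|\Theta^*_{ij}|\ge(\alpha+c)\lambda$. Asymptotic conventions. $f\gtrsim g$ (resp. $f\lesssim g$) means $f\ge kg$ (resp. $f\le kg$) for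 a positive constant $k$; $f\asymp g$ means both. Constants do not depend on $n,d,s$ (they may depend on $M,\varepsilon_2,\alpha$), and in sample size conditions and in lower bounds on $T$ the constant is sufficiently large. $Y_n=\mathcal O_{\mathbb P}(a_n)$ means $Y_n/a_n$ is bounded in probability as $n,d\to\infty$, where $d,s$ may grow with $n$. *)

(* Defs.v *)
From HB Require Import structures.
From mathcomp Require Import all_boot all_order all_algebra.
From mathcomp Require Import all_classical all_reals all_analysis.

Set Implicit Arguments.
Unset Strict Implicit.
Unset Printing Implicit Defensive.

Import Order.TTheory GRing.Theory Num.Theory.
Import numFieldNormedType.Exports.

Local Open Scope classical_set_scope.
Local Open Scope ring_scope.

(** * Matrices *)

Section matrices.
Context {R : realType}.

Definition frobenius_norm m n (A : 'M[R]_(m, n)) : R :=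
  Num.sqrt (\sum_i \sum_j A i j ^+ 2).

(* On column vectors the Frobenius norm is the Euclidean norm. *)
Definition spectral_norm m n (A : 'M[R]_(m, n)) : R :=
  sup [set frobenius_norm (A *m v) | v in [set v : 'cV[R]_n | frobenius_norm v <= 1]].

Definition inf_norm m n (A : 'M[R]_(m, n)) : R :=
  \big[Num.max/0]_i \sum_j `|A i j|.

Definition off_l1_norm n (A : 'M[R]_n) : R :=
  \sum_i \sum_(j | j != i) `|A i j|.

Definition hadamard m n (A B : 'M[R]_(m, n)) : 'M[R]_(m, n) :=
  map2_mx *%R A B.

Definition restrict_mx m n (E : {set 'I_m * 'I_n}) (A : 'M[R]_(m, n)) :
    'M[R]_(m, n) :=
  \matrix_(i, j) if (i, j) \in E then A i j else 0.

Definition posdef n : set 'M[R]_n :=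
  [set A | A^T = A /\ forall v : 'cV[R]_n, v != 0 -> 0 < (v^T *m A *m v) 0 0].

Definition correlation_mx n (A : 'M[R]_n) : Prop := posdef A /\ forall i, A i i = 1.

Definition lambda_min n (A : 'M[R]_n) : R := inf [set a | eigenvalue A a].
Definition lambda_max n (A : 'M[R]_n) : R := sup [set a | eigenvalue A a].

Definition off_support n (A : 'M[R]_n) : {set 'I_n * 'I_n} :=
  [set p | (p.1 != p.2) && (A p.1 p.2 != 0)]%SET.

End matrices.

(** * Nonparanormal samples *)

Section probability.
Context {disp : measure_display} {Omega : measurableType disp} {R : realType}.
Variable P : probability Omega R.

(* Z ~ N(0, Sigma) for positive definite Sigma: every nontrivial linear
   combination v^T Z is univariate normal with variance v^T Sigma v.  The second
   argument of [normal_prob] is the standard deviation; v = 0 is left out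
   because [normal_prob 0 0] is not the Dirac mass at 0. *)
Definition centered_gaussian d (Z : 'I_d -> Omega -> R) (Sigma : 'M[R]_d) : Prop :=
  forall v : 'cV[R]_d, v != 0 -> forall B : set R, measurable B ->
    P ((fun omega => \sum_j v j 0 * Z j omega) @^-1` B) =
    normal_prob 0 (Num.sqrt ((v^T *m Sigma *m v) 0 0)) B.

Definition nonparanormal d (f : 'I_d -> R -> R) (Sigma : 'M[R]_d)
    (X : {RV P >-> d.-tuple R}) : Prop :=
  centered_gaussian (fun j omega => f j (tnth (X omega) j)) Sigma.

(* Taking some of the B i to be the whole space gives the product rule for every
   subfamily. *)
Definition mutually_independent n d (X : 'I_n -> {RV P >-> d.-tuple R}) : Prop :=
  forall B : 'I_n -> set (d.-tuple R), (forall i, measurable (B i)) ->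
    P [set omega | forall i, B i (X i omega)] =
    (\prod_(i < n) P (X i @^-1` B i))%E.

End probability.

(** * Estimators *)

Section estimators.
Context {R : realType}.

Definition kendall_tau n d (x : 'I_n -> d.-tuple R) (j k : 'I_d) : R :=
  2 / (n%:R * (n%:R - 1)) *
  \sum_(i < n) \sum_(i' < n | (i < i')%N)
    Num.sg ((tnth (x i) j - tnth (x i') j) * (tnth (x i) k - tnth (x i') k)).

Definition kendall_mx n d (x : 'I_n -> d.-tuple R) : 'M[R]_d :=
  \matrix_(j, k) if j == k then 1 else sin (kendall_tau x j k * pi / 2).

Definition loss d (S Theta : 'M[R]_d) : R :=
  \tr (Theta^T *m S) - ln (\det Theta).

(* Gradient of [loss S] at a positive definite matrix. *)
Definition grad_loss d (S Theta : 'M[R]_d) : 'M[R]_d := S - invmx Theta.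

Definition is_argmin (T : Type) (D : set T) (F : T -> R) (x : T) : Prop :=
  D x /\ forall y, D y -> F x <= F y.

Definition weight_mx d (w : R -> R) (lambda : R) (Theta : 'M[R]_d) : 'M[R]_d :=
  \matrix_(i, j) (lambda * w `|Theta i j|).

Definition penalized_loss d (S L Theta : 'M[R]_d) : R :=
  loss S Theta + off_l1_norm (hadamard L Theta).

(* A minimizer is unique when it exists (the objective is strictly convex); it
   need not exist for every S, in which case [xget] returns 0. *)
Fixpoint estimator d (w : R -> R) (lambda : R) (S : 'M[R]_d) (l : nat) : 'M[R]_d :=
  if l is l'.+1 then
    xget 0 [set Theta | is_argmin (@posdef R d)
      (penalized_loss S (weight_mx w lambda (estimator w lambda S l'))) Theta]
  else 0.

End estimators.

(** * Assumptions *)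

Section assumptions.
Context {R : realType}.

Definition cst_c d (Sigma : 'M[R]_d) : R :=
  2 * (32 * spectral_norm (invmx Sigma) ^+ 2 + Num.max (inf_norm Sigma ^+ 2) 1).

Definition assumption1 d (M eps2 : R) (s : nat) (Sigma : 'M[R]_d) : Prop :=
  let Theta := invmx Sigma in
  [/\ (#|off_support Theta| <= s)%N,
      inf_norm Sigma <= M,
      0 < eps2,
      eps2 <= lambda_min Theta
    & lambda_max Theta <= 1 / eps2].

Definition assumption2 d (alpha lambda : R) (Sigma : 'M[R]_d) (w : R -> R) : Prop :=
  [/\ forall x y, x <= y -> w y <= w x,
      forall t, 0 <= t -> 0 <= w t <= 1,
      forall t, t <= 0 -> w t = 1,
      w (alpha * lambda) = 0
    & 1 / 2 <= w (cst_c Sigma * lambda)].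

Definition assumption3 d (alpha lambda : R) (Sigma : 'M[R]_d) : Prop :=
  let Theta := invmx Sigma in
  forall p, p \in off_support Theta ->
    (alpha + cst_c Sigma) * lambda <= `|Theta p.1 p.2|.

(* X^(1), ..., X^(n) are independent with the same law NPN_d(f, Sigma), which f
   and Sigma determine because the f j are injective. *)
Record setting (M eps2 alpha : R) (n d s : nat) (lambda : R) (w : R -> R)
    (f : 'I_d -> R -> R) (Sigma : 'M[R]_d)
    (disp : measure_display) (Omega : measurableType disp)
    (P : probability Omega R) (X : 'I_n -> {RV P >-> d.-tuple R}) : Prop := {
  f_increasing : forall j x y, x < y -> f j x < f j y;
  Sigma_correlation : correlation_mx Sigma;
  X_nonparanormal : forall i, nonparanormal f Sigma (X i);
  X_independent : mutually_independent X;
  lambda_gt0 : 0 < lambda;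
  setting_assumption1 : assumption1 M eps2 s Sigma;
  setting_assumption2 : assumption2 alpha lambda Sigma w;
  setting_assumption3 : assumption3 alpha lambda Sigma
}.

End assumptions.

(* Main.v *)
(** Write [D] for the error of a penalized minimizer.  Concavity of log det along
the segment from the minimizer to [invmx Sigma] gives a variational inequality,
and localizing it at a small distance from the truth gives
[|D|_F <= 3 |Theta|_2^2 (|grad_S| + |grad_E| + |lambda_S|)], where [E] collects
the off-support entries on which the previous iterate is large.  When
[max |S - Sigma| <= lambda / 2], [E] has at most [s] elements, and the last two
terms are at most half of the previous error: they only involve entries where the
previous iterate is off by at least [c * lambda].

The population value of Kendall's tau comes from the kernel
[ln |u + e^x v| - ln |u - e^x v|], whose integral over [x] is [(pi^2 / 2) sg (u v)].
For centered Gaussian [U], [V] the expectation of [ln |U + s e^x V|] is half the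
logarithm of the variance plus a constant, so by Fubini [E sg (U V)] reduces to
the integral of [ln ((ch x + cos a) / (ch x + cos b))], which is [b^2 - a^2].

For the deviations, the pairs [i < j] split into [n] matchings of disjoint, hence
independent, pairs; convexity of [exp] and [e^y <= y + e^(2 y^2)] then give a
sub-Gaussian moment generating function for the sample tau, from which the tail
bound and the second moment follow. *)

Require Import Defs.
From HB Require Import structures.
From mathcomp Require Import all_boot all_order all_algebra.
From mathcomp Require Import all_classical all_reals all_analysis.
From mathcomp Require Import measurable_realfun ring lra.

Set Implicit Arguments.
Unset Strict Implicit.
Unset Printing Implicit Defensive.

Import Order.TTheory GRing.Theory Num.Theory.
Import numFieldNormedType.Exports.

Local Open Scope classical_set_scope.
Local Open Scope ring_scope.

Section continuity.
Context {R : realType}.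

(** The Gaussian hypothesis gives only the univariate laws of linear combinations, so no joint
    density is at hand. The logarithmic kernel fits this: [U + s e^x V] is a multiple of the
    difference of two independent standard normals, so the mean of the logarithm of its modulus is a
    scale term plus one constant, which cancels between [s = 1] and [s = -1] and is never computed.
    [estimator] is defined by choice and is [0] when no minimizer exists. Existence is therefore
    proved on the good event, jointly with the bound on the size of [E], by one induction over the
    iterations. Statements about the estimator are events because Kendall's matrix takes finitely
    many values, so every predicate of it is measurable. The rate [sqrt (s / n)] is out of reach of
    the entrywise bound, which costs a factor [sqrt (ln d)]. The gradient on the support is instead
    controlled in second moment with Markov's inequality, while halving the error at each iteration
    removes the remaining factor [lambda * sqrt n]. *)

Lemma continuousM_fun (T : topologicalType) (f g : T -> R) :
  continuous f -> continuous g -> continuous (fun x => f x * g x).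
Proof. by move=> cf cg x; apply: continuousM; [exact: cf|exact: cg]. Qed.

Lemma continuousD_fun (T : topologicalType) (f g : T -> R) :
  continuous f -> continuous g -> continuous (fun x => f x + g x).
Proof. by move=> cf cg x; apply: continuousD; [exact: cf|exact: cg]. Qed.

Lemma continuousV_fun (T : topologicalType) (f : T -> R) :
  (forall x, f x != 0) -> continuous f -> continuous (fun x => (f x)^-1).
Proof. by move=> f0 cf x; apply: continuousV; [exact: f0|exact: cf]. Qed.

End continuity.

(** * Positive definite matrices *)

Section posdef_theory.
Context {R : realType}.

Lemma posdef_congr n (P A : 'M[R]_n) : P \in unitmx -> posdef A ->
  posdef (P *m A *m P^T).
Proof.
move=> uP [sA pA]; split; first by rewrite !trmx_mul trmxK sA mulmxA.
move=> v v0; have := pA (P^T *m v).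
rewrite trmx_mul trmxK !mulmxA; apply.
apply: contra v0 => /eqP /(congr1 (mulmx (invmx P^T))).
by rewrite mulmxA mulVmx ?unitmx_tr// mul1mx mulmx0 => ->.
Qed.

Lemma posdef_unitmx n (A : 'M[R]_n) : posdef A -> A \in unitmx.
Proof.
move=> [sA pA]; rewrite -row_free_unit -kermx_eq0; apply: contraT => /rowV0Pn [v].
move=> /sub_kermxP vA v0; have := pA v^T.
by rewrite trmx_eq0 v0 trmxK vA mul0mx mxE ltxx => /(_ isT).
Qed.

Lemma posdef_inv n (A : 'M[R]_n) : posdef A -> posdef (invmx A).
Proof.
move=> pA; have uA := posdef_unitmx pA.
have /posdef_congr/(_ pA) : invmx A \in unitmx by rewrite unitmx_inv.
by rewrite mulVmx// mul1mx trmx_inv pA.1.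
Qed.

Lemma posdef_block n (a : 'M[R]_1) (S : 'M[R]_n) :
  posdef (block_mx a 0 0 S : 'M[R]_(1 + n)) -> 0 < a 0 0 /\ posdef S.
Proof.
move=> [sB pB]; split.
  have := pB (col_mx 1%:M 0); rewrite tr_col_mx mul_row_block mul_row_col.
  rewrite !mulmx0 !trmx1 !mul1mx ?trmx0 ?mul0mx !addr0 mulmx1; apply.
  by rewrite col_mx_eq0 negb_and oner_eq0.
split.
  by move: sB; rewrite tr_block_mx => /eq_block_mx[].
move=> v v0.
have := pB (col_mx 0 v); rewrite tr_col_mx mul_row_block mul_row_col.
rewrite !mulmx0 ?trmx0 ?mul0mx !add0r; apply.
by rewrite col_mx_eq0 negb_and v0 orbT.
Qed.

(* Elimination of the first row and column: the bottom right block is the Schur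
   complement. *)
Lemma posdef_schur n (A : 'M[R]_(1 + n)) : posdef A ->
  exists (P : 'M[R]_(1 + n)) (a : R) (S : 'M[R]_n),
  [/\ \det P = 1, P *m A *m P^T = block_mx a%:M 0 0 S, 0 < a,
      posdef S & a + \tr S <= \tr A].
Proof.
move=> pA; have [sA qA] := pA.
pose a := ulsubmx A 0 0; pose c := dlsubmx A; pose D := drsubmx A.
have AE : A = block_mx a%:M c^T c D.
  rewrite -[LHS]submxK; congr block_mx; first exact: mx11_scalar.
  by rewrite /c trmx_dlsub sA.
pose P : 'M[R]_(1 + n) := block_mx 1%:M 0 (- a^-1 *: c) 1%:M.
pose S := D - a^-1 *: (c *m c^T).
have detP : \det P = 1 by rewrite det_lblock !det1 mulr1.
have uP : P \in unitmx by rewrite unitmxE detP unitr1.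
have a0 : 0 < a.
  have := qA (col_mx 1%:M 0); rewrite AE tr_col_mx mul_row_block mul_row_col.
  rewrite !trmx1 trmx0 !mul0mx !addr0 !mulmx0 !addr0 mul1mx mulmx1 !mxE eqxx mulr1n; apply.
  by rewrite col_mx_eq0 negb_and oner_eq0.
have PAP : P *m A *m P^T = block_mx a%:M 0 0 S.
  rewrite AE /P mulmx_block tr_block_mx mulmx_block !trmx1 !trmx0 !mul1mx !mul0mx.
  rewrite !addr0 !mulmx1 !mulmx0 !addr0 linearZ /= mul_mx_scalar mul_scalar_mx.
  have aV p q (x : 'M[R]_(p, q)) : a *: (- a^-1 *: x) + x = 0.
    by rewrite scalerA mulrN divff ?gt_eqF// scaleN1r addNr.
  by rewrite -!scalemxAl !aV mul0mx add0r addrC scaleNr.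
have /posdef_block[_ pS] : posdef (block_mx a%:M 0 0 S : 'M[R]_(1 + n)).
  by rewrite -PAP; exact: posdef_congr.
exists P, a, S; split => //.
rewrite [in leRHS]AE mxtrace_block mxtrace_scalar mulr1n lerD2l /S raddfB/= gerDl.
rewrite oppr_le0 mxtraceZ mulr_ge0 ?invr_ge0 ?(ltW a0)//.
rewrite mxtrace_mulC /mxtrace sumr_ge0// => i _.
by rewrite !mxE sumr_ge0// => j _; rewrite !mxE -expr2 sqr_ge0.
Qed.

(** Sums [ln a <= a - 1] over the pivots: they multiply to the determinant, and by [posdef_schur]
    their sum is at most the trace. No eigenvalue is used. *)
Lemma posdef_det_gt0_le n (A : 'M[R]_n) : posdef A ->
  0 < \det A /\ ln (\det A) <= \tr A - n%:R.
Proof.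
elim: n A => [|n IH] A pA.
  by rewrite det_mx00 ln1 /mxtrace big_ord0 subr0.
have [P [a [S [dP PAP a0 /IH[dS lS] trS]]]] := posdef_schur pA.
have detA : \det A = a * \det S.
  have := congr1 determinant PAP.
  by rewrite !det_mulmx det_tr dP mul1r mulr1 det_ublock det_scalar expr1.
rewrite detA; split; first exact: mulr_gt0.
rewrite lnM ?posrE//; have := le_ln1Dx (x := a - 1).
rewrite [_ + (_ - _)]addrC subrK.
have -> : -1 < a - 1 by lra.
move=> /(_ isT) la.
move: lS trS la; rewrite -[in n.+1%:R]natr1; move: (\tr A) (\tr S) (ln a) (ln _) => x y z t.
rewrite -/(1+n)%N => *; lra.
Qed.

(** Scales the pivots of the successive Schur complements to one; the resulting factor stands in for
    a matrix square root. *)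
Lemma posdef_factor n (A : 'M[R]_n) : posdef A ->
  exists2 P : 'M[R]_n, P \in unitmx & P *m A *m P^T = 1%:M.
Proof.
elim: n A => [|n IH] A pA.
  by exists 1%:M; [rewrite unitmx1 | rewrite [LHS]flatmx0 [RHS]flatmx0].
have [P [a [S [dP PAP a0 /IH[Q uQ QS] _]]]] := posdef_schur pA.
pose s : R := (Num.sqrt a)^-1.
have s0 : 0 < s by rewrite invr_gt0 sqrtr_gt0.
have sa : s * a * s = 1.
  rewrite mulrC mulrA -expr2 /s exprVn sqr_sqrtr ?(ltW a0)// mulVf// gt_eqF//.
pose B : 'M[R]_(1 + n) := block_mx s%:M 0 0 Q.
exists (B *m P).
  rewrite unitmx_mul; apply/andP; split; last by rewrite unitmxE dP unitr1.
  have -> : (B \in unitmx) = (\det B \is a GRing.unit) by [].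
  have -> : \det B = s * \det Q by rewrite det_ublock det_scalar expr1.
  by rewrite unitrM -unitmxE uQ andbT unitfE gt_eqF.
have BB : B *m block_mx a%:M 0 0 S *m B^T = 1%:M.
  rewrite mulmx_block tr_block_mx mulmx_block !trmx0 !(mulmx0, mul0mx, add0r, addr0).
  by rewrite QS tr_scalar_mx -!scalar_mxM sa -scalar_mx_block.
by rewrite trmx_mul !mulmxA -(mulmxA _ P A) -(mulmxA _ (P *m A)) PAP BB.
Qed.

Lemma posdef_invE n (A : 'M[R]_n) : posdef A ->
  exists2 P : 'M[R]_n, P \in unitmx & A = P *m P^T.
Proof.
move=> pA; have [P uP PAP] := posdef_factor pA.
exists (invmx P); first by rewrite unitmx_inv.
have <- : invmx P *m (P *m A *m P^T) *m invmx P^T = A.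
  rewrite -!mulmxA mulmxV ?unitmx_tr// mulmx1 mulmxA mulVmx// mul1mx //.
by rewrite PAP mulmx1 trmx_inv.
Qed.

(** First-order form of the concavity of log det. A congruence by the factor of [A] moves [A] to the
    identity, where it becomes the trace bound of [posdef_det_gt0_le]. *)
Lemma ln_det_le n (A B : 'M[R]_n) : posdef A -> posdef B ->
  ln (\det B) <= ln (\det A) + \tr (invmx A *m (B - A)).
Proof.
move=> pA pB; have [P uP AE] := posdef_invE pA.
have uA := posdef_unitmx pA.
have uPt : P^T \in unitmx by rewrite unitmx_tr.
have dP : \det P != 0 by rewrite -unitfE -unitmxE.
have [dA _] := posdef_det_gt0_le pA; have [dB _] := posdef_det_gt0_le pB.
have uPV : invmx P \in unitmx by rewrite unitmx_inv.
have [dC] := posdef_det_gt0_le (posdef_congr uPV pB).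
have -> : \tr (invmx P *m B *m (invmx P)^T) = \tr (invmx A *m B).
  rewrite mxtrace_mulC mulmxA trmx_inv; congr (\tr (_ *m _)).
  apply: (can_inj (mulKmx uA)); rewrite mulmxV//.
  by rewrite {1}AE !mulmxA -(mulmxA P) mulmxV// mulmx1 mulmxV.
have -> : \det (invmx P *m B *m (invmx P)^T) = \det B / \det A.
  rewrite !det_mulmx det_tr det_inv AE det_mulmx det_tr.
  by field.
rewrite ln_div ?posrE// mulmxBr raddfB/= mulVmx// mxtrace1; lra.
Qed.

End posdef_theory.

(** * Frobenius and spectral norms, Cauchy-Schwarz inequalities *)

Section norms.
Context {R : realType}.

(** Allows a degenerate form: besides the trace product it is applied to [A - a I] with [a] an
    eigenvalue of [A], which is only semidefinite. *)
Lemma cauchy_schwarz (V : lmodType R) (f : V -> V -> R) :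
  (forall a u v w, f (a *: u + v) w = a * f u w + f v w) ->
  (forall u v, f u v = f v u) -> (forall u, 0 <= f u u) ->
  forall u v, f u v ^+ 2 <= f u u * f v v.
Proof.
move=> fl fs f0 u v.
have ft t : 0 <= t ^+ 2 * f v v + 2 * t * f u v + f u u.
  have := f0 (t *: v + u); rewrite fl (fs u) fl (fs v (_ + _)) fl (fs v u); lra.
have [fv|fv] := eqVneq (f v v) 0.
  rewrite fv mulr0; have [->|fuv] := eqVneq (f u v) 0; first by rewrite expr0n.
  (* With [f v v = 0] the nonnegative quadratic in [t] is affine, and this [t] gives it the value
     [-1]. *)
  have := ft (- (f u u + 1) / (2 * f u v)); rewrite fv mulr0 add0r.
  have -> : 2 * (- (f u u + 1) / (2 * f u v)) * f u v = - (f u u + 1) by field.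
  lra.
have fv0 : 0 < f v v by rewrite lt_neqAle eq_sym fv f0.
have := ft (- f u v / f v v).
have -> : (- f u v / f v v) ^+ 2 * f v v + 2 * (- f u v / f v v) * f u v + f u u =
  (f u u * f v v - f u v ^+ 2) / f v v by field.
by rewrite pmulr_lge0 ?invr_gt0// subr_ge0.
Qed.

Lemma frob_sqr m n (A : 'M[R]_(m, n)) : frobenius_norm A ^+ 2 = \tr (A^T *m A).
Proof.
rewrite sqr_sqrtr; last by do 2 (apply: sumr_ge0 => ? _); exact: sqr_ge0.
rewrite exchange_big; apply: eq_bigr => j _; rewrite mxE.
by apply: eq_bigr => i _; rewrite mxE expr2.
Qed.

Lemma frob_sqrE m n (A : 'M[R]_(m, n)) :
  frobenius_norm A ^+ 2 = \sum_i \sum_j A i j ^+ 2.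
Proof. by rewrite sqr_sqrtr//; do 2 (apply: sumr_ge0 => ? _); exact: sqr_ge0. Qed.

Lemma frob_ge0 m n (A : 'M[R]_(m, n)) : 0 <= frobenius_norm A.
Proof. exact: sqrtr_ge0. Qed.

Lemma mxtrace11 (A : 'M[R]_1) : \tr A = A 0 0.
Proof. by rewrite /mxtrace big_ord1. Qed.

Lemma frob_col n (v : 'cV[R]_n) : frobenius_norm v ^+ 2 = (v^T *m v) 0 0.
Proof. by rewrite frob_sqr mxtrace11. Qed.

Lemma frob_eq0 m n (A : 'M[R]_(m, n)) : (frobenius_norm A == 0) = (A == 0).
Proof.
apply/idP/eqP => [|->]; last first.
  rewrite -sqrf_eq0 frob_sqrE; apply/eqP.
  by do 2 (apply: big1 => ? _); rewrite mxE expr0n.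
rewrite -sqrf_eq0 frob_sqrE psumr_eq0 => [/allP h|i _]; last first.
  by apply: sumr_ge0 => ? _; exact: sqr_ge0.
apply/matrixP => i j; have := h i; rewrite mem_index_enum => /(_ isT) /=.
rewrite psumr_eq0 => [/allP/(_ j)|? _]; last exact: sqr_ge0.
by rewrite mem_index_enum sqrf_eq0 => /(_ isT) /eqP ->; rewrite mxE.
Qed.

Lemma frob_gt0 m n (A : 'M[R]_(m, n)) : (0 < frobenius_norm A) = (A != 0).
Proof. by rewrite lt_neqAle frob_ge0 andbT eq_sym frob_eq0. Qed.

Lemma frob0 m n : frobenius_norm (0 : 'M[R]_(m, n)) = 0.
Proof. by apply/eqP; rewrite frob_eq0. Qed.

Lemma frobZ m n (a : R) (A : 'M[R]_(m, n)) :
  frobenius_norm (a *: A) = `|a| * frobenius_norm A.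
Proof.
apply/eqP; rewrite -(@eqrXn2 _ 2)// ?mulr_ge0 ?frob_ge0//.
rewrite exprMn !frob_sqr -scalemxAr mxtraceZ [(a *: A)^T]linearZ /= -scalemxAl mxtraceZ mulrA.
by rewrite real_normK ?num_real// expr2.
Qed.

Lemma frobN m n (A : 'M[R]_(m, n)) : frobenius_norm (- A) = frobenius_norm A.
Proof. by rewrite -scaleN1r frobZ normrN normr1 mul1r. Qed.

Lemma frobB m n (A B : 'M[R]_(m, n)) : frobenius_norm (A - B) = frobenius_norm (B - A).
Proof. by rewrite -opprB frobN. Qed.

Lemma frob_cauchy_schwarz m n (A B : 'M[R]_(m, n)) :
  `|\tr (A^T *m B)| <= frobenius_norm A * frobenius_norm B.
Proof.
rewrite -(ler_sqr _ _) ?nnegrE ?mulr_ge0 ?frob_ge0//.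
rewrite real_normK ?num_real// exprMn !frob_sqr.
apply: (cauchy_schwarz (f := fun A B : 'M[R]_(m, n) => \tr (A^T *m B))).
- by move=> a u v w; rewrite linearD linearZ /= mulmxDl -scalemxAl raddfD /= mxtraceZ.
- by move=> u v; rewrite -mxtrace_tr trmx_mul trmxK.
- by move=> u; rewrite -frob_sqr sqr_ge0.
Qed.

Lemma frobD m n (A B : 'M[R]_(m, n)) :
  frobenius_norm (A + B) <= frobenius_norm A + frobenius_norm B.
Proof.
rewrite -(ler_sqr _ _) ?nnegrE ?addr_ge0 ?frob_ge0//.
have := ler_norm (\tr (A^T *m B)); move/le_trans/(_ (frob_cauchy_schwarz A B)).
rewrite sqrrD !frob_sqr [(A + B)^T]linearD /= mulmxDl !mulmxDr !raddfD /=.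
have -> : \tr (B^T *m A) = \tr (A^T *m B) by rewrite -mxtrace_tr trmx_mul trmxK.
move: (frobenius_norm A * _) (\tr (A^T *m A)) (\tr (A^T *m B)) (\tr (B^T *m B)) => a b c d.
rewrite mulr2n; lra.
Qed.

Lemma frobM m n p (A : 'M[R]_(m, n)) (B : 'M[R]_(n, p)) :
  frobenius_norm (A *m B) <= frobenius_norm A * frobenius_norm B.
Proof.
rewrite -(ler_sqr _ _) ?nnegrE ?mulr_ge0 ?frob_ge0//.
rewrite exprMn !frob_sqrE big_distrlr /=.
have -> : \sum_i \sum_j (\sum_j0 A i j0 ^+ 2) * (\sum_j0 B j j0 ^+ 2) =
  \sum_i (\sum_j A i j ^+ 2) * \sum_k \sum_j B j k ^+ 2.
  apply: eq_bigr => i _; rewrite -mulr_sumr; congr (_ * _); exact: exchange_big.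
apply: ler_sum => i _; rewrite mulr_sumr; apply: ler_sum => k _.
have -> : (A *m B) i k = \tr (((row i A)^T)^T *m col k B).
  by rewrite trmxK mxtrace11 !mxE; apply: eq_bigr => j _; rewrite !mxE.
rewrite -real_normK ?num_real//.
apply: le_trans (lerXn2r 2 _ _ (frob_cauchy_schwarz _ _)) _; rewrite ?nnegrE ?mulr_ge0 ?frob_ge0//.
rewrite exprMn !frob_sqrE.
under [X in X * _ <= _]eq_bigr do rewrite big_ord1 !mxE.
by under [X in _ * X <= _]eq_bigr do rewrite big_ord1 !mxE.
Qed.

Lemma spectral_set_ub m n (A : 'M[R]_(m, n)) :
  has_ubound [set frobenius_norm (A *m v) | v in [set v : 'cV[R]_n | frobenius_norm v <= 1]].
Proof.
exists (frobenius_norm A) => _ [v /= v1 <-].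
by rewrite (le_trans (frobM _ _))// ler_piMr ?frob_ge0.
Qed.

Lemma spectral_norm_ge0 m n (A : 'M[R]_(m, n)) : 0 <= spectral_norm A.
Proof.
apply: ub_le_sup; first exact: spectral_set_ub.
by exists 0; rewrite /= ?frob0 ?ler01// mulmx0 frob0.
Qed.

Lemma spectral_normP m n (A : 'M[R]_(m, n)) (v : 'cV[R]_n) :
  frobenius_norm (A *m v) <= spectral_norm A * frobenius_norm v.
Proof.
have [->|v0] := eqVneq v 0; first by rewrite mulmx0 !frob0 mulr0.
have fv : 0 < frobenius_norm v by rewrite frob_gt0.
rewrite -ler_pdivrMr//; apply: ub_le_sup; first exact: spectral_set_ub.
exists ((frobenius_norm v)^-1 *: v).
  by rewrite /= frobZ ger0_norm ?invr_ge0 ?frob_ge0// mulVf ?gt_eqF.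
by rewrite -scalemxAr frobZ ger0_norm ?invr_ge0 ?frob_ge0// mulrC.
Qed.

Lemma spectral_norm_le m n (A : 'M[R]_(m, n)) b : 0 <= b ->
  (forall v : 'cV[R]_n, frobenius_norm (A *m v) <= b * frobenius_norm v) ->
  spectral_norm A <= b.
Proof.
move=> b0 Ab; apply: ge_sup.
  by exists 0, 0; rewrite /= ?frob0 ?ler01// mulmx0 frob0.
by move=> _ [v /= v1 <-]; rewrite (le_trans (Ab v))// ler_piMr.
Qed.

Lemma quad_le_spectral n (A : 'M[R]_n) (v : 'cV[R]_n) :
  (v^T *m A *m v) 0 0 <= spectral_norm A * frobenius_norm v ^+ 2.
Proof.
rewrite -mxtrace11 -mulmxA (le_trans (ler_norm _))//.
rewrite (le_trans (frob_cauchy_schwarz _ _))// expr2 mulrCA.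
by rewrite ler_wpM2l ?frob_ge0// spectral_normP.
Qed.

Lemma quad_cauchy_schwarz n (A : 'M[R]_n) : A^T = A ->
  (forall v : 'cV[R]_n, 0 <= (v^T *m A *m v) 0 0) ->
  forall u v : 'cV[R]_n, (u^T *m A *m v) 0 0 ^+ 2 <=
    (u^T *m A *m u) 0 0 * (v^T *m A *m v) 0 0.
Proof.
move=> sA A0; apply: (cauchy_schwarz (f := fun u v : 'cV[R]_n => (u^T *m A *m v) 0 0)) => //.
- by move=> a u v w; rewrite linearD linearZ /= !mulmxDl -!scalemxAl !mxE.
- move=> u v; rewrite -[LHS]mxtrace11 -mxtrace_tr mxtrace11.
  by rewrite !trmx_mul trmxK sA mulmxA.
Qed.

Lemma posdef_ge0 n (A : 'M[R]_n) : posdef A ->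
  forall v : 'cV[R]_n, 0 <= (v^T *m A *m v) 0 0.
Proof.
move=> [_ pA] v; have [->|v0] := eqVneq v 0; first by rewrite mulmx0 mxE.
exact/ltW/pA.
Qed.

(** Cauchy-Schwarz for the form of [A] between [w = A v] and [v] gives [|w|^4 <= (w^T A w) (v^T A v)
    <= b^2 |w|^2 |v|^2]. *)
Lemma spectral_norm_le_quad n (A : 'M[R]_n) (b : R) : posdef A -> 0 <= b ->
  (forall v : 'cV[R]_n, (v^T *m A *m v) 0 0 <= b * frobenius_norm v ^+ 2) ->
  spectral_norm A <= b.
Proof.
move=> pA b0 Ab; apply: spectral_norm_le => // v.
set w := A *m v.
have [->|w0] := eqVneq w 0; first by rewrite frob0 mulr_ge0 ?frob_ge0.
have fw : 0 < frobenius_norm w by rewrite frob_gt0.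
have := quad_cauchy_schwarz pA.1 (posdef_ge0 pA) w v.
rewrite -mulmxA -/w -frob_col => h.
have {}h : (frobenius_norm w ^+ 2) ^+ 2 <=
    (b * frobenius_norm w ^+ 2) * (b * frobenius_norm v ^+ 2).
  by apply: le_trans h _; rewrite ler_pM ?posdef_ge0.
have : (frobenius_norm w * frobenius_norm w) ^+ 2 <=
    (frobenius_norm w * (b * frobenius_norm v)) ^+ 2.
  by apply: le_trans (le_trans h _); rewrite ?expr2// le_eqVlt; apply/orP; left; apply/eqP; ring.
rewrite ler_sqr ?nnegrE ?mulr_ge0 ?frob_ge0//.
by rewrite ler_pM2l.
Qed.

(** Cauchy-Schwarz for the form of [A] between [v] and [invmx A v]: the mixed term is [|v|^2]. *)
Lemma quad_inv_ge n (A : 'M[R]_n) (a : R) : posdef A -> 0 < a ->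
  (forall v : 'cV[R]_n, (v^T *m A *m v) 0 0 <= a * frobenius_norm v ^+ 2) ->
  forall v : 'cV[R]_n, frobenius_norm v ^+ 2 / a <= (v^T *m invmx A *m v) 0 0.
Proof.
move=> pA a0 Aa v; have uA := posdef_unitmx pA.
have [->|v0] := eqVneq v 0; first by rewrite frob0 mulmx0 mxE expr0n mul0r.
have fv : 0 < frobenius_norm v ^+ 2 by rewrite exprn_gt0// frob_gt0.
have := quad_cauchy_schwarz pA.1 (posdef_ge0 pA) v (invmx A *m v).
rewrite -(mulmxA v^T) mulKVmx// -frob_col trmx_mul trmx_inv pA.1.
rewrite -!mulmxA mulKVmx// !mulmxA => h.
rewrite ler_pdivrMr// -(ler_pM2l fv) -expr2 (le_trans h)// mulrA mulrAC.
apply: ler_wpM2r; first exact: posdef_ge0 (posdef_inv pA) v.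
by rewrite mulrC.
Qed.

Lemma tr_quad m n (A : 'M[R]_n) (B : 'M[R]_(n, m)) :
  \tr (B^T *m A *m B) = \sum_j ((col j B)^T *m A *m col j B) 0 0.
Proof.
rewrite /mxtrace; apply: eq_bigr => j _.
rewrite tr_col -row_mul !mxE; apply: eq_bigr => k _.
by rewrite [row _ _ _ _]mxE [col _ _ _ _]mxE.
Qed.

End norms.

(** * Compactness, extreme eigenvalues, strong convexity of minus log det *)

Section matrix_calculus.
Context {R : realType}.

Lemma continuous_sum_fun (T : topologicalType) I (r : seq I) (P : pred I) (F : I -> T -> R) :
  (forall i, continuous (F i)) -> continuous (fun x => \sum_(i <- r | P i) F i x).
Proof. by move=> cF; apply: continuous_big => // -[x y]; exact: add_continuous. Qed.

Lemma continuous_prod_fun (T : topologicalType) I (r : seq I) (P : pred I) (F : I -> T -> R) :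
  (forall i, continuous (F i)) -> continuous (fun x => \prod_(i <- r | P i) F i x).
Proof. by move=> cF; apply: continuous_big => // -[x y]; exact: mul_continuous. Qed.

Lemma continuous_det n : continuous (fun A : 'M[R]_n => \det A).
Proof.
apply: continuous_sum_fun => s; apply: continuousM_fun.
  exact: cst_continuous.
by apply: continuous_prod_fun => i; exact: coord_continuous.
Qed.

Lemma compact_mx_box m n (K : R) :
  compact [set A : 'M[R]_(m, n) | forall i j, `|A i j| <= K].
Proof.
pose B := [set v : 'rV[R]_(m * n) | forall i, `[- K, K]%classic (v ord0 i)].
have cB : compact B by apply: (@rV_compact _ _ (fun=> `[- K, K]%classic)) => _; exact: segment_compact.
have -> : [set A : 'M[R]_(m, n) | forall i j, `|A i j| <= K] = vec_mx @` B.
  apply/seteqP; split => [A /= AK|_ [v /= vB <-] i j].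
    exists (mxvec A); last exact: mxvecK.
    by move=> k; case/mxvec_indexP: k => i j; rewrite mxvecE /= in_itv /= -ler_norml.
  by have := vB (mxvec_index i j); rewrite /= in_itv /= -ler_norml mxE.
apply: continuous_compact => //; apply: continuous_subspaceT => v A [P nP PA].
have : nbhs v (fun u : 'rV[R]_(m * n) =>
    forall ij : 'I_m * 'I_n, P ij.1 ij.2 (u ord0 (mxvec_index ij.1 ij.2))).
  apply: (@filter_forall _ _ (fun (ij : 'I_m * 'I_n) (u : 'rV[R]_(m * n)) =>
    P ij.1 ij.2 (u ord0 (mxvec_index ij.1 ij.2))) (nbhs v)) => -[i j] /=.
  by apply: (@coord_continuous _ _ _ ord0 (mxvec_index i j) v); have := nP i j; rewrite mxE.
apply: filterS => u h; apply: PA => i j.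
by rewrite mxE; exact: (h (i, j)).
Qed.

Lemma mx_EVT_min m n (f : 'M[R]_(m, n) -> R) (A : set 'M[R]_(m, n)) (K : R) :
  A !=set0 -> closed A -> (forall M, A M -> forall i j, `|M i j| <= K) ->
  {in A, continuous f} -> exists2 c, A c & forall M, A M -> f c <= f M.
Proof.
move=> A0 clA AK cf.
have cA : compact A by apply: subclosed_compact clA (@compact_mx_box m n K) _.
have [c cc h] := compact_EVT_min A0 cA (continuous_in_subspaceT cf).
by exists c; [rewrite inE in cc | move=> M AM; apply: h; rewrite inE].
Qed.

Lemma mx_entry_le_frob m n (A : 'M[R]_(m, n)) i j : `|A i j| <= frobenius_norm A.
Proof.
rewrite -ler_sqr ?nnegrE ?frob_ge0// real_normK ?num_real// frob_sqrE.
rewrite (bigD1 i)//= (bigD1 j)//= -addrA lerDl addr_ge0//.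
  by apply: sumr_ge0 => ? _; exact: sqr_ge0.
by do 2 (apply: sumr_ge0 => ? _); exact: sqr_ge0.
Qed.

Lemma closed_frob_ball m n (C : 'M[R]_(m, n)) (r : R) : 0 <= r ->
  closed [set A : 'M[R]_(m, n) | frobenius_norm (A - C) <= r].
Proof.
move=> r0.
pose g (A : 'M[R]_(m, n)) := \sum_i \sum_j (A i j - C i j) * (A i j - C i j).
have gE A : g A = frobenius_norm (A - C) ^+ 2.
  by rewrite frob_sqrE; apply: eq_bigr => i _; apply: eq_bigr => j _; rewrite !mxE expr2.
have -> : [set A : 'M[R]_(m, n) | frobenius_norm (A - C) <= r] = g @^-1` `]-oo, r ^+ 2].
  by apply/seteqP; split => A /=; rewrite in_itv /= gE ler_sqr ?nnegrE ?frob_ge0.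
apply: preimage_closed; last exact: lray_closed.
have cij i j : continuous (fun A : 'M[R]_(m, n) => A i j - C i j).
  by apply: continuousD_fun; [exact: coord_continuous|exact: cst_continuous].
move=> A _; apply: continuous_sum_fun => i; apply: continuous_sum_fun => j.
exact: continuousM_fun.
Qed.

(** The minimum of the quadratic form over the compact unit sphere is an eigenvalue. The dimension
    is a successor so that the sphere is nonempty. *)
Lemma eigenvalue_min n (A : 'M[R]_n.+1) : A^T = A ->
  exists2 a, eigenvalue A a &
    forall v : 'cV[R]_n.+1, a * frobenius_norm v ^+ 2 <= (v^T *m A *m v) 0 0.
Proof.
move=> sA.
pose q (v : 'cV[R]_n.+1) := (v^T *m A *m v) 0 0.
have qZ a (v : 'cV[R]_n.+1) : q (a *: v) = a ^+ 2 * q v.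
  by rewrite /q [(a *: v)^T]linearZ /= -scalemxAr -!scalemxAl !mxE mulrA -expr2.
have cq : continuous q.
  have -> : q = fun v => \sum_j (\sum_i v i 0 * A i j) * v j 0.
    apply/funext => v; rewrite /q mxE; apply: eq_bigr => j _; rewrite mxE.
    by congr (_ * _); apply: eq_bigr => i _; rewrite mxE.
  apply: continuous_sum_fun => j; apply: continuousM_fun; last exact: coord_continuous.
  apply: continuous_sum_fun => i; apply: continuousM_fun; first exact: coord_continuous.
  exact: cst_continuous.
pose S := [set v : 'cV[R]_n.+1 | frobenius_norm v ^+ 2 = 1].
have SE : S = (fun v : 'cV[R]_n.+1 => \sum_i \sum_j v i j * v i j) @^-1` [set 1].
  apply/seteqP; split => v; rewrite /S /= frob_sqrE => <-;
    by apply: eq_bigr => i _; apply: eq_bigr => j _; rewrite expr2.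
have clS : closed S.
  rewrite SE; apply: preimage_closed; last exact: closed_eq.
  move=> v _; apply: continuous_sum_fun => i; apply: continuous_sum_fun => j.
  by apply: continuousM_fun; exact: coord_continuous.
have normS (v : 'cV[R]_n.+1) : v != 0 -> S ((frobenius_norm v)^-1 *: v).
  move=> v0; rewrite /S /= frobZ ger0_norm ?invr_ge0 ?frob_ge0// mulVf ?expr1n//.
  by rewrite frob_eq0.
have S0 : S !=set0.
  have v0 : (const_mx 1 : 'cV[R]_n.+1) != 0.
    by apply/eqP => /matrixP/(_ 0 0); rewrite !mxE => /eqP; rewrite oner_eq0.
  by exists ((frobenius_norm (const_mx 1 : 'cV[R]_n.+1))^-1 *: const_mx 1); exact: normS.
have [v Sv qv] : exists2 v, S v & forall w, S w -> q v <= q w.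
  apply: (@mx_EVT_min _ _ q S 1) => // w Sw i j.
  by rewrite (le_trans (mx_entry_le_frob _ _ _))// -(@expr_le1 _ 2) ?frob_ge0 ?Sw.
have qge w : q v * frobenius_norm w ^+ 2 <= q w.
  have [->|w0] := eqVneq w 0; first by rewrite frob0 expr0n mulr0 /q mulmx0 mxE.
  have fw : frobenius_norm w != 0 by rewrite frob_eq0.
  have := qv _ (normS _ w0); rewrite qZ exprVn mulrC ler_pdivlMr//.
  by rewrite exprn_gt0// frob_gt0.
exists (q v) => //.
pose B := A - (q v)%:M.
have sB : B^T = B by rewrite linearB /= sA tr_scalar_mx.
have qB w : (w^T *m B *m w) 0 0 = q w - q v * frobenius_norm w ^+ 2.
  by rewrite -mxtrace11 mulmxBr mulmxBl mul_mx_scalar -scalemxAl raddfB /= mxtraceZ !mxtrace11 -frob_col.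
have B0 (w : 'cV[R]_n.+1) : 0 <= (w^T *m B *m w) 0 0 by rewrite qB subr_ge0.
(* [B] is semidefinite and its form vanishes at [v], so by Cauchy-Schwarz its product of [v] with
   every vector vanishes; against [B v] that product is [|v^T B|^2]. *)
have vB : v^T *m B = 0.
  apply/eqP; rewrite -frob_eq0 -sqrf_eq0.
  have := quad_cauchy_schwarz sB B0 v (v^T *m B)^T.
  rewrite qB Sv mulr1 subrr mul0r => h.
  have : (v^T *m B *m (v^T *m B)^T) 0 0 == 0 by rewrite -sqrf_eq0 eq_le h sqr_ge0.
  by rewrite frob_sqr -mxtrace11 mxtrace_mulC.
apply/eigenvalueP; exists v^T.
  by apply/eqP; rewrite -subr_eq0 -mul_mx_scalar -mulmxBr; exact/eqP.
rewrite trmx_eq0; apply/eqP => v0; move: Sv; rewrite /S /= v0 frob0 expr0n /=.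
by move/eqP; rewrite eq_sym oner_eq0.
Qed.

Lemma quad_eigenvalue n (A : 'M[R]_n) a : eigenvalue A a ->
  exists2 v : 'cV[R]_n, v != 0 & (v^T *m A *m v) 0 0 = a * frobenius_norm v ^+ 2.
Proof.
move=> /eigenvalueP[v vA v0]; exists v^T; first by rewrite trmx_eq0.
by rewrite trmxK vA -scalemxAl frob_col trmxK mxE.
Qed.

Lemma quad_ge_lambda_min n (A : 'M[R]_n) (v : 'cV[R]_n) : A^T = A ->
  lambda_min A * frobenius_norm v ^+ 2 <= (v^T *m A *m v) 0 0.
Proof.
case: n A v => [|n] A v sA.
  by rewrite [v]flatmx0 frob0 mulmx0 mxE expr0n mulr0.
have [a ea Aa] := eigenvalue_min sA.
apply: le_trans (Aa v); rewrite ler_wpM2r ?sqr_ge0//.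
apply: ge_inf => //; exists a => b /= /quad_eigenvalue[w w0 qw].
by have := Aa w; rewrite qw ler_pM2r// exprn_gt0// frob_gt0.
Qed.

Lemma quad_le_lambda_max n (A : 'M[R]_n) (v : 'cV[R]_n) : A^T = A ->
  (v^T *m A *m v) 0 0 <= lambda_max A * frobenius_norm v ^+ 2.
Proof.
case: n A v => [|n] A v sA.
  by rewrite [v]flatmx0 frob0 mulmx0 mxE expr0n mulr0.
have sN : (- A)^T = - A by rewrite linearN /= sA.
have qN (w : 'cV[R]_n.+1) : (w^T *m (- A) *m w) 0 0 = - (w^T *m A *m w) 0 0.
  by rewrite mulmxN mulNmx mxE.
have [a ea Aa] := eigenvalue_min sN.
have {}Aa (w : 'cV[R]_n.+1) : (w^T *m A *m w) 0 0 <= - a * frobenius_norm w ^+ 2.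
  by have := Aa w; rewrite qN mulNr lerNr.
apply: le_trans (Aa v) _; rewrite ler_wpM2r ?sqr_ge0//.
apply: ub_le_sup; first exists (- a) => b /= /quad_eigenvalue[w w0 qw].
  by have := Aa w; rewrite qw ler_pM2r// exprn_gt0// frob_gt0.
move: ea => /eigenvalueP[w wA w0]; apply/eigenvalueP; exists w => //.
by rewrite scaleNr -wA mulmxN opprK.
Qed.

Lemma sum_frob_col m n (B : 'M[R]_(m, n)) :
  \sum_j frobenius_norm (col j B) ^+ 2 = frobenius_norm B ^+ 2.
Proof.
rewrite [RHS]frob_sqr -[B^T in RHS]mulmx1 tr_quad; apply: eq_bigr => j _.
by rewrite frob_col mulmx1.
Qed.

(** Strong convexity of minus log det. With [D = B - A] the difference of inverses is
    [invmx A D invmx B], and writing [invmx B = G G^T] turns the trace into the form of [invmx A]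
    summed over the columns of [D G]; [quad_inv_ge] is then used once for each inverse. *)
Lemma invmx_sub_inner n (A B : 'M[R]_n) (a b : R) : posdef A -> posdef B ->
  0 < a -> 0 < b ->
  (forall v : 'cV[R]_n, (v^T *m A *m v) 0 0 <= a * frobenius_norm v ^+ 2) ->
  (forall v : 'cV[R]_n, (v^T *m B *m v) 0 0 <= b * frobenius_norm v ^+ 2) ->
  frobenius_norm (B - A) ^+ 2 / (a * b) <=
    \tr ((invmx A - invmx B) *m (B - A)).
Proof.
move=> pA pB a0 b0 Aa Bb; set D := B - A.
have sD : D^T = D by rewrite linearB /= pA.1 pB.1.
have -> : invmx A - invmx B = invmx A *m D *m invmx B.
  rewrite mulmxBr mulmxBl mulVmx ?posdef_unitmx// mul1mx.
  by rewrite mulmxK ?posdef_unitmx.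
have [G uG GE] := posdef_invE (posdef_inv pB).
have -> : \tr (invmx A *m D *m invmx B *m D) = \tr ((D *m G)^T *m invmx A *m (D *m G)).
  by rewrite GE [RHS]mxtrace_mulC trmx_mul sD -!mulmxA [LHS]mxtrace_mulC !mulmxA.
rewrite tr_quad; apply: (@le_trans _ _ (frobenius_norm (D *m G) ^+ 2 / a)); last first.
  rewrite -sum_frob_col mulr_suml; apply: ler_sum => j _.
  exact: quad_inv_ge.
rewrite invfM mulrA mulrAC ler_wpM2r ?invr_ge0 ?(ltW a0)//.
have -> : frobenius_norm (D *m G) ^+ 2 = \tr (D^T *m invmx B *m D).
  by rewrite frob_sqr mxtrace_mulC trmx_mul GE !mulmxA sD.
rewrite tr_quad -(sum_frob_col D) mulr_suml; apply: ler_sum => j _.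
exact: quad_inv_ge.
Qed.

End matrix_calculus.

(** * Local error bounds for penalized minimizers *)

Section penalized_likelihood.
Context {R : realType}.

Lemma posdef_convex n (A B : 'M[R]_n) (t : R) : posdef A -> posdef B -> 0 <= t <= 1 ->
  posdef (A + t *: (B - A)).
Proof.
move=> [sA pA] [sB pB] /andP[t0 t1]; split; first by rewrite linearD linearZ linearB /= sA sB.
move=> v v0.
have -> : A + t *: (B - A) = (1 - t) *: A + t *: B.
  by rewrite scalerBr scalerBl scale1r addrAC addrA.
rewrite -mxtrace11 mulmxDr mulmxDl -!scalemxAr -!scalemxAl raddfD /= !mxtraceZ !mxtrace11.
have qA := pA v v0; have qB := pB v v0.
move: t0; rewrite le_eqVlt => /orP[/eqP<-|t0].
  by rewrite subr0 mul1r mul0r addr0.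
by rewrite ltr_wpDl ?mulr_gt0// mulr_ge0 ?(ltW qA)// subr_ge0.
Qed.

Lemma loss_convex n (S A B : 'M[R]_n) (t : R) : posdef A -> posdef B -> 0 <= t <= 1 ->
  loss S (A + t *: (B - A)) <= loss S A + t * (loss S B - loss S A).
Proof.
move=> pA pB t01; have pC := posdef_convex pA pB t01; move: t01 => /andP[t0 t1].
set C := A + _ in pC *.
have lA := ln_det_le pC pA; have lB := ln_det_le pC pB.
have AC : A - C = - t *: (B - A) by rewrite /C opprD addNKr scaleNr.
have BC : B - C = (1 - t) *: (B - A).
  by rewrite /C opprD addrA scalerBl scale1r.
rewrite AC -scalemxAr mxtraceZ in lA; rewrite BC -scalemxAr mxtraceZ in lB.
rewrite /loss.
have -> : \tr (C^T *m S) = \tr (A^T *m S) + t * (\tr (B^T *m S) - \tr (A^T *m S)).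
  by rewrite /C linearD linearZ linearB /= mulmxDl -scalemxAl mulmxBl raddfD /= mxtraceZ raddfB.
move: lA lB; set x := \tr (invmx C *m _); set lc := ln (\det C).
set la := ln (\det A); set lb := ln (\det B); move: (\tr _) (\tr _) => p q lA lB.
have h1 : (1 - t) * la <= (1 - t) * (lc + - t * x) by rewrite ler_wpM2l// subr_ge0.
have h2 : t * lb <= t * (lc + (1 - t) * x) by rewrite ler_wpM2l.
lra.
Qed.

Lemma off_l1_convex n (L A B : 'M[R]_n) (t : R) : (forall i j, 0 <= L i j) -> 0 <= t <= 1 ->
  off_l1_norm (hadamard L (A + t *: (B - A))) <=
  off_l1_norm (hadamard L A) + t * (off_l1_norm (hadamard L B) - off_l1_norm (hadamard L A)).
Proof.
move=> L0 /andP[t0 t1].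
rewrite -sumrB mulr_sumr -big_split /=; apply: ler_sum => i _.
rewrite -sumrB mulr_sumr -big_split /=; apply: ler_sum => j _.
rewrite !mxE !normrM !(ger0_norm (L0 i j)) -mulrBr mulrCA -mulrDr ler_wpM2l//.
have -> : A i j + t * (B i j - A i j) = (1 - t) * A i j + t * B i j by ring.
rewrite (le_trans (ler_normD _ _))// !normrM (ger0_norm t0) ger0_norm ?subr_ge0//.
by rewrite mulrBr mulrBl mul1r; lra.
Qed.

Lemma penalized_loss_convex n (S L A B : 'M[R]_n) (t : R) : (forall i j, 0 <= L i j) ->
  posdef A -> posdef B -> 0 <= t <= 1 ->
  penalized_loss S L (A + t *: (B - A)) <=
    penalized_loss S L A + t * (penalized_loss S L B - penalized_loss S L A).
Proof.
move=> L0 pA pB t01; rewrite /penalized_loss.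
have := loss_convex S pA pB t01; have := off_l1_convex A B L0 t01.
move: (loss _ _) (loss _ _) (loss _ _) (off_l1_norm _) (off_l1_norm _) (off_l1_norm _).
move=> a b c x y z; lra.
Qed.

(* The concavity of log det at the perturbed point replaces the stationarity
   condition, so no derivative of the objective is needed. *)
Lemma variational_inequality n (S L A B : 'M[R]_n) (t : R) : (forall i j, 0 <= L i j) ->
  posdef A -> posdef B -> 0 < t <= 1 ->
  penalized_loss S L A <= penalized_loss S L (A + t *: (B - A)) ->
  off_l1_norm (hadamard L A) - off_l1_norm (hadamard L B) <=
    \tr ((S - invmx (A + t *: (B - A))) *m (B - A)).
Proof.
move=> L0 pA pB /andP[t0 t1] AC; have t01 : 0 <= t <= 1 by rewrite (ltW t0).
have pC := posdef_convex pA pB t01; set C := A + _ in pC AC *.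
have lA := ln_det_le pC pA.
have CA : A - C = - t *: (B - A) by rewrite /C opprD addNKr scaleNr.
rewrite CA -scalemxAr mxtraceZ in lA.
have pen := off_l1_convex A B L0 t01; rewrite -/C in pen.
move: AC; rewrite /penalized_loss /loss.
have -> : \tr (C^T *m S) = \tr (A^T *m S) + t * \tr (S *m (B - A)).
  rewrite (mxtrace_mulC S) /C linearD linearZ /= [(B - A)^T]linearB /= pA.1 pB.1.
  by rewrite mulmxDl -scalemxAl raddfD /= mxtraceZ.
rewrite mulmxBl [\tr (S *m _ - _)]raddfB /=.
move: lA pen; set x := \tr (invmx C *m _); set lc := ln (\det C); set la := ln (\det A).
set pa := off_l1_norm (hadamard L A); set pc := off_l1_norm (hadamard L C).
move: (off_l1_norm _) (\tr _) (\tr _) => pb y z h1 h2 h3.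
rewrite -(ler_pM2l t0); lra.
Qed.

Lemma sum_abs_le_frob n (A D : 'M[R]_n) :
  \sum_i \sum_j `|A i j| * `|D i j| <= frobenius_norm A * frobenius_norm D.
Proof.
pose ab (M : 'M[R]_n) : 'M[R]_n := map_mx Num.norm M.
have fab M : frobenius_norm (ab M) = frobenius_norm M.
  congr Num.sqrt; apply: eq_bigr => i _; apply: eq_bigr => j _.
  by rewrite mxE real_normK ?num_real.
rewrite -(fab A) -(fab D); apply: le_trans (frob_cauchy_schwarz _ _).
apply: le_trans (ler_norm _); rewrite exchange_big /mxtrace; apply: ler_sum => j _.
by rewrite mxE; apply: ler_sum => i _; rewrite !mxE.
Qed.

(** Entry by entry. On the support both the gradient and the change of penalty are paid for. On [E]
    only the gradient is, the penalty of [A] being dropped. Elsewhere [Th] vanishes and the penalty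
    of [A] absorbs the gradient. *)
Lemma gradient_penalty_bound n (Th A G L : 'M[R]_n) (E : {set 'I_n * 'I_n}) :
  G^T = G -> (forall i, G i i = 0) -> (forall i j, 0 <= L i j) ->
  (forall i j, i != j -> (i, j) \notin off_support Th -> (i, j) \notin E ->
     `|G i j| <= L i j) ->
  \tr (G *m (Th - A)) + off_l1_norm (hadamard L Th) - off_l1_norm (hadamard L A) <=
  (frobenius_norm (restrict_mx (off_support Th) G) + frobenius_norm (restrict_mx E G) +
   frobenius_norm (restrict_mx (off_support Th) L)) * frobenius_norm (Th - A).
Proof.
move=> sG G0 L0 GL; rewrite !mulrDl.
apply: le_trans (lerD (lerD (sum_abs_le_frob _ _) (sum_abs_le_frob _ _)) (sum_abs_le_frob _ _)).
have -> : \tr (G *m (Th - A)) = \sum_i \sum_j G i j * (Th i j - A i j).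
  rewrite -{1}sG exchange_big; apply: eq_bigr => j _; rewrite mxE.
  by apply: eq_bigr => i _; rewrite !mxE.
have offE (M : 'M[R]_n) : off_l1_norm (hadamard L M) =
    \sum_i \sum_j (if j != i then L i j * `|M i j| else 0).
  apply: eq_bigr => i _; rewrite big_mkcond; apply: eq_bigr => j _.
  by case: ifP => // _; rewrite !mxE normrM ger0_norm.
rewrite !offE -!big_split -sumrB /=; apply: ler_sum => i _.
rewrite -!big_split -sumrB /=; apply: ler_sum => j _.
rewrite !mxE.
have [<-|ji] /= := eqVneq j i.
  by rewrite G0 mul0r !addr0 subr0 !addr_ge0// mulr_ge0.
have GD : G i j * (Th i j - A i j) <= `|G i j| * `|Th i j - A i j|.
  by rewrite -normrM ler_norm.
have D0 : 0 <= `|Th i j - A i j| by [].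
have A0 : 0 <= L i j * `|A i j| by rewrite mulr_ge0.
have [ijS|ijS] := ifPn.
  rewrite (ger0_norm (L0 i j)).
  have : L i j * `|Th i j| - L i j * `|A i j| <= L i j * `|Th i j - A i j|.
    by rewrite -mulrBr ler_wpM2l// lerB_dist.
  have : 0 <= `|if (i, j) \in E then G i j else 0| * `|Th i j - A i j| by rewrite mulr_ge0.
  by move=> *; lra.
have Th0 : Th i j = 0.
  by move: ijS; rewrite inE /= eq_sym ji /= negbK => /eqP.
rewrite normr0 !mul0r addr0 add0r Th0 normr0 mulr0 addr0 sub0r normrN.
rewrite Th0 sub0r normrN in GD.
have [_|ijE] := ifPn; first lra.
have : `|G i j| * `|A i j| <= L i j * `|A i j|.
  by rewrite ler_wpM2r// GL// eq_sym.
rewrite normr0 mul0r => *; lra.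
Qed.

Lemma quad_le_frob n (D : 'M[R]_n) (v : 'cV[R]_n) :
  `|(v^T *m D *m v) 0 0| <= frobenius_norm D * frobenius_norm v ^+ 2.
Proof.
rewrite -mxtrace11 -mulmxA (le_trans (frob_cauchy_schwarz _ _))// expr2 mulrCA.
by rewrite ler_wpM2l ?frob_ge0// frobM.
Qed.

(* Restricting the perturbation to the segment from the minimizer to the truth,
   at distance [s * |Th - A|] from the truth, localizes the strong convexity. *)
Lemma segment_error_bound n (S L Th A : 'M[R]_n) (E : {set 'I_n * 'I_n}) (s : R) :
  S^T = S -> (forall i, grad_loss S Th i i = 0) -> (forall i j, 0 <= L i j) ->
  (forall i j, i != j -> (i, j) \notin off_support Th -> (i, j) \notin E ->
     `|grad_loss S Th i j| <= L i j) ->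
  posdef Th -> posdef A -> 0 < spectral_norm Th -> A != Th -> 0 < s < 1 ->
  penalized_loss S L A <= penalized_loss S L (A + (1 - s) *: (Th - A)) ->
  s * frobenius_norm (A - Th) <=
    spectral_norm Th * (spectral_norm Th + s * frobenius_norm (A - Th)) *
    (frobenius_norm (restrict_mx (off_support Th) (grad_loss S Th)) +
     frobenius_norm (restrict_mx E (grad_loss S Th)) +
     frobenius_norm (restrict_mx (off_support Th) L)).
Proof.
move=> sS G0 L0 GL pTh pA nu0 ATh /andP[s0 s1] Amin.
set nu := spectral_norm Th in nu0 *; set Del := frobenius_norm (A - Th).
have t01 : 0 < 1 - s <= 1 by lra.
have t01' : 0 <= 1 - s <= 1 by lra.
have pC := posdef_convex pA pTh t01'.
have vi := variational_inequality L0 pA pTh t01 Amin.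
set C := A + _ in pC vi.
have CTh : C - Th = - s *: (Th - A).
  by apply/matrixP => i j; rewrite !mxE; ring.
have DelE : frobenius_norm (Th - A) = Del by rewrite frobB.
have Del0 : 0 < Del by rewrite frob_gt0 subr_eq0.
have fC : frobenius_norm (C - Th) = s * Del.
  by rewrite CTh frobZ DelE normrN gtr0_norm.
have sG : (grad_loss S Th)^T = grad_loss S Th.
  by rewrite /grad_loss linearB /= sS trmx_inv pTh.1.
have gp := gradient_penalty_bound A sG G0 L0 GL; rewrite DelE in gp.
move: gp; set a := (_ + frobenius_norm (restrict_mx _ L)) => gp.
have b0 : 0 < nu + s * Del by rewrite addr_gt0// mulr_gt0.
have := invmx_sub_inner pTh pC nu0 b0 (quad_le_spectral Th).
rewrite fC CTh -scalemxAr mxtraceZ => isi.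
have {}isi : (s * Del) ^+ 2 / (nu * (nu + s * Del)) <=
    - s * \tr ((invmx Th - invmx C) *m (Th - A)).
  apply: isi => v.
  have -> : C = Th + (C - Th) by rewrite addrC subrK.
  rewrite mulmxDr mulmxDl mxE mulrDl lerD ?quad_le_spectral//.
  by rewrite -fC (le_trans _ (quad_le_frob _ _))// ler_norm.
have SE : S - invmx C = grad_loss S Th + (invmx Th - invmx C).
  by rewrite /grad_loss addrA subrK.
(* Now [vi] and [gp] bound minus the trace of [(invmx Th - invmx C) (Th - A)] above by [a * Del],
   while [isi] bounds [s] times it below by the strong convexity term. *)
rewrite SE mulmxDl raddfD /= in vi.
have nb0 : 0 < nu * (nu + s * Del) by rewrite mulr_gt0.
have : s * (s * Del * Del) <= s * (nu * (nu + s * Del) * (a * Del)).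
  move: isi; rewrite ler_pdivrMr// => isi.
  have -> : s * (s * Del * Del) = (s * Del) ^+ 2 by ring.
  apply: le_trans isi _.
  set x := \tr (_ *m (Th - A)); set N := nu * _.
  have -> : - s * x * N = s * (N * - x) by ring.
  rewrite ler_pM2l// ler_pM2l// /x.
  move: vi gp; move: (\tr _) (\tr _) (off_l1_norm _) (off_l1_norm _) => p q x1 y1; lra.
by rewrite ler_pM2l// !mulrA ler_pM2r.
Qed.

End penalized_likelihood.

(** * Existence and error of a minimizer near the truth *)

Section localization.
Context {R : realType} {n : nat} (S L Th : 'M[R]_n) (E : {set 'I_n * 'I_n}) (r : R).
Hypothesis S_sym : S^T = S.
Hypothesis grad_diag0 : forall i, grad_loss S Th i i = 0.
Hypothesis L_ge0 : forall i j, 0 <= L i j.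
Hypothesis grad_le_L : forall i j, i != j -> (i, j) \notin off_support Th ->
  (i, j) \notin E -> `|grad_loss S Th i j| <= L i j.
Hypothesis Th_posdef : posdef Th.
Hypothesis r_gt0 : 0 < r.
Hypothesis r_le : r <= spectral_norm Th.
Hypothesis Th_ge : forall v : 'cV[R]_n, 2 * r * frobenius_norm v ^+ 2 <= (v^T *m Th *m v) 0 0.

Let F := penalized_loss S L.
Let nu := spectral_norm Th.
Let a := frobenius_norm (restrict_mx (off_support Th) (grad_loss S Th)) +
     frobenius_norm (restrict_mx E (grad_loss S Th)) +
     frobenius_norm (restrict_mx (off_support Th) L).
Hypothesis a_small : 3 * nu ^+ 2 * a < r.

Let a_ge0 : 0 <= a. Proof. by rewrite !addr_ge0 ?frob_ge0. Qed.

Let nu_gt0 : 0 < nu. Proof. exact: lt_le_trans r_le. Qed.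

(** If the error is at most [r <= nu], the point [s = 1/2] gives half the error at most
    [nu (nu + nu / 2) a], whence the factor [3]. If it exceeds [r], the point at distance exactly
    [r] from [Th] gives [r <= 2 nu^2 a], against [a_small]. *)
Lemma minimizer_error (A : 'M[R]_n) : posdef A ->
  (forall s, 0 < s < 1 -> F A <= F (A + (1 - s) *: (Th - A))) ->
  frobenius_norm (A - Th) <= 3 * nu ^+ 2 * a.
Proof.
move=> pA Amin.
have n2 : 0 < nu ^+ 2 by rewrite exprn_gt0.
have [->|ATh] := eqVneq A Th.
  by rewrite subrr frob0 !mulr_ge0// ltW.
have Del0 : 0 < frobenius_norm (A - Th) by rewrite frob_gt0 subr_eq0.
have seg s : 0 < s < 1 -> s * frobenius_norm (A - Th) <=
    nu * (nu + s * frobenius_norm (A - Th)) * a.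
  by move=> s01; apply: segment_error_bound => //; exact: Amin.
move: seg Del0; set Del := frobenius_norm _ => seg Del0.
have [Dr|rD] := leP Del r.
  have half : 0 < (2^-1 : R) < 1 by lra.
  have := seg _ half.
  have h2 : nu * (nu + 2^-1 * Del) * a <= nu * (nu + 2^-1 * nu) * a.
    by rewrite ler_wpM2r// ler_wpM2l ?(ltW nu_gt0)// lerD2l ler_wpM2l//; exact: le_trans r_le.
  move=> h; have := le_trans h h2.
  have -> : nu * (nu + 2^-1 * nu) * a = 2^-1 * (3 * nu ^+ 2 * a) by field.
  by rewrite ler_pM2l.
have s01 : 0 < r / Del < 1 by rewrite divr_gt0//= ltr_pdivrMr ?mul1r.
have := seg _ s01; rewrite divfK ?gt_eqF// => h.
have h2 : nu * (nu + r) * a <= nu * (nu + nu) * a.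
  by rewrite ler_wpM2r// ler_wpM2l ?(ltW nu_gt0)// lerD2l.
have := le_trans h h2.
have -> : nu * (nu + nu) * a = 2 * (nu ^+ 2 * a) by ring.
have : 0 <= nu ^+ 2 * a by rewrite mulr_ge0// ltW.
move: a_small; rewrite -mulrA; move: (nu ^+ 2 * a) => x; lra.
Qed.

Lemma ball_posdef (A : 'M[R]_n) : A^T = A -> frobenius_norm (A - Th) <= r -> posdef A.
Proof.
move=> sA Ar; split=> // v v0.
have fv : 0 < frobenius_norm v ^+ 2 by rewrite exprn_gt0// frob_gt0.
have := quad_le_frob (A - Th) v.
rewrite -mxtrace11 mulmxBr mulmxBl raddfB /= !mxtrace11 => h.
have h1 : frobenius_norm (A - Th) * frobenius_norm v ^+ 2 <= r * frobenius_norm v ^+ 2.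
  by rewrite ler_pM2r.
have := Th_ge v; move: h; rewrite ler_norml => /andP[h2 _].
have : 0 < r * frobenius_norm v ^+ 2 by rewrite mulr_gt0.
move: h1 h2 => *; lra.
Qed.

Lemma continuous_penalized_loss (A : 'M[R]_n) : posdef A -> {for A, continuous F}.
Proof.
move=> pA; apply: continuousD; last first.
  have -> : (fun M : 'M[R]_n => off_l1_norm (hadamard L M)) =
    fun M => \sum_i \sum_(j | j != i) `|L i j * M i j|.
    by apply/funext => M; apply: eq_bigr => i _; apply: eq_bigr => j _; rewrite !mxE.
  apply: continuous_sum_fun => i; apply: continuous_sum_fun => j M.
  apply: (@continuous_comp _ _ _ (fun M : 'M[R]_n => L i j * M i j) Num.norm).
    by apply: continuousM_fun; [exact: cst_continuous|exact: coord_continuous].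
  exact: norm_continuous.
apply: continuousB.
  have -> : (fun M : 'M[R]_n => \tr (M^T *m S)) = fun M => \sum_i \sum_j M j i * S j i.
    by apply/funext => M; apply: eq_bigr => i _; rewrite mxE; apply: eq_bigr => j _; rewrite mxE.
  apply: continuous_sum_fun => i; apply: continuous_sum_fun => j.
  by apply: continuousM_fun; [exact: coord_continuous|exact: cst_continuous].
apply: (@continuous_comp _ _ _ (fun M : 'M[R]_n => \det M) (@ln R)).
  exact: continuous_det.
by apply: continuous_ln; case: (posdef_det_gt0_le pA).
Qed.

(** The positive definite cone is neither closed nor bounded, so the objective is minimized over
    symmetric matrices in the closed ball of radius [r], all positive definite by [ball_posdef]. The
    error bound places this minimizer strictly inside the ball, and convexity makes it global. *)
Lemma exists_argmin : exists A, is_argmin (@posdef R n) F A.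
Proof.
pose K := [set A : 'M[R]_n | frobenius_norm (A - Th) <= r] `&`
          [set A : 'M[R]_n | A^T = A].
have clK : closed K.
  apply: closedI; first exact: closed_frob_ball (ltW r_gt0).
  have -> : [set A : 'M[R]_n | A^T = A] =
    \bigcap_(ij in [set: 'I_n * 'I_n]) ((fun A : 'M[R]_n => A ij.2 ij.1 - A ij.1 ij.2) @^-1` [set 0]).
    apply/seteqP; split => A /=.
      by move=> sA [i j] _ /=; rewrite -{1}sA mxE subrr.
    move=> h; apply/matrixP => i j; rewrite mxE.
    by apply/eqP; rewrite -subr_eq0; apply/eqP; exact: (h (i, j)).
  apply: closed_bigI => -[i j] _; apply: preimage_closed; last exact: closed_eq.
  move=> A _; apply: continuousB; exact: coord_continuous.
have KTh : K Th by split; rewrite /= ?subrr ?frob0 ?(ltW r_gt0)//; exact: Th_posdef.1.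
have Kpd A : K A -> posdef A by case=> Ar sA; exact: ball_posdef.
have [A KA Amin] : exists2 A, K A & forall M, K M -> F A <= F M.
  apply: (@mx_EVT_min _ _ _ F K (frobenius_norm Th + r)) => //.
  - by exists Th.
  - move=> M [Mr _] i j; rewrite (le_trans (mx_entry_le_frob _ _ _))//.
    apply: (@le_trans _ _ (frobenius_norm (M - Th + Th))); first by rewrite subrK.
    by rewrite (le_trans (frobD _ _))// addrC lerD2l.
  - by move=> M /[!inE] /Kpd; exact: continuous_penalized_loss.
have pA := Kpd _ KA.
(* [minimizer_error] compares only with points of the segment towards [Th]. They are closer to [Th]
   than [A], so minimality over the ball suffices. *)
have err : frobenius_norm (A - Th) <= 3 * nu ^+ 2 * a.
  apply: minimizer_error => // s /andP[s0 s1]; apply: Amin; split; last first.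
    by rewrite /= linearD linearZ linearB /= pA.1 Th_posdef.1.
  rewrite /=.
  have -> : A + (1 - s) *: (Th - A) - Th = s *: (A - Th).
    by apply/matrixP => i j; rewrite !mxE; ring.
  rewrite /= frobZ gtr0_norm// (le_trans _ KA.1)// ler_piMl ?frob_ge0//; exact: ltW.
exists A; split=> // B pB.
pose d := r - frobenius_norm (A - Th).
have d0 : 0 < d by rewrite subr_gt0 (le_lt_trans err).
(* A step towards [B] short enough to stay in the ball; the [+ 1] avoids dividing by zero when
   [B = A]. *)
pose t := Num.min 1 (d / (frobenius_norm (B - A) + 1)).
have b0 : 0 < frobenius_norm (B - A) + 1 by rewrite ltr_wpDl ?frob_ge0.
have t0 : 0 < t by rewrite lt_min ltr01 divr_gt0.
have t1 : t <= 1 by rewrite ge_min lexx.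
have td : t * frobenius_norm (B - A) <= d.
  apply: (@le_trans _ _ (d / (frobenius_norm (B - A) + 1) * (frobenius_norm (B - A) + 1))).
    by rewrite ler_pM ?frob_ge0 ?(ltW t0)// ?ge_min ?lexx ?orbT// lerDl.
  by rewrite divfK// gt_eqF.
have t01 : 0 <= t <= 1 by rewrite (ltW t0).
have KC : K (A + t *: (B - A)).
  split; last by rewrite /= linearD linearZ linearB /= pA.1 pB.1.
  rewrite /=.
  have -> : A + t *: (B - A) - Th = (A - Th) + t *: (B - A) by rewrite addrAC.
  rewrite /= (le_trans (frobD _ _))// frobZ (gtr0_norm t0) -lerBrDl.
  exact: td.
have := le_trans (Amin _ KC) (penalized_loss_convex S L_ge0 pA pB t01).
by rewrite -/(F A) -/(F B) lerDl pmulr_rge0// subr_ge0.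
Qed.

Lemma argmin_error (A : 'M[R]_n) : is_argmin (@posdef R n) F A ->
  frobenius_norm (A - Th) <= 3 * nu ^+ 2 * a.
Proof.
move=> [pA Amin]; apply: minimizer_error => // s /andP[s0 s1]; apply: Amin.
by apply: posdef_convex => //; rewrite subr_ge0 ltW//= gerBl ltW.
Qed.

End localization.

(** * One reweighting step *)

Section adaptive_step.
Context {R : realType}.

Lemma frob_le_entry m n (A B : 'M[R]_(m, n)) :
  (forall i j, `|A i j| <= `|B i j|) -> frobenius_norm A <= frobenius_norm B.
Proof.
move=> AB; rewrite -ler_sqr ?nnegrE ?frob_ge0// !frob_sqrE.
apply: ler_sum => i _; apply: ler_sum => j _.
by rewrite -[A i j ^+ 2]real_normK ?num_real// -[B i j ^+ 2]real_normK ?num_real// lerXn2r ?nnegrE.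
Qed.

Lemma frob_restrict_sqr m n (E : {set 'I_m * 'I_n}) (A : 'M[R]_(m, n)) :
  frobenius_norm (restrict_mx E A) ^+ 2 = \sum_(p in E) A p.1 p.2 ^+ 2.
Proof.
rewrite frob_sqrE pair_bigA [RHS]big_mkcond; apply: eq_bigr => -[i j] _ /=.
by rewrite mxE; case: ifP => // _; rewrite expr0n.
Qed.

Lemma frob_restrict_le_card m n (E : {set 'I_m * 'I_n}) (A : 'M[R]_(m, n)) (b : R) :
  0 <= b -> (forall p, p \in E -> `|A p.1 p.2| <= b) ->
  frobenius_norm (restrict_mx E A) <= b * Num.sqrt #|E|%:R.
Proof.
move=> b0 Ab; rewrite -ler_sqr ?nnegrE ?frob_ge0 ?mulr_ge0 ?sqrtr_ge0//.
rewrite frob_restrict_sqr exprMn sqr_sqrtr// mulr_natr -sumr_const; apply: ler_sum => p pE.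
by rewrite -real_normK ?num_real// lerXn2r ?nnegrE// Ab.
Qed.

Lemma frob_restrict_le m n (E : {set 'I_m * 'I_n}) (A B : 'M[R]_(m, n)) (b : R) :
  0 <= b -> (forall p, p \in E -> `|A p.1 p.2| <= b * `|B p.1 p.2|) ->
  frobenius_norm (restrict_mx E A) <= b * frobenius_norm B.
Proof.
move=> b0 Ab; rewrite -[b]ger0_norm// -frobZ; apply: frob_le_entry => i j.
rewrite !mxE normrM ger0_norm//; case: ifP => [/Ab//|_].
by rewrite normr0 mulr_ge0.
Qed.

Section step.
Context {n : nat} (S Sigma Thp : 'M[R]_n.+1) (w : R -> R) (M eps2 alpha lambda : R) (s : nat).
Hypothesis Sigma_corr : correlation_mx Sigma.
Hypothesis lambda_gt0 : 0 < lambda.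
Hypothesis A1 : assumption1 M eps2 s Sigma.
Hypothesis A2 : assumption2 alpha lambda Sigma w.
Hypothesis A3 : assumption3 alpha lambda Sigma.
Hypothesis S_sym : S^T = S.
Hypothesis S_diag : forall i, S i i = 1.
Hypothesis S_close : forall i j, i != j -> `|S i j - Sigma i j| <= lambda / 2.

Let Th := invmx Sigma.
Let nu := spectral_norm Th.
Let c := cst_c Sigma.
Hypothesis lambda_small : 6 * nu ^+ 2 * (lambda * Num.sqrt s%:R) < eps2 / 2.

(* Entries outside the support where the previous iterate exceeds [c * lambda],
   so that the penalty weight may drop below [lambda / 2]. *)
Definition large_off_support (T : 'M[R]_n.+1) : {set 'I_n.+1 * 'I_n.+1} :=
  [set p | [&& p.1 != p.2, p \notin off_support Th & c * lambda < `|T p.1 p.2|]]%SET.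
Hypothesis Thp_large : (#|large_off_support Thp| <= s)%N.

Let E := large_off_support Thp.
Let L := weight_mx w lambda Thp.

Let Th_posdef : posdef Th. Proof. exact: posdef_inv Sigma_corr.1. Qed.

Let gradE : grad_loss S Th = S - Sigma. Proof. by rewrite /grad_loss invmxK. Qed.

Let eps2_gt0 : 0 < eps2. Proof. by case: A1. Qed.

Lemma Th_quad_ge (v : 'cV[R]_n.+1) : eps2 * frobenius_norm v ^+ 2 <= (v^T *m Th *m v) 0 0.
Proof.
apply: le_trans (quad_ge_lambda_min v Th_posdef.1); rewrite ler_wpM2r ?sqr_ge0//.
by case: A1.
Qed.

Lemma eps2_le_spectral : eps2 <= nu.
Proof.
pose v : 'cV[R]_n.+1 := const_mx 1.
have v0 : 0 < frobenius_norm v ^+ 2.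
  rewrite exprn_gt0// frob_gt0; apply/eqP => /matrixP/(_ 0 0).
  by rewrite !mxE => /eqP; rewrite oner_eq0.
by have := le_trans (Th_quad_ge v) (quad_le_spectral Th v); rewrite ler_pM2r.
Qed.

Lemma spectral_le_eps2 : nu <= eps2^-1.
Proof.
apply: spectral_norm_le_quad => //; first by rewrite invr_ge0 ltW.
move=> v; apply: le_trans (quad_le_lambda_max v Th_posdef.1) _.
rewrite ler_wpM2r ?sqr_ge0//; rewrite -div1r; by case: A1.
Qed.

Let nu_gt0 : 0 < nu. Proof. exact: lt_le_trans eps2_le_spectral. Qed.

(** The margin [64] serves both the contraction factor in [step_error] and the cardinality bound in
    [step_large_card]. *)
Lemma cst_c_ge : 64 * nu ^+ 2 <= c.
Proof.
have : 1 <= Num.max (inf_norm Sigma ^+ 2) 1 by rewrite le_max lexx orbT.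
rewrite /c /cst_c -/Th -/nu; lra.
Qed.

Lemma cst_c_gt0 : 0 < c.
Proof.
have : 1 <= Num.max (inf_norm Sigma ^+ 2) 1 by rewrite le_max lexx orbT.
by have := sqr_ge0 nu; rewrite /c /cst_c -/Th -/nu; lra.
Qed.

Let w01 t : 0 <= t -> 0 <= w t <= 1. Proof. by case: A2 => _ + _ _ _; exact. Qed.

Let L_ge0 i j : 0 <= L i j.
Proof. by rewrite mxE mulr_ge0 ?(ltW lambda_gt0)//; case/andP: (w01 (normr_ge0 (Thp i j))). Qed.

Let L_le i j : L i j <= lambda.
Proof. by rewrite mxE ler_piMr ?(ltW lambda_gt0)//; case/andP: (w01 (normr_ge0 (Thp i j))). Qed.

Let grad_diag0 i : grad_loss S Th i i = 0.
Proof. by rewrite gradE !mxE S_diag Sigma_corr.2 subrr. Qed.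

Let grad_le i j : i != j -> `|grad_loss S Th i j| <= lambda / 2.
Proof. by move=> ij; rewrite gradE !mxE S_close. Qed.

(** Off the support and off [E] the previous iterate is at most [u = c * lambda], so monotonicity
    and [w u >= 1/2] keep the penalty at [lambda / 2] or more, which dominates the gradient. *)
Let grad_le_L i j : i != j -> (i, j) \notin off_support Th ->
  (i, j) \notin E -> `|grad_loss S Th i j| <= L i j.
Proof.
move=> ij ijS; rewrite inE /= ij ijS /= -leNgt => Tu.
apply: le_trans (grad_le ij) _; rewrite mxE ler_wpM2l ?(ltW lambda_gt0)//.
case: A2 => wd _ _ _ wu; rewrite -div1r; apply: le_trans wu _; exact: wd.
Qed.

Let off_supportP p : p \in off_support Th -> p.1 != p.2.
Proof. by rewrite inE => /andP[]. Qed.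

Let grad_S : frobenius_norm (restrict_mx (off_support Th) (grad_loss S Th)) <=
  lambda / 2 * Num.sqrt s%:R.
Proof.
apply: (@le_trans _ _ (lambda / 2 * Num.sqrt #|off_support Th|%:R)).
  apply: frob_restrict_le_card => [|p pS]; first by rewrite divr_ge0// ltW.
  exact/grad_le/off_supportP.
rewrite ler_wpM2l ?divr_ge0 ?(ltW lambda_gt0)// ler_sqrt// ler_nat.
by case: A1.
Qed.

Let grad_E : frobenius_norm (restrict_mx E (grad_loss S Th)) <= lambda / 2 * Num.sqrt s%:R.
Proof.
apply: (@le_trans _ _ (lambda / 2 * Num.sqrt #|E|%:R)).
  apply: frob_restrict_le_card => [|p]; first by rewrite divr_ge0// ltW.
  by rewrite inE => /and3P[? _ _]; exact: grad_le.
by rewrite ler_wpM2l ?divr_ge0 ?(ltW lambda_gt0)// ler_sqrt// ler_nat.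
Qed.

Let L_S : frobenius_norm (restrict_mx (off_support Th) L) <= lambda * Num.sqrt s%:R.
Proof.
apply: (@le_trans _ _ (lambda * Num.sqrt #|off_support Th|%:R)).
  apply: frob_restrict_le_card => [|p pS]; first by rewrite ltW.
  by rewrite ger0_norm.
rewrite ler_wpM2l ?(ltW lambda_gt0)// ler_sqrt// ler_nat.
by case: A1.
Qed.

(** On [E] the truth is zero and the previous iterate exceeds [c * lambda], so a gradient entry, at
    most [lambda / 2], is charged to the previous error. *)
Let grad_E_prev : frobenius_norm (restrict_mx E (grad_loss S Th)) <=
  (2 * c)^-1 * frobenius_norm (Thp - Th).
Proof.
have c0 := cst_c_gt0.
apply: frob_restrict_le => [|[i j]]; first by rewrite invr_ge0 mulr_ge0// ltW.
rewrite inE /= => /and3P[ij ijS Tu]; rewrite [(Thp - Th) i j]mxE [(- Th) i j]mxE.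
have -> : Th i j = 0 by move: ijS; rewrite inE /= ij negbK => /eqP.
rewrite subr0; apply: le_trans (grad_le ij) _.
have c2 : 0 < 2 * c by rewrite pmulr_rgt0.
rewrite (ler_pdivlMl _ _ c2).
have -> : 2 * c * (lambda / 2) = c * lambda by field.
exact: ltW.
Qed.

(** A support entry of the previous iterate either reaches [alpha * lambda], and its weight is zero,
    or by Assumption 3 is off by at least [(alpha + c) lambda - alpha lambda = c lambda]. *)
Let L_S_prev : frobenius_norm (restrict_mx (off_support Th) L) <=
  c^-1 * frobenius_norm (Thp - Th).
Proof.
have c0 := cst_c_gt0.
apply: frob_restrict_le => [|[i j] ijS /=]; first by rewrite invr_ge0 ltW.
rewrite (ger0_norm (L_ge0 i j)).
have [Ta|Ta] := leP (alpha * lambda) `|Thp i j|.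
  have -> : L i j = 0.
    rewrite mxE; case: A2 => wd w0 _ wa _.
    have /andP[wp _] := w0 _ (normr_ge0 (Thp i j)).
    by apply/eqP; rewrite mulf_eq0 gt_eqF//= eq_le wp andbT -wa wd.
  by rewrite mulr_ge0// invr_ge0 ltW.
apply: le_trans (L_le i j) _; rewrite ler_pdivlMl//.
have := A3 ijS => /= Th_ge; rewrite !mxE.
have := lerB_dist (invmx Sigma i j) (Thp i j); rewrite distrC => h.
apply: le_trans h; move: Th_ge; rewrite mulrDl -/c; lra.
Qed.

Let a := frobenius_norm (restrict_mx (off_support Th) (grad_loss S Th)) +
     frobenius_norm (restrict_mx E (grad_loss S Th)) +
     frobenius_norm (restrict_mx (off_support Th) L).

Let a_le : a <= 2 * (lambda * Num.sqrt s%:R).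
Proof. by move: grad_S grad_E L_S; rewrite /a => *; lra. Qed.

Let n2 : 0 < nu ^+ 2. Proof. exact: exprn_gt0. Qed.

Let a_nu : 3 * nu ^+ 2 * a <= 6 * nu ^+ 2 * (lambda * Num.sqrt s%:R).
Proof.
apply: (@le_trans _ _ (3 * nu ^+ 2 * (2 * (lambda * Num.sqrt s%:R)))); last lra.
by rewrite ler_wpM2l// mulr_ge0// ltW.
Qed.

Let a_small : 3 * nu ^+ 2 * a < eps2 / 2. Proof. exact: le_lt_trans lambda_small. Qed.

(** [eps2 / 2] is the localization radius [r]: the smallest eigenvalue of [Th] is at least
    [2 r = eps2]. *)
Let half_gt0 : 0 < eps2 / 2. Proof. by rewrite divr_gt0. Qed.

Let half_le : eps2 / 2 <= nu.
Proof. by apply: le_trans eps2_le_spectral; rewrite ler_pdivrMr// ler_peMr ?ler1n// ltW. Qed.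

Let Th_ge (v : 'cV[R]_n.+1) :
  2 * (eps2 / 2) * frobenius_norm v ^+ 2 <= (v^T *m Th *m v) 0 0.
Proof. by rewrite mulrC [2 * _]mulrC divfK// mulrC; exact: Th_quad_ge. Qed.

Lemma step_argmin_exists :
  exists A, is_argmin (@posdef R n.+1) (penalized_loss S L) A.
Proof. exact: (exists_argmin S_sym grad_diag0 L_ge0 grad_le_L Th_posdef half_gt0 half_le Th_ge a_small). Qed.

Section error.
Context {A : 'M[R]_n.+1}.
Hypothesis A_argmin : is_argmin (@posdef R n.+1) (penalized_loss S L) A.

Let A_err : frobenius_norm (A - Th) <= 3 * nu ^+ 2 * a.
Proof. exact: (argmin_error S_sym grad_diag0 L_ge0 grad_le_L Th_posdef half_gt0 half_le a_small). Qed.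

(** The three terms of [a] cost [1/2], [1/2] and [1] times [lambda * sqrt s], hence [3 * 2 = 6]. *)
Lemma step_error_sqrt : frobenius_norm (A - Th) <= 6 * nu ^+ 2 * (lambda * Num.sqrt s%:R).
Proof. exact: le_trans A_err _. Qed.

(** The last two terms of [a] are at most [1 / (2 c)] and [1 / c] times the previous error, so they
    contribute [9 nu^2 / (2 c)], well below [1/2] by [cst_c_ge]; on the gradient term [3] is relaxed
    to [4]. *)
Lemma step_error : frobenius_norm (A - Th) <=
  4 * nu ^+ 2 * frobenius_norm (restrict_mx (off_support Th) (grad_loss S Th)) +
  1 / 2 * frobenius_norm (Thp - Th).
Proof.
apply: le_trans A_err _; rewrite /a.
move: grad_E_prev L_S_prev; set x := frobenius_norm (Thp - Th).
set gE := frobenius_norm (restrict_mx E _); set l := frobenius_norm (restrict_mx _ L).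
set g := frobenius_norm (restrict_mx _ _) => h1 h2.
have x0 : 0 <= x by exact: frob_ge0.
have g0 : 0 <= g by exact: frob_ge0.
have c0 := cst_c_gt0.
have h : gE + l <= (3 / 2) * c^-1 * x.
  by move: h1 h2; rewrite invfM; lra.
have h3 : 3 * nu ^+ 2 * (gE + l) <= 1 / 2 * x.
  apply: (@le_trans _ _ (3 * nu ^+ 2 * ((3 / 2) * c^-1 * x))).
    by rewrite ler_wpM2l// mulr_ge0// ltW.
  have -> : 3 * nu ^+ 2 * (3 / 2 * c^-1 * x) = (9 / 2 * nu ^+ 2) / c * x.
    by field; rewrite gt_eqF.
  rewrite ler_wpM2r// ler_pdivrMr//; have := cst_c_ge; lra.
have : 0 <= nu ^+ 2 * g by rewrite mulr_ge0// ltW.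
lra.
Qed.

(** Each large off-support entry contributes at least [(c lambda)^2] to the squared error, whose
    total is at most [(6 nu^2)^2 lambda^2 s <= (c lambda)^2 s]. This restores the hypothesis of the
    next step. *)
Lemma step_large_card : (#|large_off_support A| <= s)%N.
Proof.
have c0 := cst_c_gt0; have u0 : 0 < c * lambda by rewrite mulr_gt0.
rewrite -(ler_nat R) -(ler_pM2l (exprn_gt0 2 u0)).
apply: (@le_trans _ _ (frobenius_norm (A - Th) ^+ 2)); last first.
  have -> : (c * lambda) ^+ 2 * s%:R = (c * lambda * Num.sqrt s%:R) ^+ 2.
    by rewrite [RHS]exprMn sqr_sqrtr.
  have u1 : 0 <= c * lambda * Num.sqrt s%:R := mulr_ge0 (ltW u0) (sqrtr_ge0 _).
  rewrite ler_sqr ?nnegrE ?frob_ge0 ?u1//.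
  apply: (le_trans step_error_sqrt); rewrite -[c * lambda * _]mulrA ler_wpM2r//.
    by rewrite mulr_ge0 ?sqrtr_ge0// ltW.
  by have := cst_c_ge; lra.
apply: (@le_trans _ _ (frobenius_norm (restrict_mx (large_off_support A) (A - Th)) ^+ 2)).
  rewrite frob_restrict_sqr mulr_natr -sumr_const; apply: ler_sum => -[i j].
  rewrite inE /= => /and3P[ij ijS /ltW Tu]; rewrite !mxE.
  have -> : invmx Sigma i j = 0 by move: ijS; rewrite inE /= ij negbK => /eqP.
  rewrite subr0 -[A i j ^+ 2]real_normK ?num_real//.
  by rewrite lerXn2r ?nnegrE// ltW.
rewrite lerXn2r ?nnegrE ?frob_ge0//; apply: frob_le_entry => i j.
by rewrite [restrict_mx _ _ _ _]mxE; case: ifP => // _; rewrite normr0.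
Qed.

End error.
End step.
End adaptive_step.

(** * Iterating the reweighting step *)

Section iteration.
Context {R : realType}.

Section path.
Context {n : nat} (S Sigma : 'M[R]_n.+1) (w : R -> R) (M eps2 alpha lambda : R) (s : nat).
Hypothesis Sigma_corr : correlation_mx Sigma.
Hypothesis lambda_gt0 : 0 < lambda.
Hypothesis A1 : assumption1 M eps2 s Sigma.
Hypothesis A2 : assumption2 alpha lambda Sigma w.
Hypothesis A3 : assumption3 alpha lambda Sigma.
Hypothesis S_sym : S^T = S.
Hypothesis S_diag : forall i, S i i = 1.
Hypothesis S_close : forall i j, i != j -> `|S i j - Sigma i j| <= lambda / 2.

Let Th := invmx Sigma.
Let nu := spectral_norm Th.
Hypothesis lambda_small : 6 * nu ^+ 2 * (lambda * Num.sqrt s%:R) < eps2 / 2.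

Let hat := estimator w lambda S.

(** The two claims feed each other: the cardinality bound at [l] gives existence of a minimizer, so
    that [xget] does not fall back to [0], and minimality at [l.+1] gives the cardinality bound
    there. The zero iterate has no large entry. *)
Lemma estimator_argmin_card l :
  is_argmin (@posdef R n.+1) (penalized_loss S (weight_mx w lambda (hat l))) (hat l.+1) /\
  (#|large_off_support Sigma lambda (hat l)| <= s)%N.
Proof.
have ex T : (#|large_off_support Sigma lambda T| <= s)%N ->
    is_argmin (@posdef R n.+1) (penalized_loss S (weight_mx w lambda T))
      (xget 0 [set A | is_argmin (@posdef R n.+1) (penalized_loss S (weight_mx w lambda T)) A]).
  move=> cT; apply: xgetPex.
  exact: (step_argmin_exists Sigma_corr lambda_gt0 A1 A2 S_sym S_diag S_close lambda_small cT).
elim: l => [|l [amin card]].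
  have c0 : (#|large_off_support Sigma lambda (hat 0)| <= s)%N.
    rewrite (_ : large_off_support _ _ _ = finset.set0) ?cards0//.
    apply/setP => -[i j]; rewrite !inE /= mxE normr0.
    rewrite [X in [&& _, _ & X]]ltNge (ltW (mulr_gt0 (cst_c_gt0 Sigma) lambda_gt0)).
    by rewrite !andbF.
  by split => //; exact: ex.
have card1 : (#|large_off_support Sigma lambda (hat l.+1)| <= s)%N.
  exact: (step_large_card Sigma_corr lambda_gt0 A1 A2 S_sym S_diag S_close lambda_small card amin).
by split => //; exact: ex.
Qed.

Lemma estimator_contraction l : frobenius_norm (hat l.+1 - Th) <=
  4 * nu ^+ 2 * frobenius_norm (restrict_mx (off_support Th) (grad_loss S Th)) +
  1 / 2 * frobenius_norm (hat l - Th).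
Proof.
have [amin card] := estimator_argmin_card l.
exact: (step_error Sigma_corr lambda_gt0 A1 A2 A3 S_sym S_diag S_close lambda_small card amin).
Qed.

Lemma estimator_crude_error l : frobenius_norm (hat l.+1 - Th) <=
  6 * nu ^+ 2 * (lambda * Num.sqrt s%:R).
Proof.
have [amin card] := estimator_argmin_card l.
exact: (step_error_sqrt Sigma_corr lambda_gt0 A1 A2 S_sym S_diag S_close lambda_small card amin).
Qed.

(** Sums the geometric series, with [8 = 4 / (1 - 1/2)]. The recursion starts from the crude bound
    at the first iterate: the error of [hat 0 = 0] is the whole norm of [Th], which grows with the
    dimension. *)
Lemma estimator_error T : frobenius_norm (hat T.+1 - Th) <=
  8 * nu ^+ 2 * frobenius_norm (restrict_mx (off_support Th) (grad_loss S Th)) +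
  2^-1 ^+ T * (6 * nu ^+ 2 * (lambda * Num.sqrt s%:R)).
Proof.
elim: T => [|T IH].
  rewrite expr0 mul1r (le_trans (estimator_crude_error 0))// lerDr.
  by rewrite mulr_ge0 ?frob_ge0// mulr_ge0// sqr_ge0.
apply: le_trans (estimator_contraction T.+1) _.
rewrite [2^-1 ^+ T.+1]exprS; move: IH; set g := frobenius_norm (restrict_mx _ _).
move: (frobenius_norm _) => x h.
have : 1 / 2 * x <= 1 / 2 * (8 * nu ^+ 2 * g +
  2^-1 ^+ T * (6 * nu ^+ 2 * (lambda * Num.sqrt s%:R))) by rewrite ler_wpM2l.
rewrite -mulrA; move: (2^-1 ^+ T * _) => y; lra.
Qed.

End path.
End iteration.

(** * The arcsine law for Gaussian sign correlations *)

Section integral_lemmas.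
Context {R : realType}.
Local Notation mu := (@lebesgue_measure R).

Lemma lebesgue_measure_translate (a : R) (A : set R) : measurable A ->
  mu ((fun x => x + a) @^-1` A) = mu A.
Proof.
move=> mA.
have mphi : measurable_fun [set: R] (fun x : R => x + a).
  by apply: measurable_funD => //; exact: measurable_cst.
pose m' : {measure set (measurableTypeR R) -> \bar R} :=
  [the measure _ _ of pushforward mu (fun x : measurableTypeR R => x + a : measurableTypeR R)].
rewrite -[LHS]/(m' mphi A); apply/esym/lebesgue_measure_unique => // X [[x y] _ <-].
rewrite /= /pushforward /=.
have -> : (fun x => x + a) @^-1` `]x, y] = `]x - a, y - a]%classic.
  by apply/seteqP; split => z; rewrite /= !in_itv /= ltrBlDr lerBrDr.
rewrite !lebesgue_measure_itv /= !lte_fin ltrD2r.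
by case: ifP => // _; rewrite -!EFinB; congr EFin; ring.
Qed.

Lemma integral_translate (f : R -> \bar R) (a : R) : measurable_fun setT f ->
  (forall x, 0 <= f x)%E ->
  (\int[mu]_x f (x + a)%R = \int[mu]_x f x)%E.
Proof.
move=> mf f0.
have mphi : measurable_fun [set: R] (fun x : R => x + a).
  by apply: measurable_funD => //; exact: measurable_cst.
have := @ge0_integral_pushforward _ _ (measurableTypeR R) (measurableTypeR R) R
  (fun x => x + a) mphi mu setT f measurableT mf (fun y _ => f0 y).
rewrite preimage_setT => <-.
apply: eq_measure_integral => A mA _.
exact: lebesgue_measure_translate.
Qed.

Lemma ae_eq_off_points (p q : R) (f g : R -> \bar R) :
  (forall x, x != p -> x != q -> f x = g x) -> ae_eq mu setT f g.
Proof.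
move=> fg; exists ([set p] `|` [set q]); split.
- by apply: measurableU; exact: measurable_set1.
- apply/eqP; rewrite eq_le measure_ge0 andbT.
  have h := @measureU2 _ _ _ (@lebesgue_measure R) _ _ (measurable_set1 p) (measurable_set1 q).
  apply: (le_trans h).
  by rewrite [X in (X + _)%E]lebesgue_measure_set1 [X in (_ + X)%E]lebesgue_measure_set1 adde0.
- move=> x /= h; have [->|xp] := eqVneq x p; first by left.
  have [->|xq] := eqVneq x q; first by right.
  by exfalso; apply: h => _; exact: fg.
Qed.

(** The hyperbolic cosine. *)
Definition ch (x : R) := (expR x + expR (- x)) / 2.

Lemma ch_ge1 x : 1 <= ch x.
Proof.
rewrite /ch ler_pdivlMr// mul1r expRN.
have e0 := expR_gt0 x.
rewrite -(ler_pM2r e0) [leRHS]mulrDl mulVf ?gt_eqF//.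
have := sqr_ge0 (expR x - 1); lra.
Qed.

Lemma ch_gt1 x : x != 0 -> 1 < ch x.
Proof.
move=> x0; rewrite /ch ltr_pdivlMr// mul1r expRN.
have e0 := expR_gt0 x.
rewrite -(ltr_pM2r e0) [ltRHS]mulrDl mulVf ?gt_eqF//.
have : 0 < (expR x - 1) ^+ 2.
  by rewrite exprn_even_gt0//= subr_eq0 -[X in _ != X]expR0 (inj_eq (@expR_inj R)).
lra.
Qed.

Lemma continuous_ch : continuous ch.
Proof.
apply: continuousM_fun; last exact: cst_continuous.
apply: continuousD_fun; first exact: continuous_expR.
move=> x; apply: (@continuous_comp _ _ _ (fun x : R => - x) expR); last exact: continuous_expR.
exact: opp_continuous.
Qed.

Lemma measurable_ch : measurable_fun setT ch.
Proof. by apply: continuous_measurable_fun; exact: continuous_ch. Qed.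

Lemma chD_gt0 x (t : R) : 0 < t < pi -> 0 < ch x + cos t.
Proof.
move=> /andP[t0 tpi].
have : -1 < cos t by rewrite -cospi ltr_cos// ?in_itv/= ?(ltW t0) ?(ltW tpi) ?pi_ge0 ?lexx.
have := ch_ge1 x; lra.
Qed.

Lemma continuous_chV (t : R) : 0 < t < pi -> continuous (fun x => sin t / (ch x + cos t)).
Proof.
move=> tpi; apply: continuousM_fun; first exact: cst_continuous.
apply: continuousV_fun => [x|]; first by rewrite gt_eqF// chD_gt0.
by apply: continuousD_fun; [exact: continuous_ch|exact: cst_continuous].
Qed.

(** The antiderivative is [2 atan (tan (t/2) tanh (x/2))], with [tanh (x/2)] written as
    [1 - 2 / (e^x + 1)]; the derivative is checked through the half-angle formulas in
    [T = tan (t/2)]. *)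
Lemma integral_ch_half (t : R) : 0 < t < pi ->
  (\int[mu]_(x in `[0%R, +oo[) (sin t / (ch x + cos t))%:E = t%:E)%E.
Proof.
move=> tpi; have /andP[t0 tp] := tpi.
have ct0 : 0 < cos (t / 2).
  by apply: cos_gt0_pihalf; rewrite ltr_pM2r// tp andbT (lt_trans _ (divr_gt0 t0 _))// oppr_lt0 divr_gt0// pi_gt0.
pose T := tan (t / 2).
pose F (x : R) := 2 * atan (T * (1 - 2 * (expR x + 1)^-1)).
have e1 x : expR x + 1 != 0 :> R by rewrite gt_eqF// addr_gt0// expR_gt0.
have sinE : sin t = 2 * T / (1 + T ^+ 2).
  rewrite /T -cos2_tan2 ?gt_eqF// invrK -[t in LHS](divfK (_ : 2 != 0 :> R))//.
  rewrite mulr_natr sin_mulr2n /tan.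
  by field; rewrite gt_eqF.
have cosE : cos t = (1 - T ^+ 2) / (1 + T ^+ 2).
  rewrite /T -cos2_tan2 ?gt_eqF// invrK -[t in LHS](divfK (_ : 2 != 0 :> R))//.
  rewrite mulr_natr cos_mulr2n /tan exprMn exprVn mulrBl mul1r divfK ?sqrf_eq0 ?gt_eqF//.
  by rewrite sin2cos2; ring.
have T1 : 1 + T ^+ 2 != 0 by rewrite gt_eqF// ltr_pwDl// sqr_ge0.
have dF (x : R) : is_derive x (1 : R) F (sin t / (ch x + cos t)).
  have dV : is_derive x (1 : R) (fun x : R => (expR x + 1)^-1) (- (expR x + 1) ^- 2 * expR x).
    have d1 : is_derive x (1 : R) (fun x : R => expR x + 1) (expR x).
      by apply: is_derive_eq; rewrite addr0.
    exact: (@is_deriveV R (fun x => expR x + 1) x (expR x) 1 (e1 x) d1).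
  have dG : is_derive x (1 : R) (fun x : R => T * (1 - 2 * (expR x + 1)^-1))
      (T * (2 * ((expR x + 1) ^- 2 * expR x))).
    apply: is_derive_eq; rewrite /GRing.scale /= add0r; ring.
  have dA := @is_derive1_comp R atan _ x _ _ (is_derive1_atan _) dG.
  have dF : is_derive x (1 : R) F (2 * ((1 + (T * (1 - 2 * (expR x + 1)^-1)) ^+ 2)^-1 * (T * (2 * ((expR x + 1) ^- 2 * expR x))))).
    exact: (@is_deriveZ _ _ _ _ 2 _ _ _ dA).
  apply: (is_derive_eq dF).
  have ex : 0 < expR x := expR_gt0 x.
  rewrite sinE cosE /ch expRN; move: (expR x) ex (e1 x) => q q0 q1; field.
  rewrite (gt_eqF q0) T1 q1 !andbT /= gt_eqF//.
  have -> : (q * q + 1) * (1 + T ^+ 2) + (1 - T ^+ 2) * (q * 2) =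
    (q + 1) ^+ 2 + (T * (q - 1)) ^+ 2 by ring.
  by rewrite ltr_pwDl ?sqr_ge0// exprn_gt0// addr_gt0.
have F0 : F 0 = 0.
  by rewrite /F expR0 (_ : 1 - _ = 0) ?mulr0 ?atan0 //; field.
have -> : t%:E = (t%:E - (F 0)%:E)%E by rewrite F0 sube0.
apply: (@ge0_continuous_FTC2y R (fun x => sin t / (ch x + cos t)) F 0 t).
- move=> x x0; rewrite divr_ge0 ?(ltW (chD_gt0 _ tpi))//.
  by rewrite sin_ge0_pi// (ltW t0) ltW.
- exact/continuous_subspaceT/continuous_chV.
- have -> : t = 2 * atan (T * (1 - 2 * 0)).
    rewrite mulr0 subr0 mulr1 tanK; first by field.
    by rewrite in_itv/= ltr_pM2r// tp andbT (lt_trans _ (divr_gt0 t0 _))// oppr_lt0 divr_gt0// pi_gt0.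
  apply: cvgM; first exact: cvg_cst.
  apply: continuous_cvg; first exact: continuous_atan.
  apply: cvgM; first exact: cvg_cst.
  apply: cvgB; first exact: cvg_cst.
  apply: cvgM; first exact: cvg_cst.
  apply: (@squeeze_cvgr _ _ _ _ (fun=> 0) (fun x : R => expR (- x))); last 2 first.
  - exact: cvg_cst.
  - exact: cvgr_expR.
  apply: nearW => x; rewrite invr_ge0 addr_ge0 ?expR_ge0//= expRN lef_pV2 ?posrE ?expR_gt0//.
  by rewrite lerDl.
- by move=> x _; exact: ex_derive.
- apply: cvg_at_right_filter; apply: differentiable_continuous.
  exact/derivable1_diffP/ex_derive.
- by move=> x _; rewrite derive1E; exact: derive_val.
Qed.

Lemma integral_ch (t : R) : 0 < t < pi ->
  (\int[mu]_x (sin t / (ch x + cos t))%:E = (2 * t)%:E)%E.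
Proof.
move=> tpi; have /andP[t0 tp] := tpi.
rewrite ge0_symfun_integralT.
- by rewrite -set_itvcy integral_ch_half// EFinM.
- move=> x; rewrite divr_ge0 ?(ltW (chD_gt0 _ tpi))//.
  by rewrite sin_ge0_pi// (ltW t0) ltW.
- exact: continuous_chV.
- by move=> x; rewrite /= /ch opprK [expR (- x) + _]addrC.
Qed.

(** [- ln (ch x + cos t)] is an antiderivative in [t]; [x != 0] keeps the argument positive up to
    [t = pi]. *)
Lemma integral_ln_ch_cos (x a b : R) : x != 0 -> 0 <= a -> a <= b -> b <= pi ->
  (\int[mu]_(t in `[a, b]) (sin t / (ch x + cos t))%:E =
   (ln (ch x + cos a) - ln (ch x + cos b))%:E)%E.
Proof.
move=> x0 a0 ab bpi.
have pos t : 0 < ch x + cos t.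
  by have := ch_gt1 x0; have := cos_geN1 t; lra.
move: ab; rewrite le_eqVlt => /orP[/eqP <-|ab].
  by rewrite subrr set_itv1 integral_set1.
pose F t := - ln (ch x + cos t).
have dF (t : R) : is_derive t (1 : R) F (sin t / (ch x + cos t)).
  have d1 : is_derive t (1 : R) (fun t : R => ch x + cos t) (- sin t).
    apply: is_derive_eq.
  by rewrite add0r mul1r.
  have dA := @is_derive1_comp R (@ln R) _ t _ _ (is_derive1_ln (pos t)) d1.
  apply: (is_derive_eq (is_deriveN dA)).
  by rewrite mulrN opprK mulrC.
have -> : ln (ch x + cos a) - ln (ch x + cos b) = F b - F a.
  by rewrite /F opprK addrC.
rewrite EFinB; apply: (@continuous_FTC2 R (fun t => sin t / (ch x + cos t)) F) => //.
- apply: continuous_subspaceT; apply: continuousM_fun; first exact: continuous_sin.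
  apply: continuousV_fun => [t|]; first by rewrite gt_eqF.
  by apply: continuousD_fun; [exact: cst_continuous|exact: continuous_cos].
- have cF t : {for t, continuous F}.
    by apply: differentiable_continuous; apply/derivable1_diffP; exact: ex_derive.
  split; first by move=> t _; exact: ex_derive.
    exact/cvg_at_right_filter/cF.
  exact/cvg_at_left_filter/cF.
- by move=> t _; rewrite derive1E; exact: derive_val.
Qed.

Lemma integral_double (a b : R) : a <= b ->
  (\int[mu]_(t in `[a, b]) (2 * t)%:E = (b ^+ 2 - a ^+ 2)%:E)%E.
Proof.
rewrite le_eqVlt => /orP[/eqP <-|ab]; first by rewrite subrr set_itv1 integral_set1.
pose F (t : R) := t ^+ 2.
have dF (t : R) : is_derive t (1 : R) F (2 * t).
  apply: is_derive_eq.
rewrite /GRing.scale /=; ring.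
rewrite EFinB; apply: (@continuous_FTC2 R (fun t => 2 * t) F) => //.
- apply: continuous_subspaceT; apply: continuousM_fun; first exact: cst_continuous.
  by move=> t; exact: cvg_id.
- have cF t : {for t, continuous F}.
    by apply: differentiable_continuous; apply/derivable1_diffP; exact: ex_derive.
  split; first by move=> t _; exact: ex_derive.
    exact/cvg_at_right_filter/cF.
  exact/cvg_at_left_filter/cF.
- by move=> t _; rewrite derive1E; exact: derive_val.
Qed.

Lemma measurable_ln_ch a b :
  measurable_fun setT (fun x => ln (ch x + cos a) - ln (ch x + cos b)).
Proof.
by apply: measurable_funB; apply: measurableT_comp => //; apply: measurable_funD => //;
  exact: measurable_ch.
Qed.

Lemma measurable_double a b :
  measurable_fun setT ((fun x : R => (2 * x)%:E) \_ `[a, b]).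
Proof.
apply/(measurable_restrictT (fun x : R => (2 * x)%:E) (measurable_itv _)).
by apply/measurable_EFinP; apply: measurable_funM => //; exact: measurable_cst.
Qed.

(** Tonelli for [sin t / (ch x + cos t)] over [t] in [[a, b]]: integrating first in [t] gives the
    logarithms, first in [x] gives [2 t]. *)
Lemma integral_ln_ch (a b : R) : 0 <= a -> a <= b -> b <= pi ->
  (\int[mu]_x (ln (ch x + cos a) - ln (ch x + cos b))%:E = (b ^+ 2 - a ^+ 2)%:E)%E.
Proof.
move=> a0 ab bpi.
(* [expR (- ln _)] is the reciprocal wherever the denominator is positive. In this form
   nonnegativity and joint measurability are immediate, including at the zero [x = 0], [t = pi]. *)
pose g (z : R * R) := \1_(`[a, b]%classic) z.2 * (sin z.2 * expR (- ln (ch z.1 + cos z.2))).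
have g0 z : 0 <= g z.
  rewrite /g; case: z => x t /=; rewrite indicE; have [|] := boolP (t \in _); last by rewrite mul0r.
  rewrite inE /= in_itv /= => /andP[at0 tb]; rewrite mul1r mulr_ge0 ?expR_ge0//.
  by rewrite sin_ge0_pi// (le_trans a0 at0) (le_trans tb bpi).
have mg : measurable_fun setT g.
  apply: measurable_funM.
    by apply: (measurableT_comp (f := \1_(`[a, b]%classic) : R -> R)).
  apply: measurable_funM.
    apply: measurableT_comp => //; apply: continuous_measurable_fun; exact: continuous_sin.
  apply: measurableT_comp => //; apply: measurableT_comp => //.
  apply: measurableT_comp => //; apply: measurable_funD.
    by apply: measurableT_comp => //; exact: measurable_ch.
  by apply: measurableT_comp => //; apply: continuous_measurable_fun; exact: continuous_cos.
have gE x t : 0 < ch x + cos t -> sin t * expR (- ln (ch x + cos t)) = sin t / (ch x + cos t).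
  by move=> p; rewrite expRN lnK.
have mgE : measurable_fun setT (fun z : measurableTypeR R * measurableTypeR R => (g z)%:E).
  by apply/measurable_EFinP; exact: mg.
have g0E (z : measurableTypeR R * measurableTypeR R) : (0 <= (g z)%:E)%E.
  by rewrite lee_fin.
have tonelli := @fubini_tonelli _ _ (measurableTypeR R) (measurableTypeR R) R mu mu _ mgE g0E.
have mF := @measurable_fun_fubini_tonelli_F _ _ (measurableTypeR R) (measurableTypeR R) R mu _ mgE g0E.
have mG := @measurable_fun_fubini_tonelli_G _ _ (measurableTypeR R) (measurableTypeR R) R mu _ mgE g0E.
have gI x t : (g (x, t))%:E = (((fun t => (sin t * expR (- ln (ch x + cos t)))%:E) \_ `[a, b]) t)%E.
  by rewrite /g /= indicE patchE; case: ifP => _; rewrite ?mul1r ?mul0r.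
transitivity (\int[mu]_x \int[mu]_t (g (x, t))%:E)%E.
  apply: ae_eq_integral; first exact: measurableT.
  - apply/measurable_EFinP.
    apply: measurable_ln_ch.
  - exact: mF.
  apply: (@ae_eq_off_points 0 0) => x x0 _.
  under [RHS]eq_integral do rewrite gI.
  rewrite -integral_mkcond -(integral_ln_ch_cos x0 a0 ab bpi).
  apply: eq_integral => t _.
  have p : 0 < ch x + cos t by have := ch_gt1 x0; have := cos_geN1 t; lra.
  rewrite (gE _ _ p); reflexivity.
transitivity (\int[mu]_t \int[mu]_x (g (x, t))%:E)%E; first exact: tonelli.
rewrite -(integral_double ab) [RHS]integral_mkcond.
apply: ae_eq_integral; first exact: measurableT.
- exact: mG.
- apply: measurable_double.
(* [integral_ch] asks for [t] strictly between [0] and [pi]; the two endpoints are null. *)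
apply: (@ae_eq_off_points 0 pi) => t t0 tpi.
under eq_integral do rewrite gI.
rewrite patchE; case: ifPn => tab; last first.
  by apply: integral0_eq => x _; rewrite patchE (negbTE tab).
have tpi' : 0 < t < pi.
  move: tab; clear -a0 bpi t0 tpi; rewrite inE /= in_itv /= => /andP[at_ tb].
  by rewrite !lt_neqAle eq_sym t0 tpi (le_trans a0)// (le_trans tb).
rewrite -(integral_ch tpi'); apply: eq_integral => x _.
rewrite patchE tab (gE _ _ (chD_gt0 x tpi')); reflexivity.
Qed.

Lemma integral_abs_ln_ch (a b : R) : 0 <= a -> a <= b -> b <= pi ->
  (\int[mu]_x `|(ln (ch x + cos a) - ln (ch x + cos b))%:E| = (b ^+ 2 - a ^+ 2)%:E)%E.
Proof.
move=> a0 ab bpi; rewrite -integral_ln_ch//.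
apply: ae_eq_integral; first exact: measurableT.
- apply: measurableT_comp => //; apply/measurable_EFinP; exact: measurable_ln_ch.
- apply/measurable_EFinP; exact: measurable_ln_ch.
apply: (@ae_eq_off_points 0 0) => x x0 _.
rewrite gee0_abs// lee_fin subr_ge0.
have c1 := ch_gt1 x0; have ca := cos_geN1 a; have cb := cos_geN1 b.
rewrite ler_ln ?posrE; [|lra..].
rewrite lerD2l leNgt; apply/negP.
rewrite ltr_cos ?in_itv/=; [|by rewrite (le_trans a0)|by rewrite a0 (le_trans ab)].
by rewrite ltNge ab.
Qed.

Lemma integrable_ln_ch (a b : R) : 0 <= a <= pi -> 0 <= b <= pi ->
  mu.-integrable setT (fun x => (ln (ch x + cos a) - ln (ch x + cos b))%:E).
Proof.
move=> /andP[a0 api] /andP[b0 bpi]; apply/integrableP; split.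
  by apply/measurable_EFinP; apply: measurable_ln_ch.
have [ab|ba] := leP a b; first by rewrite integral_abs_ln_ch ?ltry.
under eq_integral do rewrite -opprB EFinN abseN.
by rewrite integral_abs_ln_ch ?ltry// ltW.
Qed.

Lemma integral_ln_chE (a b : R) : 0 <= a <= pi -> 0 <= b <= pi ->
  (\int[mu]_x (ln (ch x + cos a) - ln (ch x + cos b))%:E = (b ^+ 2 - a ^+ 2)%:E)%E.
Proof.
move=> ain bin; have /andP[a0 api] := ain; have /andP[b0 bpi] := bin.
have [ab|ba] := leP a b; first by rewrite integral_ln_ch.
under eq_integral do rewrite -opprB EFinN.
rewrite integralN; last exact: integrable_add_def (integrable_ln_ch bin ain).
by rewrite integral_ln_ch ?(ltW ba)// -EFinN opprB.
Qed.

End integral_lemmas.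

(** * Integral representation of the sign *)

Section log_kernel.
Context {R : realType}.
Local Notation mu := (@lebesgue_measure R).

(* Its integral over x is pi^2 / 2 times the sign of u v: for u v > 0, x only
   enters through x + ln (v / u), and Lebesgue measure is translation invariant. *)
Definition log_ratio (u v x : R) := ln `|u + expR x * v| - ln `|u - expR x * v|.

Lemma measurable_log_ratio (u v : R) : measurable_fun setT (log_ratio u v).
Proof.
have me : measurable_fun setT (fun x : R => expR x * v).
  by apply: measurable_funM => //; exact: measurable_cst.
apply: measurable_funB; apply: measurableT_comp => //; apply: measurableT_comp => //.
  by apply: measurable_funD.
by apply: measurable_funB.
Qed.

(** [ch x + 1] and [ch x - 1] are [|1 + e^x|^2] and [|1 - e^x|^2] over [2 e^x], so the kernel is
    half the case [a = 0], [b = pi] of [integral_ln_ch]. At [x = 0] the convention [ln 0 = 0] breaks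
    the identity. *)
Lemma log_ratio_kernelE (x : R) : x != 0 ->
  log_ratio 1 1 x = 2^-1 * (ln (ch x + cos 0) - ln (ch x + cos pi)).
Proof.
move=> x0; have e0 := expR_gt0 x.
have e1 : expR x - 1 != 0.
  by rewrite subr_eq0 -[X in _ != X]expR0 (inj_eq (@expR_inj R)).
have chp : ch x + 1 = (expR x + 1) ^+ 2 / (2 * expR x).
  by rewrite /ch expRN; field; rewrite gt_eqF.
have chm : ch x - 1 = `|1 - expR x| ^+ 2 / (2 * expR x).
  rewrite real_normK ?num_real// /ch expRN; field; by rewrite gt_eqF.
have p1 : 0 < expR x + 1 by rewrite addr_gt0.
have p2 : 0 < `|1 - expR x| by rewrite normr_gt0 -opprB oppr_eq0.
have p3 : 0 < 2 * expR x by rewrite mulr_gt0.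
rewrite cos0 cospi chp chm !ln_div ?posrE ?exprn_gt0// !lnXn//.
have p4 : 0 < 1 + expR x by rewrite addrC.
have e2 : `|1 + expR x * 1| = expR x + 1 by rewrite mulr1 gtr0_norm// addrC.
rewrite /log_ratio e2 mulr1; move: (ln _) (ln _) (ln _) => p q r; lra.
Qed.

Lemma log_ratio_kernel_ge0 (x : R) : 0 <= log_ratio 1 1 x.
Proof.
rewrite /log_ratio !mulr1 subr_ge0.
have e0 := expR_gt0 x.
have [->|p2] := eqVneq (1 - expR x) 0.
  by rewrite normr0 ln0// ln_ge0// gtr0_norm ?addr_gt0// lerDl ltW.
rewrite ler_ln ?posrE ?normr_gt0// ?gt_eqF ?addr_gt0//.
by rewrite (le_trans (ler_normB _ _))// normr1 !gtr0_norm ?addr_gt0.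
Qed.

Lemma integral_log_ratio_kernel :
  (\int[mu]_x (log_ratio 1 1 x)%:E = (pi ^+ 2 / 2)%:E)%E.
Proof.
transitivity (\int[mu]_x ((2^-1 * (ln (ch x + cos 0) - ln (ch x + cos pi)))%:E))%E.
  apply: ae_eq_integral; first exact: measurableT.
  - by apply/measurable_EFinP; apply: measurable_log_ratio.
  - apply/measurable_EFinP; apply: measurable_funM; first exact: measurable_cst.
    apply: measurable_ln_ch.
  apply: (@ae_eq_off_points _ 0 0) => x x0 _.
  by rewrite log_ratio_kernelE.
have d0 (x : R) : 0 <= ln (ch x + cos 0) - ln (ch x + cos pi).
  rewrite cos0 cospi subr_ge0; have c1 := ch_ge1 x.
  have [->|p2] := eqVneq (ch x - 1) 0; first by rewrite ln0// ln_ge0//; lra.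
  have : 0 < ch x - 1 by rewrite lt_neqAle eq_sym p2; lra.
  by move=> p3; rewrite ler_ln ?posrE//; lra.
under eq_integral do rewrite EFinM.
rewrite ge0_integralZl_EFin.
- by rewrite integral_ln_ch ?pi_ge0// -EFinM; congr EFin; ring.
- exact: measurableT.
- by move=> x _; rewrite lee_fin.
- by apply/measurable_EFinP; apply: measurable_ln_ch.
- lra.
Qed.

(** Factoring [u] out of both moduli leaves one plus or minus [e^(x + ln (v / u))]; the excluded [x]
    is the zero of the second modulus. *)
Lemma log_ratio_shift (u v x : R) : 0 < u * v -> x != - ln (v / u) ->
  log_ratio u v x = log_ratio 1 1 (x + ln (v / u)).
Proof.
move=> uv xc.
have u0 : u != 0 by apply: contraTneq uv => ->; rewrite mul0r ltxx.
have vu : 0 < v / u.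
  have -> : v / u = u * v / u ^+ 2 by field.
  by rewrite divr_gt0// exprn_even_gt0.
have e0 := expR_gt0 x.
rewrite /log_ratio expRD lnK ?posrE// !mulr1.
have nz : 1 - expR x * (v / u) != 0.
  apply: contra xc; rewrite subr_eq0 => /eqP h.
  have : ln 1 = x + ln (v / u) by rewrite h lnM ?posrE// expRK.
  by rewrite ln1 => /eqP; rewrite eq_sym addr_eq0.
have -> : u + expR x * v = u * (1 + expR x * (v / u)) by field.
have -> : u - expR x * v = u * (1 - expR x * (v / u)) by field.
rewrite !normrM !lnM ?posrE ?normr_gt0//; first lra.
by rewrite gt_eqF// addr_gt0// mulr_gt0.
Qed.

Lemma log_ratioN (u v x : R) : log_ratio u (- v) x = - log_ratio u v x.
Proof. by rewrite /log_ratio mulrN opprK opprB. Qed.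

Lemma log_ratio0l (v x : R) : log_ratio 0 v x = 0.
Proof. by rewrite /log_ratio add0r sub0r normrN subrr. Qed.

Lemma log_ratio0r (u x : R) : log_ratio u 0 x = 0.
Proof. by rewrite /log_ratio mulr0 addr0 subr0 subrr. Qed.

Lemma ae_eq_log_ratio (u v : R) : 0 < u * v ->
  ae_eq mu setT (fun x => (log_ratio u v x)%:E)
    (fun x => (log_ratio 1 1 (x + ln (v / u)))%:E).
Proof.
move=> uv; apply: (@ae_eq_off_points _ (- ln (v / u)) (- ln (v / u))) => x xc _.
by rewrite log_ratio_shift.
Qed.

Lemma integral_log_ratio_shift (c : R) :
  (\int[mu]_x (log_ratio 1 1 (x + c))%:E = (pi ^+ 2 / 2)%:E)%E.
Proof.
rewrite -integral_log_ratio_kernel.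
apply: (@integral_translate _ (fun x => (log_ratio 1 1 x)%:E) c).
  by apply/measurable_EFinP; apply: measurable_log_ratio.
by move=> x; rewrite lee_fin log_ratio_kernel_ge0.
Qed.

Lemma measurable_log_ratio_shift (c : R) :
  measurable_fun setT (fun x : R => (log_ratio 1 1 (x + c))%:E).
Proof.
apply/measurable_EFinP.
apply: (measurableT_comp (f := log_ratio 1 1)); first exact: measurable_log_ratio.
by apply: measurable_funD => //; exact: measurable_cst.
Qed.

Lemma integral_log_ratio_pos (u v : R) : 0 < u * v ->
  (\int[mu]_x (log_ratio u v x)%:E = (pi ^+ 2 / 2)%:E)%E.
Proof.
move=> uv; rewrite -(integral_log_ratio_shift (ln (v / u))).
apply: ae_eq_integral; first exact: measurableT.
- by apply/measurable_EFinP; apply: measurable_log_ratio.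
- exact: measurable_log_ratio_shift.
- exact: ae_eq_log_ratio.
Qed.

Lemma integral_abs_log_ratio_pos (u v : R) : 0 < u * v ->
  (\int[mu]_x `|(log_ratio u v x)%:E| = (pi ^+ 2 / 2)%:E)%E.
Proof.
move=> uv; rewrite -(integral_log_ratio_shift (ln (v / u))).
apply: ae_eq_integral; first exact: measurableT.
- apply: measurableT_comp => //; apply/measurable_EFinP; exact: measurable_log_ratio.
- exact: measurable_log_ratio_shift.
apply: (@ae_eq_off_points _ (- ln (v / u)) (- ln (v / u))) => x xc _.
by rewrite log_ratio_shift// gee0_abs// lee_fin log_ratio_kernel_ge0.
Qed.

Lemma integral_abs_log_ratio (u v : R) :
  (\int[mu]_x `|(log_ratio u v x)%:E| = (`|Num.sg (u * v)| * (pi ^+ 2 / 2))%:E)%E.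
Proof.
have [uv|uv|/eqP] := ltrgtP (u * v) 0.
- rewrite ltr0_sg// normrN normr1 mul1r -(@integral_abs_log_ratio_pos u (- v)) ?mulrN ?oppr_gt0//.
  by apply: eq_integral => x _; rewrite log_ratioN EFinN abseN.
- by rewrite gtr0_sg// normr1 mul1r integral_abs_log_ratio_pos.
- rewrite mulf_eq0 => /orP[] /eqP ->; rewrite ?mul0r ?mulr0 sgr0 normr0 mul0r.
    by apply: integral0_eq => x _; rewrite log_ratio0l abse0.
  by apply: integral0_eq => x _; rewrite log_ratio0r abse0.
Qed.

Lemma integrable_log_ratio (u v : R) : mu.-integrable setT (EFin \o log_ratio u v).
Proof.
apply/integrableP; split; first by apply/measurable_EFinP; apply: measurable_log_ratio.
by rewrite integral_abs_log_ratio ltry.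
Qed.

Lemma integral_log_ratio (u v : R) :
  (\int[mu]_x (log_ratio u v x)%:E = (Num.sg (u * v) * (pi ^+ 2 / 2))%:E)%E.
Proof.
have [uv|uv|/eqP] := ltrgtP (u * v) 0.
- have -> : (\int[mu]_x (log_ratio u v x)%:E = \int[mu]_x (- (log_ratio u (- v) x)%:E))%E.
    by apply: eq_integral => x _; rewrite log_ratioN EFinN oppeK.
  rewrite integralN; last exact: integrable_add_def (integrable_log_ratio _ _).
  by rewrite integral_log_ratio_pos ?mulrN ?oppr_gt0// ltr0_sg// mulN1r EFinN.
- by rewrite gtr0_sg// mul1r integral_log_ratio_pos.
- rewrite mulf_eq0 => /orP[] /eqP ->; rewrite ?mul0r ?mulr0 sgr0 mul0r.
    by apply: integral0_eq => x _; rewrite log_ratio0l.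
  by apply: integral0_eq => x _; rewrite log_ratio0r.
Qed.

End log_kernel.

Section sign_expectation.
Context {disp : measure_display} {Omega : measurableType disp} {R : realType}.
Variable P : probability Omega R.
Local Notation mu := (@lebesgue_measure R).

Lemma measurable_sg : measurable_fun setT (fun x : R => Num.sg x).
Proof.
apply: nondecreasing_measurable => // x y xy.
have [y0|y0|y0] := ltrgtP y 0.
- by rewrite !ltr0_sg// (le_lt_trans xy).
- rewrite [leRHS]gtr0_sg// (le_trans (ler_norm _))// normr_sg.
  by case: (x != 0).
- rewrite y0 sgr0 sgr_le0 -y0//.
Qed.

Lemma integral_cst_probability (c : R) : (\int[P]_w (cst c%:E w) = c%:E)%E.
Proof.
rewrite integral_cst//; transitivity (c%:E * 1)%E; last by rewrite mule1.
congr (_ * _)%E; exact: probability_setT.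
Qed.

Lemma measurable_log_ratio2 (U V : Omega -> R) :
  measurable_fun setT U -> measurable_fun setT V ->
  measurable_fun setT (fun z : Omega * R => log_ratio (U z.1) (V z.1) z.2).
Proof.
move=> mU mV.
have mU1 : measurable_fun setT (fun z : Omega * R => U z.1) by exact: measurableT_comp.
have mV1 : measurable_fun setT (fun z : Omega * R => V z.1) by exact: measurableT_comp.
have me : measurable_fun setT (fun z : Omega * R => expR z.2 * V z.1).
  apply: measurable_funM => //.
  by apply: (measurableT_comp (f := @expR R)).
apply: measurable_funB; apply: measurableT_comp => //; apply: measurableT_comp => //.
  exact: measurable_funD.
exact: measurable_funB.
Qed.

(* The hypothesis says that E ln |U + s e^x V| depends on the law of (U, V) only
   through the variance of U + s e^x V, up to the constant kappa. *)
Lemma expectation_sg (U V : Omega -> R) (rho kappa : R) :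
  measurable_fun setT U -> measurable_fun setT V -> -1 < rho < 1 ->
  (forall x s, (s = 1 \/ s = -1) ->
     P.-integrable setT (fun w => (ln `|U w + s * expR x * V w|)%:E) /\
     (\int[P]_w (ln `|U w + s * expR x * V w|)%:E =
       (2^-1 * ln (1 + 2 * (s * rho) * expR x + expR x ^+ 2) + kappa)%:E)%E) ->
  (\int[P]_w (Num.sg (U w * V w))%:E = (1 - 2 * acos rho / pi)%:E)%E.
Proof.
move=> mU mV /andP[r0 r1] logint.
have rin : -1 <= rho <= 1 by rewrite !ltW.
have pi0 := @pi_gt0 R.
pose f (z : Omega * measurableTypeR R) := (log_ratio (U z.1) (V z.1) z.2)%:E.
have mf : measurable_fun setT f.
  by apply/measurable_EFinP; apply: measurable_log_ratio2.
have intf : (P \x mu)%E.-integrable setT f.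
  (* Domination for Fubini: for every outcome the integral of [|f|] over [x] is [0] or
     [pi^2 / 2]. *)
  apply: (@integrable12ltyP _ _ _ (measurableTypeR R) R P mu f mf).2.
  apply: (@le_lt_trans _ _ (\int[P]_w (cst (pi ^+ 2 / 2)%:E w))%E).
    apply: ge0_le_integral.
    - exact: measurableT.
    - by move=> w _; apply: integral_ge0.
    - apply: (@measurable_fun_fubini_tonelli_F _ _ _ _ _ mu (fun z => `|f z|%E)) => //.
      exact: measurableT_comp.
    - exact: measurable_cst.
    move=> w _.
    have h : (\int[mu]_y `|f (w, y)| = (`|Num.sg (U w * V w)| * (pi ^+ 2 / 2))%:E)%E.
      rewrite -integral_abs_log_ratio; apply: eq_integral => y _; reflexivity.
    rewrite h lee_fin ler_piMl ?divr_ge0 ?sqr_ge0//.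
    by rewrite normr_sg lern1 leq_b1.
  by rewrite integral_cst_probability ltry.
have fub := Fubini intf.
have isg : P.-integrable setT (fun w => (Num.sg (U w * V w))%:E).
  apply/integrableP; split.
    by apply/measurable_EFinP; apply: (measurableT_comp measurable_sg); apply: measurable_funM.
  apply: (@le_lt_trans _ _ (\int[P]_w (cst 1 w))%E).
    apply: ge0_le_integral.
    - exact: measurableT.
    - by move=> w _.
    - apply: measurableT_comp => //.
      by apply/measurable_EFinP; apply: (measurableT_comp measurable_sg); apply: measurable_funM.
    - exact: measurable_cst.
    by move=> w _; rewrite lee_fin normr_sg lern1 leq_b1.
  by rewrite integral_cst_probability ltry.
have lhs : (\int[P]_w \int[mu]_x f (w, x) =
    (pi ^+ 2 / 2)%:E * \int[P]_w (Num.sg (U w * V w))%:E)%E.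
  rewrite -integralZl; last 2 first.
  - exact: measurableT.
  - exact: isg.
  apply: eq_integral => w _.
  have h : (\int[mu]_y f (w, y) = (Num.sg (U w * V w) * (pi ^+ 2 / 2))%:E)%E.
    rewrite -integral_log_ratio; apply: eq_integral => y _; reflexivity.
  by rewrite h -EFinM mulrC.
have quad_pos (s x : R) : s = 1 \/ s = -1 -> 0 < 1 + 2 * (s * rho) * expR x + expR x ^+ 2.
  move=> s1; have -> : 1 + 2 * (s * rho) * expR x + expR x ^+ 2 =
    (1 - rho ^+ 2) + (s * rho + expR x) ^+ 2.
    by case: s1 => ->; ring.
  rewrite ltr_pwDl ?sqr_ge0// subr_gt0 -[rho ^+ 2]real_normK ?num_real//.
  by rewrite expr_lt1// ltr_norml r0.
(* The factor [2 e^x] does not depend on [s], so it cancels, together with [kappa], in the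
   difference of the cases [s = 1] and [s = -1]. *)
have quadE (s x : R) : s = 1 \/ s = -1 ->
    ln (1 + 2 * (s * rho) * expR x + expR x ^+ 2) = ln (ch x + s * rho) + ln (2 * expR x).
  move=> s1; have e0 := expR_gt0 x.
  have e2 : 0 < 2 * expR x by rewrite mulr_gt0.
  have E : 1 + 2 * (s * rho) * expR x + expR x ^+ 2 = (ch x + s * rho) * (2 * expR x).
    by rewrite /ch expRN; field; rewrite gt_eqF.
  have := quad_pos s x s1; rewrite E pmulr_lgt0// => c0.
  by rewrite lnM ?posrE.
pose a := acos rho.
have a0 : 0 <= a by exact: acos_ge0.
have cosa : cos a = rho by rewrite /a acosK// in_itv.
have ain : 0 <= a <= pi by rewrite a0 acos_lepi.
have bin : 0 <= pi - a <= pi by rewrite subr_ge0 gerBl acos_lepi.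
have cosb : cos (pi - a) = - rho.
  by rewrite -opprB cosN cosB cospi sinpi mulr0 addr0 mulrN1 cosa.
have rhs : (\int[mu]_x \int[P]_w f (w, x) = (2^-1 * ((pi - a) ^+ 2 - a ^+ 2))%:E)%E.
  transitivity (\int[mu]_x (2^-1%:E * (ln (ch x + cos a) - ln (ch x + cos (pi - a)))%:E))%E.
    apply: eq_integral => x _.
    have [i1 e1] := logint x 1 (or_introl erefl).
    have [i2 e2] := logint x (-1) (or_intror erefl).
    transitivity (\int[P]_w ((ln `|U w + 1 * expR x * V w|)%:E - (ln `|U w + -1 * expR x * V w|)%:E))%E.
      by apply: eq_integral => w _; rewrite /f /log_ratio /= mul1r mulN1r mulNr EFinB.
    rewrite integralB_EFin// e1 e2 -EFinB -EFinM; congr EFin.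
    by rewrite !quadE ?cosa ?cosb ?mul1r ?mulN1r; [lra|right|left].
  rewrite integralZl; last 2 first.
  - exact: measurableT.
  - exact: integrable_ln_ch.
  by rewrite integral_ln_chE// EFinM.
(* Since [(pi - a)^2 - a^2 = pi^2 - 2 pi a], dividing by [pi^2] leaves [1 - 2 a / pi]. *)
rewrite lhs rhs in fub.
have p2 : 0 < pi ^+ 2 / 2 :> R by rewrite divr_gt0// exprn_gt0.
have fin := integrable_fin_num measurableT isg.
move: fub; rewrite -(fineK fin) -EFinM => -[h]; congr EFin.
have p0 : pi ^+ 2 / 2 != 0 :> R by rewrite gt_eqF.
apply: (mulfI p0); rewrite h -/a; clear -pi0; move: (@pi R) pi0 => p p0; field.
by rewrite gt_eqF.
Qed.

End sign_expectation.

(** * Integrability of the logarithm of a Gaussian difference *)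

Section gaussian_log.
Context {R : realType}.
Local Notation mu := (@lebesgue_measure R).
Let N1 : probability (measurableTypeR R) R := normal_prob 0 1.

Import HBNNSimple.

(** Tested on simple functions below [f], whose level sets are measured by the density. The
    one-sided bound is enough to show that an integral is finite. *)
Lemma integral_density_le (nu : {measure set (measurableTypeR R) -> \bar R}) (h : R -> R)
    (f : R -> R) :
  (forall x, 0 <= h x) -> measurable_fun setT h ->
  (forall A, measurable A -> nu A = (\int[mu]_(x in A) (h x)%:E)%E) ->
  (forall x, 0 <= f x) -> measurable_fun setT f ->
  (\int[nu]_x (f x)%:E <= \int[mu]_x (f x * h x)%:E)%E.
Proof.
move=> h0 mh nuE f0 mf.
rewrite ge0_integralTE; last by move=> x; rewrite lee_fin.
apply: ge_ereal_sup => _ [g /= gf <-].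
rewrite sintegralE.
have -> : (\sum_(x \in range g) x%:E * nu (g @^-1` [set x]) = \int[mu]_x ((h x)%:E * (g x)%:E))%E.
  under [RHS]eq_integral.
    move=> x _; rewrite fimfunE -fsumEFin// ge0_mule_fsumr; last first.
      by move=> r; rewrite EFinM nnfun_muleindic_ge0.
    over.
  rewrite [RHS]ge0_integral_fsum//; last 2 first.
  - move=> r; apply: emeasurable_funM; first exact/measurable_EFinP.
    by apply/measurable_EFinP; apply: measurable_funM => //; exact: measurable_cst.
  - by move=> n x _; rewrite mule_ge0// ?lee_fin// -lee_fin EFinM nnfun_muleindic_ge0.
  apply: eq_fsbigr => r _.
  have mA : measurable (g @^-1` [set r]) by exact: measurable_sfunP.
  have [r0|r0] := ltP r 0.
    have -> : g @^-1` [set r] = set0.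
      by apply/seteqP; split => x //= gx; move: r0; rewrite -gx ltNge fun_ge0.
    by rewrite measure0 mule0 integral0_eq// => x _; rewrite indic0 mulr0 mule0.
  rewrite nuE// -ge0_integralZl//.
  - rewrite [LHS]integral_mkcond; apply: eq_integral => x _.
    rewrite patchE indicE; case: ifP => _; first by rewrite mulr1 muleC.
    by rewrite mulr0 mule0.
  - by apply/measurable_EFinP; exact: measurable_funTS.
  - by move=> x _; rewrite lee_fin.
apply: ge0_le_integral.
- exact: measurableT.
- by move=> x _; rewrite mule_ge0// lee_fin.
- by apply: emeasurable_funM; apply/measurable_EFinP.
- apply/measurable_EFinP; apply: measurable_funM => //. 
- by move=> x _; rewrite -EFinM lee_fin mulrC ler_wpM2r// -lee_fin.
Qed.

Lemma normal_prob_le (A : set R) : measurable A -> (N1 A <= (normal_peak 1)%:E * mu A)%E.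
Proof.
move=> mA; rewrite /N1 /= /normal_prob -integral_cst//; apply: ge0_le_integral => //.
- by move=> x _; rewrite lee_fin normal_pdf_ge0.
- apply/measurable_EFinP; apply: measurable_funTS; exact: measurable_normal_pdf.
- by move=> x _; rewrite lee_fin normal_pdf_ub// oner_neq0.
Qed.

Lemma measurable_normR : measurable_fun setT (fun x : R => `|x|).
Proof. exact: normr_measurable. Qed.

(** Comparison with the normal density of standard deviation [2]: the ratio of exponentials is
    [expR (3 x^2 / 8)], which dominates [|x|], and [C] is the ratio of the peaks. *)
Lemma integral_normal_abs : (\int[N1]_x `|x|%:E < +oo)%E.
Proof.
pose C := normal_peak 1 / normal_peak (2 : R).
have p1 := @normal_peak_gt0 R 1 (oner_neq0 _).
have n2 : (2 : R) != 0 by [].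
have p2 := @normal_peak_gt0 R 2 n2.
apply: (@le_lt_trans _ _ (\int[mu]_x (`|x| * normal_pdf 0 1 x)%:E)%E).
  apply: integral_density_le => //.
  - by move=> x; exact: normal_pdf_ge0.
  - exact: measurable_normal_pdf.
apply: (@le_lt_trans _ _ (\int[mu]_x (C%:E * (normal_pdf 0 2 x)%:E))%E).
  apply: ge0_le_integral.
  - exact: measurableT.
  - by move=> x _; rewrite lee_fin mulr_ge0// normal_pdf_ge0.
  - apply/measurable_EFinP; apply: measurable_funM; first exact: measurable_normR.
    exact: measurable_normal_pdf.
  - apply: emeasurable_funM => //; apply/measurable_EFinP; exact: measurable_normal_pdf.
  move=> x _; rewrite -EFinM lee_fin !normal_pdfE// ?oner_neq0//.
  rewrite /normal_fun !subr0 /C mulrCA -!mulrA ler_wpM2l ?(ltW p1)//.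
  rewrite mulKf ?gt_eqF//.
  have -> : - x ^+ 2 / (2 ^+ 2 *+ 2) = 3 / 8 * x ^+ 2 + - x ^+ 2 / (1 ^+ 2 *+ 2).
    by field.
  rewrite expRD ler_wpM2r ?expR_ge0//.
  apply: le_trans (expR_ge1Dx _).
  have := sqr_ge0 (`|x| - 4 / 3); have -> : x ^+ 2 = `|x| ^+ 2 by rewrite real_normK ?num_real.
  move: `|x| => y; rewrite sqrrB; nra.
rewrite ge0_integralZl//.
- by rewrite integral_normal_pdf mule1 ltry.
- apply/measurable_EFinP; exact: measurable_normal_pdf.
- by move=> x _; rewrite lee_fin normal_pdf_ge0.
- by rewrite lee_fin divr_ge0// ltW.
Qed.

Lemma log_ratio_kernelN (z : R) : log_ratio 1 1 (- z) = log_ratio 1 1 z.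
Proof.
have [->|z0] := eqVneq z 0; first by rewrite oppr0.
by rewrite !log_ratio_kernelE ?oppr_eq0// /ch opprK [expR (- z) + _]addrC.
Qed.

(** Near zero the kernel has the same logarithmic singularity: for [0 < y < 1],
    [1 / y <= (1 + e^y) / (e^y - 1)] follows from [1 - y <= e^(-y)]. Away from zero
    [ln |z| <= |z| - 1]. The integral of the singularity is thus the one already computed. *)
Lemma abs_ln_le (z : R) : `|ln `|z| | <= log_ratio 1 1 z + `|z|.
Proof.
have k0 := log_ratio_kernel_ge0 z.
have [->|z0] := eqVneq z 0; first by rewrite normr0 ln0// normr0 addr0; exact: log_ratio_kernel_ge0.
have az : 0 < `|z| by rewrite normr_gt0.
have [z1|z1] := leP 1 `|z|.
  rewrite ger0_norm ?ln_ge0//.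
  have -> : ln `|z| = ln (1 + (`|z| - 1)) by rewrite addrC subrK.
  have : ln (1 + (`|z| - 1)) <= `|z| - 1 by apply: le_ln1Dx; lra.
  lra.
rewrite ler0_norm; last by rewrite ln_le0// ltW.
suff : - ln `|z| <= log_ratio 1 1 z by move/le_trans; apply; rewrite lerDl ltW.
have even : log_ratio 1 1 z = log_ratio 1 1 `|z|.
  by have [zge|zlt] := ger0P z; rewrite ?log_ratio_kernelN.
rewrite even; move: (`|z|) az z1 {k0 even} => y y0 y1.
have e1 : 1 < expR y by rewrite expR_gt1.
have e0 := expR_gt0 y.
have p0 : 0 < 1 + expR y by rewrite addr_gt0.
have q0 : 0 < expR y - 1 by rewrite subr_gt0.
rewrite /log_ratio !mulr1 gtr0_norm// -normrN opprB gtr0_norm//.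
rewrite lerNl opprB lerBlDr -lnM ?posrE// ler_ln ?posrE// ?mulr_gt0//.
have := expR_ge1Dx (- y); rewrite expRN -(ler_pM2r e0) mulVf ?gt_eqF//; lra.
Qed.

(** The normal law is at most its peak times Lebesgue measure, under which the integral of the
    kernel does not depend on [x]. *)
Lemma integral_kernel_normal (x : R) :
  (\int[N1]_y (log_ratio 1 1 (x - y))%:E <= (normal_peak 1 * (pi ^+ 2 / 2))%:E)%E.
Proof.
have mk : measurable_fun setT (fun y : R => (log_ratio 1 1 (y + - x))%:E).
  exact: measurable_log_ratio_shift.
have -> : (\int[N1]_y (log_ratio 1 1 (x - y))%:E = \int[N1]_y (log_ratio 1 1 (y + - x))%:E)%E.
  by apply: eq_integral => y _; rewrite -log_ratio_kernelN opprB.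
have p0 : 0 <= normal_peak (1 : R) by exact: normal_peak_ge0.
pose k := NngNum p0.
apply: (@le_trans _ _ (\int[mscale k mu]_y (log_ratio 1 1 (y + - x))%:E)%E).
  apply: ge0_le_measure_integral => //.
  - by move=> A mA; exact: normal_prob_le.
  - by move=> y; rewrite lee_fin log_ratio_kernel_ge0.
rewrite ge0_integral_mscale//.
- by rewrite integral_log_ratio_shift.
- by move=> y _; rewrite lee_fin log_ratio_kernel_ge0.
Qed.

Lemma measurable_absln_shift (x : R) :
  measurable_fun setT (fun y : R => `|ln `|x - y| |).
Proof.
apply: measurableT_comp => //; apply: measurableT_comp => //; apply: measurableT_comp => //.
exact: measurable_funB.
Qed.

(** By [abs_ln_le] the integrand is bounded by a kernel whose normal mean is bounded uniformly in
    [x], plus [|x| + |y|], which has finite mean. *)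
Lemma integrable_ln_normal :
  (N1 \x N1)%E.-integrable setT (fun z => (ln `|z.1 - z.2|)%:E).
Proof.
have mf : measurable_fun setT (fun z : R * R => (ln `|z.1 - z.2|)%:E).
  apply/measurable_EFinP; apply: measurableT_comp => //; apply: measurableT_comp => //.
  exact: measurable_funB.
apply: (@integrable12ltyP _ _ (measurableTypeR R) (measurableTypeR R) R N1 N1 _ _).2 => //.
set K := (\int[N1]_x `|x|%:E)%E.
have K0 : (0 <= K)%E by apply: integral_ge0 => x _; rewrite lee_fin.
have Koo : (K < +oo)%E := integral_normal_abs.
pose c := (normal_peak 1 * (pi ^+ 2 / 2) : R).
have c0 : 0 <= c by rewrite mulr_ge0 ?normal_peak_ge0// divr_ge0// sqr_ge0.
have mabs : measurable_fun setT (fun y : R => `|y|%:E).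
  by apply/measurable_EFinP; apply: measurable_normR.
have mk x : measurable_fun setT (fun y : R => (log_ratio 1 1 (x - y))%:E).
  have -> : (fun y : R => (log_ratio 1 1 (x - y))%:E) = (fun y => (log_ratio 1 1 (y + - x))%:E).
    by apply/funext => y; rewrite -log_ratio_kernelN opprB.
  exact: measurable_log_ratio_shift.
apply: (@le_lt_trans _ _ (\int[N1]_x (c%:E + (`|x|%:E + K)))%E).
  apply: ge0_le_integral.
  - exact: measurableT.
  - by move=> x _; apply: integral_ge0.
  - apply: (@measurable_fun_fubini_tonelli_F _ _ (measurableTypeR R) (measurableTypeR R) R N1
      (fun z => `|(ln `|z.1 - z.2|)%:E|%E)) => //.
    exact: measurableT_comp.
  - apply: emeasurable_funD; first exact: measurable_cst.
    by apply: emeasurable_funD => //; exact: measurable_cst.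
  move=> x _.
  apply: (@le_trans _ _ (\int[N1]_y ((log_ratio 1 1 (x - y))%:E + (`|x|%:E + `|y|%:E)))%E).
    apply: ge0_le_integral.
    - exact: measurableT.
    - by move=> y _.
    - apply/measurable_EFinP; apply: measurable_absln_shift.
    - apply: emeasurable_funD; first exact: mk.
      by apply: emeasurable_funD => //; apply: measurable_cst.
    - move=> y _; rewrite lee_fin (le_trans (abs_ln_le _))// lerD2l.
      exact: ler_normB.
  rewrite ge0_integralD//; last 4 first.
  - by move=> y _; rewrite lee_fin log_ratio_kernel_ge0.
  - exact: mk.
  - by move=> y _; rewrite lee_fin addr_ge0.
  - by apply: emeasurable_funD => //; apply: measurable_cst.
  rewrite leeD//; first exact: integral_kernel_normal.
  rewrite ge0_integralD//.
  by rewrite integral_cst_probability.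
have KE : K = (fine K)%:E by rewrite fineK// ge0_fin_numE.
have k0 : 0 <= fine K by exact: fine_ge0.
rewrite KE ge0_integralD//; last first.
- by apply: emeasurable_funD => //; apply: measurable_cst.
- by move=> y _; rewrite lee_fin addr_ge0.
rewrite ge0_integralD//.
rewrite !integral_cst_probability -/K KE -!EFinD; exact: ltry.
Qed.

End gaussian_log.

Section gaussian_pair.
Context {disp : measure_display} {Omega : measurableType disp} {R : realType}.
Variable P : probability Omega R.
Let N1 : probability (measurableTypeR R) R := normal_prob 0 1.

Lemma normal_productT : (N1 \x N1)%E setT = 1%E.
Proof.
have := @product_measure1E _ _ (measurableTypeR R) (measurableTypeR R) R N1 N1 _ _
  measurableT measurableT.
rewrite setXTT => E; apply: etrans E _.
have H : N1 setT = 1%E by exact: probability_setT.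
by rewrite -[RHS](mul1e 1%E); congr (_ * _)%E.
Qed.

Lemma diagonal_null : (N1 \x N1)%E [set z | z.1 = z.2] = 0%E.
Proof.
apply: (@integral0_eq _ (measurableTypeR R)) => x _ /=.
have -> : xsection [set z : R * R | z.1 = z.2] x = [set x].
  by apply/seteqP; split => y /=; rewrite /xsection /= inE.
apply/eqP; rewrite eq_le measure_ge0 andbT.
apply: le_trans (normal_prob_le _) _; first exact: measurable_set1.
by rewrite lebesgue_measure_set1 mule0.
Qed.

Lemma measurable_diagonal : measurable [set z : measurableTypeR R * measurableTypeR R | z.1 = z.2].
Proof.
have -> : [set z : measurableTypeR R * measurableTypeR R | z.1 = z.2] =
    (fun z : R * R => z.1 - z.2) @^-1` [set 0].
  by apply/seteqP; split => z /=; [move=> ->; rewrite subrr|move=> /eqP; rewrite subr_eq0 => /eqP].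
rewrite -[_ @^-1` _]setTI; apply: measurable_funB => //.
Qed.

Variables A A' : Omega -> R.
Hypotheses (mA : measurable_fun setT A) (mA' : measurable_fun setT A').
Hypothesis lawA : forall B : set R, measurable B -> P (A @^-1` B) = normal_prob 0 1 B.
Hypothesis lawA' : forall B : set R, measurable B -> P (A' @^-1` B) = normal_prob 0 1 B.
Hypothesis indep : forall B B' : set R, measurable B -> measurable B' ->
  P (A @^-1` B `&` A' @^-1` B') = (P (A @^-1` B) * P (A' @^-1` B'))%E.

Let phi (w : Omega) : measurableTypeR R * measurableTypeR R := (A w, A' w).

Let mphi : measurable_fun setT phi.
Proof. by apply/measurable_fun_pairP; split. Qed.

Let pairE X : measurable X -> pushforward P phi X = (N1 \x N1)%E X.
Proof.
pose m' := [the measure _ _ of pushforward P phi].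
move=> mX; have := @product_measure_unique _ _ (measurableTypeR R) (measurableTypeR R) R
  N1 N1 (m' mphi).
move=> H; apply/esym; apply: H => //= B B' mB mB'.
rewrite -(lawA mB) -(lawA' mB') -indep//.
Qed.

Lemma gaussian_pair_integral (h : R * R -> R) : (N1 \x N1)%E.-integrable setT (EFin \o h) ->
  P.-integrable setT (fun w => (h (A w, A' w))%:E) /\
  (\int[P]_w (h (A w, A' w))%:E = \int[N1 \x N1]_z (h z)%:E)%E.
Proof.
move=> ih.
have mh : measurable_fun setT (EFin \o h) := measurable_int _ ih.
pose m' := [the measure _ _ of pushforward P phi].
have intE f : (\int[m' mphi]_z f z = \int[N1 \x N1]_z f z)%E.
  by apply: eq_measure_integral => X mX _; apply: pairE.
have ip : P.-integrable setT (fun w => (h (A w, A' w))%:E).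
  apply/integrableP; split; first by apply: (measurableT_comp mh).
  have /integrableP[_] := ih; rewrite -intE /m' ge0_integral_pushforward//; last first.
    exact: measurableT_comp.
split => //; rewrite -intE.
by rewrite /m' integral_pushforward.
Qed.

(** The logarithm splits into [ln sigma] and a fixed integrand off the diagonal; there the
    convention [ln 0 = 0] can break the splitting, but the diagonal is null. *)
Lemma integral_ln_gaussian_diff (sigma : R) : 0 < sigma ->
  P.-integrable setT (fun w => (ln `|sigma * A w - sigma * A' w|)%:E) /\
  (\int[P]_w (ln `|sigma * A w - sigma * A' w|)%:E =
   (ln sigma + fine (\int[N1 \x N1]_z (ln `|z.1 - z.2|)%:E))%:E)%E.
Proof.
move=> s0.
have il := @integrable_ln_normal R.
pose h (z : R * R) := ln `|sigma * z.1 - sigma * z.2|.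
have cstE (c : R) : (\int[N1 \x N1]_z cst c%:E z)%E = c%:E.
  rewrite integral_cst; last exact: measurableT.
  by rewrite -[RHS]mule1 -normal_productT.
have icst : (N1 \x N1)%E.-integrable setT (cst (ln sigma)%:E).
  apply/integrableP; split; first exact: measurable_cst.
  by rewrite (cstE `|ln sigma|); exact: ltry.
have ih' : (N1 \x N1)%E.-integrable setT (fun z => (ln sigma + ln `|z.1 - z.2|)%:E).
  have -> : (fun z : R * R => (ln sigma + ln `|z.1 - z.2|)%:E) =
      (fun z => (cst (ln sigma)%:E z + (ln `|z.1 - z.2|)%:E)%E) by apply/funext.
  apply: integrableD; [exact: measurableT| |exact: il].
  exact: icst.
have mh : measurable_fun setT (EFin \o h).
  apply/measurable_EFinP; apply: measurableT_comp => //; apply: measurableT_comp => //.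
  by apply: measurable_funB; apply: measurable_funM.
have ae : ae_eq (N1 \x N1)%E setT (EFin \o h) (fun z => (ln sigma + ln `|z.1 - z.2|)%:E).
  exists [set z | z.1 = z.2]; split; [exact: measurable_diagonal|exact: diagonal_null|].
  move=> z /=; apply: contra_notP => zz _; rewrite /h -mulrBr normrM gtr0_norm// lnM// posrE.
  by rewrite normr_gt0 subr_eq0; apply/eqP.
have ih : (N1 \x N1)%E.-integrable setT (EFin \o h).
  apply/integrableP; split; first exact: mh.
  have /integrableP[m' /le_lt_trans] := ih'; apply.
  rewrite le_eqVlt; apply/orP; left; apply/eqP; apply: ae_eq_integral; first exact: measurableT.
  - exact: (measurableT_comp _ mh).
  - exact: (measurableT_comp _ m').
  - have [D [mD D0 DE]] := ae; exists D; split => //.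
    by move=> z zE; apply: DE => e; apply: zE => t; exact: (congr1 abse (e t)).
have [i1 i2] := gaussian_pair_integral ih; split; first exact: i1.
rewrite [LHS]i2 (ae_eq_integral _ _ _ _ _ ae)//; last exact: (measurable_int _ ih').
have -> : (fun z : R * R => (ln sigma + ln `|z.1 - z.2|)%:E) =
    (fun z => (cst (ln sigma)%:E z + (ln `|z.1 - z.2|)%:E)%E) by apply/funext.
rewrite integralD; [|exact: measurableT|exact: icst|exact: il].
rewrite cstE EFinD fineK//.
exact: (integrable_fin_num measurableT il).
Qed.

End gaussian_pair.

Section two_coordinates.
Context {R : realType} {d : nat}.

Definition two_coord (j k : 'I_d) (a b : R) : 'cV[R]_d := a *: delta_mx j 0 + b *: delta_mx k 0.

Lemma sum_delta (j : 'I_d) (z : 'I_d -> R) : \sum_l (delta_mx j 0 : 'cV[R]_d) l 0 * z l = z j.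
Proof.
rewrite (bigD1 j)//= big1 => [|l lj]; rewrite mxE ?eqxx ?mul1r ?addr0//.
by rewrite (negbTE lj) mul0r.
Qed.

Lemma sum_two_coord j k a b (z : 'I_d -> R) :
  \sum_l two_coord j k a b l 0 * z l = a * z j + b * z k.
Proof.
have E l : two_coord j k a b l 0 = a * (delta_mx j 0 : 'cV[R]_d) l 0 + b * (delta_mx k 0 : 'cV[R]_d) l 0 by rewrite !mxE.
under eq_bigr do rewrite E mulrDl -!mulrA.
by rewrite big_split/= -!mulr_sumr !sum_delta.
Qed.

Lemma quad_two_coord j k a b (S : 'M[R]_d) : S^T = S ->
  ((two_coord j k a b)^T *m S *m two_coord j k a b) 0 0 =
  a ^+ 2 * S j j + 2 * (a * b) * S j k + b ^+ 2 * S k k.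
Proof.
move=> sS; rewrite -mulmxA mxE.
under eq_bigr do rewrite mxE.
rewrite sum_two_coord !mxE.
under [X in a * X]eq_bigr do rewrite mulrC.
under [X in _ + b * X]eq_bigr do rewrite mulrC.
rewrite (sum_two_coord _ _ _ _ (S j)) (sum_two_coord _ _ _ _ (S k)).
have -> : S k j = S j k by rewrite -{1}sS mxE.
ring.
Qed.

Lemma two_coord_neq0 j k a b : j != k -> a != 0 -> two_coord j k a b != 0.
Proof.
move=> jk a0; apply/eqP => /matrixP /(_ j 0); rewrite !mxE eqxx (negbTE jk) mulr0 addr0 mulr1.
by move/eqP; apply/negP.
Qed.

(** Positivity of the form at the sum and at the difference of two basis vectors. *)
Lemma offdiag_correlation (Sigma : 'M[R]_d) j k : correlation_mx Sigma -> j != k ->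
  -1 < Sigma j k < 1.
Proof.
move=> [[sy pd] dg] jk.
have := pd _ (two_coord_neq0 1 jk (oner_neq0 _)).
have := pd _ (two_coord_neq0 (- 1) jk (oner_neq0 _)).
rewrite !quad_two_coord// !dg; lra.
Qed.

End two_coordinates.

(** * Population value of Kendall's tau for a nonparanormal pair *)

Section sample.
Context {disp : measure_display} {Omega : measurableType disp} {R : realType}.
Variable P : probability Omega R.

Lemma measurable_increasing (f : R -> R) : (forall x y, x < y -> f x < f y) ->
  measurable_fun setT f.
Proof.
move=> fi; apply: nondecreasing_measurable => //.
by move=> x y; rewrite le_eqVlt => /predU1P[->//|/fi/ltW].
Qed.

Lemma sg_increasing (f : R -> R) x y : (forall x y, x < y -> f x < f y) ->
  Num.sg (f x - f y) = Num.sg (x - y).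
Proof.
move=> fi; have [xy|xy|->] := ltgtP x y; last by rewrite !subrr.
- by rewrite !ltr0_sg// subr_lt0// fi.
- by rewrite !gtr0_sg// subr_gt0// fi.
Qed.

Variables (n d : nat) (X : 'I_n -> {RV P >-> d.-tuple R}).
Hypothesis indX : mutually_independent X.

Lemma independent_pair (i i' : 'I_n) (E E' : set (d.-tuple R)) : i != i' ->
  measurable E -> measurable E' ->
  P (X i @^-1` E `&` X i' @^-1` E') = (P (X i @^-1` E) * P (X i' @^-1` E'))%E.
Proof.
move=> ii mE mE'.
pose B l : set (d.-tuple R) := if l == i then E else if l == i' then E' else setT.
have mB l : measurable (B l) by rewrite /B; case: ifP => // _; case: ifP => // _.
have i'i : (i' == i) = false by rewrite eq_sym; apply/negbTE.
have := indX mB.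
rewrite (bigD1 i)//= (bigD1 i')/=; last by rewrite eq_sym.
rewrite big1 ?mule1.
  rewrite {2 3}/B eqxx i'i eqxx => <-; congr (P _); apply/seteqP; split => w /=.
  - by move=> [Ei Ei'] l; rewrite /B; case: eqP => [->//|_]; case: eqP => [->|].
  - move=> H; split; first by have := H i; rewrite /B eqxx.
    by have := H i'; rewrite /B i'i eqxx.
move=> l /andP[/negbTE li /negbTE li']; rewrite /B li li' preimage_setT.
exact: probability_setT.
Qed.

Variable f : 'I_d -> R -> R.
Hypothesis fi : forall j x y, x < y -> f j x < f j y.
Variable Sigma : 'M[R]_d.
Hypothesis corr : correlation_mx Sigma.
Hypothesis npn : forall i, nonparanormal f Sigma (X i).

(** Let [U], [V] be the differences of the transformed coordinates [j], [k] of two observations;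
    they have the signs of the raw differences. Then [U + s e^x V] is [sigma] times the difference
    of the independent standard normals [g (X i)] and [g (X i')], so only laws of linear
    combinations enter. *)
Lemma expectation_sg_pair (i i' : 'I_n) (j k : 'I_d) : i != i' -> j != k ->
  (\int[P]_w (Num.sg ((tnth (X i w) j - tnth (X i' w) j) *
                      (tnth (X i w) k - tnth (X i' w) k)))%:E =
   (1 - 2 * acos (Sigma j k) / pi)%:E)%E.
Proof.
move=> ii jk.
have rho := offdiag_correlation corr jk.
pose Z l (t : d.-tuple R) := f l (tnth t l).
have mZ l : measurable_fun setT (Z l).
  by apply: (measurableT_comp (measurable_increasing (fi l))); exact: measurable_tnth.
have mX i0 : measurable_fun setT (X i0) := measurable_funPT (X i0).
have mZX i0 l : measurable_fun setT (Z l \o X i0) := measurableT_comp (mZ l) (mX i0).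
pose kappa : R := fine (\int[normal_prob 0 1 \x normal_prob 0 1]_z (ln `|z.1 - z.2|)%:E).
transitivity (\int[P]_w (Num.sg ((Z j (X i w) - Z j (X i' w)) *
                                  (Z k (X i w) - Z k (X i' w))))%:E)%E.
  by apply: eq_integral => w _; rewrite !sgrM /Z !(sg_increasing _ _ (fi _)).
apply: (@expectation_sg _ _ _ P _ _ _ kappa) => //.
- exact: (measurable_funB (mZX i j) (mZX i' j)).
- exact: (measurable_funB (mZX i k) (mZX i' k)).
move=> x s s1.
set rho0 := Sigma j k in rho *.
have s2 : s ^+ 2 = 1 by case: s1 => ->; rewrite ?sqrrN expr1n.
have e0 := expR_gt0 x; set e := expR x in e0 *.
pose q := 1 + 2 * (s * rho0) * e + e ^+ 2.
have q0 : 0 < q.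
  have -> : q = (1 + s * rho0 * e) ^+ 2 + e ^+ 2 * (1 - s ^+ 2 * rho0 ^+ 2) by rewrite /q; ring.
  have : 0 < e ^+ 2 * (1 - s ^+ 2 * rho0 ^+ 2).
    by rewrite s2 mul1r mulr_gt0 ?exprn_gt0//; move: rho => /andP[? ?]; nra.
  by have := sqr_ge0 (1 + s * rho0 * e); lra.
pose sigma := Num.sqrt q.
have sg0 : 0 < sigma by rewrite sqrtr_gt0.
have sg2 : sigma ^+ 2 = q by rewrite sqr_sqrtr// ltW.
(* The weights are divided by [sigma], the standard deviation of [Z j + s e^x Z k], so that the
   combination [g] has unit variance. *)
pose v := two_coord j k sigma^-1 (sigma^-1 * (s * e)).
have v0 : v != 0 by rewrite two_coord_neq0// invr_neq0// gt_eqF.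
have [[sy _] dg] := corr.
have var1 : (v^T *m Sigma *m v) 0 0 = 1.
  rewrite quad_two_coord// !dg -/rho0 !mulr1.
  transitivity (sigma^-1 ^+ 2 * (1 + 2 * (s * rho0) * e + s ^+ 2 * e ^+ 2)); first by ring.
  by rewrite s2 mul1r -/q -sg2 -exprMn mulVf ?expr1n// gt_eqF.
pose g (t : d.-tuple R) := \sum_l v l 0 * Z l t.
have mg : measurable_fun setT g.
  by apply: measurable_sum => l; apply: measurable_funM => //; exact: measurable_cst.
have mgV (B : set R) : measurable B -> measurable (g @^-1` B).
  by move=> mB; rewrite -[_ @^-1` _]setTI; exact: mg.
have gE t : sigma * g t = Z j t + s * e * Z k t.
  rewrite /g sum_two_coord mulrDr !mulrA divff ?gt_eqF// !mul1r.
  by [].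
have law i0 (B : set R) : measurable B -> P ((g \o X i0) @^-1` B) = normal_prob 0 1 B.
  by move=> mB; rewrite -[in RHS]sqrtr1 -var1 -(npn i0 v0 mB).
have [] := @integral_ln_gaussian_diff _ _ _ P (g \o X i) (g \o X i')
  (measurableT_comp mg (mX i)) (measurableT_comp mg (mX i')) (law i) (law i') _ sigma sg0.
  by move=> B B' mB mB'; exact: (independent_pair ii (mgV _ mB) (mgV _ mB')).
have -> : (fun w => (ln `|sigma * (g \o X i) w - sigma * (g \o X i') w|)%:E) =
    (fun w => (ln `|Z j (X i w) - Z j (X i' w) + s * e * (Z k (X i w) - Z k (X i' w))|)%:E).
  by apply/funext => w; rewrite /= !gE; congr (ln `|_|)%:E; ring.
move=> -> ->; split => //; congr (_ + _)%:E.
rewrite -/q -sg2 expr2 lnM ?posrE//; lra.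
Qed.
End sample.

(** * Concentration of Kendall's tau *)

Section blocks.
Context {disp : measure_display} {Omega : measurableType disp} {R : realType}.
Variables (P : probability Omega R) (n d : nat) (X : 'I_n -> {RV P >-> d.-tuple R}).
Hypothesis indX : mutually_independent X.
Local Notation T := (d.-tuple R).

Definition pair_indices (L : seq ('I_n * 'I_n)) := flatten [seq [:: p.1; p.2] | p <- L].

(** Constraints on pairs come with constraints [B] on single observations: the induction in
    [independent_blocks] turns a rectangle on a pair into two single constraints. *)
Definition block_event (L : seq ('I_n * 'I_n)) (C : 'I_n * 'I_n -> set (T * T))
    (B : 'I_n -> set T) : set Omega :=
  [set w | (forall p, p \in L -> C p (X p.1 w, X p.2 w)) /\ forall l, B l (X l w)].

Lemma measurable_RV i : measurable_fun setT (X i).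
Proof. exact: measurable_funPT. Qed.

Lemma measurable_pair (p : 'I_n * 'I_n) (C : set (T * T)) : measurable C ->
  measurable [set w | C (X p.1 w, X p.2 w)].
Proof.
move=> mC; have := measurable_fun_pair (measurable_RV p.1) (measurable_RV p.2).
by move=> /(_ measurableT _ mC); rewrite setTI.
Qed.

Lemma measurable_block L C B : (forall p, measurable (C p)) -> (forall l, measurable (B l)) ->
  measurable (block_event L C B).
Proof.
move=> mC mB.
have -> : block_event L C B = (\bigcap_(p in [set` L]) [set w | C p (X p.1 w, X p.2 w)]) `&`
    \bigcap_(l in setT) (X l @^-1` B l).
  by apply/seteqP; split => w [H1 H2]; split => // l; [move=> _; apply: H2|apply: H2].
apply: measurableI.
- by apply: fin_bigcap_measurable => // p _; exact: measurable_pair.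
- apply: fin_bigcap_measurable => // l _; rewrite -[_ @^-1` _]setTI.
  by have := measurable_RV l; move=> /(_ measurableT _ (mB l)).
Qed.

(** As functions of [C] both sides are finite measures, and they agree on rectangles; uniqueness of
    the product measure does the rest. *)
Lemma block_product (a b : 'I_n) (W : set Omega) (C : set (T * T)) : measurable W -> measurable C ->
  (forall E E', measurable E -> measurable E' ->
    P ((X a @^-1` E `&` X b @^-1` E') `&` W) =
    (P (X a @^-1` E) * P (X b @^-1` E') * P W)%E) ->
  P ([set w | C (X a w, X b w)] `&` W) =
  ((distribution P (X a) \x distribution P (X b)) C * P W)%E.
Proof.
move=> mW mC rect.
have PW0 : 0 <= fine (P W) by exact: fine_ge0.
have PWE : P W = (fine (P W))%:E by rewrite fineK// fin_num_measure.
pose c := NngNum PW0.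
pose phi w := (X a w, X b w).
have mphi : measurable_fun setT phi := measurable_fun_pair (measurable_RV a) (measurable_RV b).
pose m' := [the measure _ _ of pushforward (mrestr P mW) phi].
(* The factor [P W] is put on the first marginal, so that the restriction of [P] to [W] is compared
   with a genuine product measure. *)
pose m1 : {finite_measure set T -> \bar R} := mscale c (distribution P (X a)).
have := @product_measure_unique _ _ _ _ R m1 (distribution P (X b)) (m' mphi).
move=> U; rewrite -[LHS]/(m' mphi C) -(U _ _ mC).
  rewrite /product_measure1 /m1 ge0_integral_mscale//=; last 1 first.
    by apply: measurable_fun_xsection.
  by rewrite muleC [P W]PWE.
move=> E E' mE mE'; rewrite /m' /= /pushforward /mrestr.
rewrite -[_ `&` W]/((X a @^-1` E `&` X b @^-1` E') `&` W) rect//.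
rewrite -[RHS]/((fine (P W))%:E * P (X a @^-1` E) * P (X b @^-1` E'))%E -PWE.
by rewrite muleC muleA.
Qed.

(** [mutually_independent] speaks of single observations only. By [block_product] it is enough to
    treat rectangles for the head pair; these are absorbed by changing [B] at its two indices, free
    since no index repeats, and the induction hypothesis for the tail applies. *)
Lemma independent_blocks L C B : (forall p, measurable (C p)) -> (forall l, measurable (B l)) ->
  uniq (pair_indices L) -> (forall l, l \in pair_indices L -> B l = setT) ->
  P (block_event L C B) =
  ((\prod_(p <- L) P [set w | C p (X p.1 w, X p.2 w)]) * \prod_l P (X l @^-1` B l))%E.
Proof.
move=> mC; elim: L B => [|[a b] L IH] B mB.
  move=> _ _; rewrite big_nil mul1e -(indX mB); congr (P _).
  by apply/seteqP; split => w; [case|].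
rewrite /= inE negb_or => /and3P[/andP[ab aL] bL uL] BT.
have Ba : B a = setT by apply: BT; rewrite !inE eqxx.
have Bb : B b = setT by apply: BT; rewrite !inE eqxx orbT.
have BL l : l \in pair_indices L -> B l = setT.
  by move=> lL; apply: BT; rewrite !inE [X in _ || (_ || X)]lL !orbT.
have mW := measurable_block L mC mB.
have PW := IH _ mB uL BL.
have -> : block_event ((a, b) :: L) C B =
    [set w | C (a, b) (X a w, X b w)] `&` block_event L C B.
  apply/seteqP; split => w /=.
  - move=> [H1 H2]; split; first by apply: (H1 (a, b)); rewrite inE eqxx.
    by split=> // p pL; apply: H1; rewrite inE pL orbT.
  - move=> [H0 [H1 H2]]; split => // p; rewrite inE => /predU1P[->//|]; exact: H1.
have prodB : (\prod_l P (X l @^-1` B l) = \prod_(l | (l != a) && (l != b)) P (X l @^-1` B l))%E.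
  rewrite (bigD1 a)//= (bigD1 b)/=; last by rewrite eq_sym.
  by rewrite Ba Bb !preimage_setT probability_setT !mul1e.
rewrite (block_product mW (mC _)); last first.
  move=> E E' mE mE'.
  pose B' l := if l == a then E else if l == b then E' else B l.
  have mB' l : measurable (B' l) by rewrite /B'; case: ifP => // _; case: ifP => // _.
  have B'L l : l \in pair_indices L -> B' l = setT.
    move=> lL; rewrite /B'; case: eqP => [la|_]; first by rewrite -la lL in aL.
    by case: eqP => [lb|_]; [rewrite -lb lL in bL|exact: BL].
  have -> : X a @^-1` E `&` X b @^-1` E' `&` block_event L C B = block_event L C B'.
    apply/seteqP; split => w /=.
    - move=> [[Ea Eb] [H1 H2]]; split => // l; rewrite /B'.
      by case: eqP => [->//|_]; case: eqP => [->|_].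
    - move=> [H1 H2]; split; [split|split => //].
      + by have := H2 a; rewrite /B' eqxx.
      + by have := H2 b; rewrite /B' eqxx [b == a]eq_sym (negbTE ab).
      + move=> l; have := H2 l; rewrite /B'.
        by case: eqP => [->|_]; [rewrite Ba|case: eqP => [->|_]; [rewrite Bb|]].
  rewrite (IH _ mB' uL B'L) PW prodB.
  rewrite (bigD1 a)//= (bigD1 b)/=; last by rewrite eq_sym.
  rewrite /B' eqxx [b == a]eq_sym (negbTE ab) eqxx.
  rewrite (eq_bigr (fun l => P (X l @^-1` B l))); last first.
    by move=> l /andP[/negbTE -> /negbTE ->].
  by rewrite -[RHS]muleA [in RHS](muleCA (P (X b @^-1` E'))) [RHS]muleCA.
have := @block_product a b setT _ measurableT (mC (a, b)).
rewrite setIT probability_setT mule1 => <-; last first.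
  move=> E E' mE mE'; rewrite setIT mule1.
  exact: independent_pair.
by rewrite PW big_cons muleA.
Qed.

End blocks.

(** * Expectations of products over disjoint pairs *)

Section finite_valued.
Context {disp : measure_display} {Omega : measurableType disp} {R : realType}.
Variables (P : probability Omega R) (n d : nat) (X : 'I_n -> {RV P >-> d.-tuple R}).
Hypothesis indX : mutually_independent X.
Local Notation T := (d.-tuple R).
Variables (g : T * T -> R) (V : seq R).
Hypotheses (mg : measurable_fun setT g) (uV : uniq V) (gV : forall z, g z \in V).

Definition pair_value (p : 'I_n * 'I_n) (w : Omega) : R := g (X p.1 w, X p.2 w).

(** The mean of [h (pair_value p)] as a finite sum over values, the form in which [mgf_le] takes
    it. *)
Definition value_mean (h : R -> R) p : R :=
  \sum_(c <- V) h c * fine (P [set w | pair_value p w = c]).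

Lemma pair_indices_cat (L K : seq ('I_n * 'I_n)) :
  pair_indices (L ++ K) = pair_indices L ++ pair_indices K.
Proof. by rewrite /pair_indices map_cat flatten_cat. Qed.

Lemma mem_pair_indices (p : 'I_n * 'I_n) K : p \in K -> p.1 \in pair_indices K.
Proof. by move=> pK; apply/flattenP; exists [:: p.1; p.2]; [exact: map_f|rewrite inE eqxx]. Qed.

Lemma measurable_pair_value p : measurable_fun setT (pair_value p).
Proof.
exact: (measurableT_comp mg (measurable_fun_pair (measurable_RV X p.1) (measurable_RV X p.2))).
Qed.

Lemma measurable_level c : measurable (g @^-1` [set c]).
Proof. by rewrite -[_ @^-1` _]setTI; exact: mg. Qed.

Lemma measurable_level_fun (h : R -> R) p : measurable_fun setT (fun w => h (pair_value p w)).
Proof.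
have -> : (fun w => h (pair_value p w)) =
    (fun w => \sum_(c <- V) h c * \1_[set w | pair_value p w = c] w).
  apply/funext => w; rewrite (big_rem (pair_value p w))/=; last exact: gV.
  rewrite big_seq big1 ?addr0; first by rewrite indicE mem_set// mulr1.
  move=> c; rewrite mem_rem_uniq// inE => /andP[/eqP cw _].
  by rewrite indicE memNset ?mulr0// => E; apply: cw.
apply: measurable_sum => c; apply: measurable_funM; first exact: measurable_cst.
by apply: measurable_indic; exact: (measurable_pair X p (measurable_level c)).
Qed.

Local Notation block K C := (block_event X K C (fun _ => setT)).

(** Splitting by the value [c] of the head pair replaces its factor by the constant [h c] and moves
    the pair into the event as a level-set constraint. Products of functions thus reduce to
    independence of events, and the indicator is what the induction has to carry. *)
Lemma integral_block_product (h : R -> R) (L K : seq ('I_n * 'I_n)) (C : 'I_n * 'I_n -> set (T * T)) :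
  (forall c, 0 <= h c) -> (forall p, measurable (C p)) -> uniq (pair_indices (L ++ K)) ->
  (\int[P]_w ((\prod_(p <- L) h (pair_value p w)) * \1_(block K C) w)%:E =
   ((\prod_(p <- L) value_mean h p) * fine (P (block K C)))%:E)%E.
Proof.
move=> h0; elim: L K C => [|p L IH] K C mC uLK.
  have mB : measurable (block K C) by exact: measurable_block.
  under eq_integral do rewrite big_nil mul1r.
  by rewrite integral_indic// setIT big_nil mul1r fineK// fin_num_measure.
pose Cc c q := if q == p then g @^-1` [set c] else C q.
have mCc c q : measurable (Cc c q) by rewrite /Cc; case: ifP => // _; exact: measurable_level.
have pK : p \notin K.
  apply/negP => pK; move: uLK; rewrite /= inE negb_or -andbA => /and3P[_ /negP p1 _]; apply: p1.
  by apply: (@mem_pair_indices p (L ++ K)); rewrite mem_cat pK orbT.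
have uLpK : uniq (pair_indices (L ++ p :: K)).
  move: uLK; rewrite -[(p :: L) ++ K]/([:: p] ++ (L ++ K)) -[p :: K]/([:: p] ++ K).
  by rewrite !pair_indices_cat uniq_catCA.
have uK : uniq (pair_indices (p :: K)).
  by move: uLpK; rewrite pair_indices_cat cat_uniq => /and3P[].
have CcK c q : q \in K -> Cc c q = C q.
  by move=> qK; rewrite /Cc; case: eqP => // qp; rewrite -qp qK in pK.
have blockE c w : \1_(block (p :: K) (Cc c)) w = (pair_value p w == c)%:R * \1_(block K C) w :> R.
  rewrite !indicE -natrM mulnb; congr (_%:R); congr nat_of_bool.
  apply/idP/andP => [/set_mem[H _]|[/eqP H /set_mem[H1 _]]].
  - split; first by have := H p; rewrite inE eqxx /Cc eqxx => /(_ isT) /eqP.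
    apply/mem_set; split => // q qK; rewrite -(CcK c q qK); apply: H.
    by rewrite inE qK orbT.
  - apply/mem_set; split => // q; rewrite inE => /predU1P[->|qK]; first by rewrite /Cc eqxx.
    by rewrite CcK//; exact: H1.
have E w : (\prod_(q <- p :: L) h (pair_value q w)) * \1_(block K C) w =
    \sum_(c <- V) h c * ((\prod_(q <- L) h (pair_value q w)) * \1_(block (p :: K) (Cc c)) w).
  rewrite (big_rem (pair_value p w))/=; last exact: gV.
  rewrite [X in _ = _ + X](_ : _ = 0); first by rewrite addr0 blockE eqxx mul1r big_cons mulrA.
  rewrite big_seq big1// => c; rewrite mem_rem_uniq// inE => /andP[/negbTE cw _].
  by rewrite blockE eq_sym cw mul0r !mulr0.
have mprod : measurable_fun setT (fun w => \prod_(q <- L) h (pair_value q w)).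
  by apply: measurable_prod => q _; exact: measurable_level_fun.
have mterm c : measurable_fun setT (fun w => (\prod_(q <- L) h (pair_value q w)) *
    \1_(block (p :: K) (Cc c)) w).
  apply: measurable_funM => //.
  by apply: measurable_indic; exact: measurable_block.
have term0 c w : 0 <= (\prod_(q <- L) h (pair_value q w)) * \1_(block (p :: K) (Cc c)) w.
  by rewrite mulr_ge0// prodr_ge0.
under eq_integral do rewrite E -sumEFin.
rewrite ge0_integral_sum//; last 2 first.
- move=> c; apply/measurable_EFinP; apply: measurable_funM; first exact: measurable_cst.
  exact: mterm.
- by move=> c w _; rewrite lee_fin mulr_ge0.
have PBe c : P (block (p :: K) (Cc c)) = (P [set w | pair_value p w = c] * P (block K C))%E.
  rewrite (independent_blocks indX (mCc c) (fun _ => measurableT) uK)//.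
  rewrite (independent_blocks indX mC (fun _ => measurableT) (L := K))//; last first.
    by move: uK => /= /andP[_ /andP[]].
  rewrite (_ : \prod_l _ = 1)%E ?mule1; last first.
    by rewrite big1// => l _; rewrite preimage_setT probability_setT.
  rewrite big_cons {1}/Cc eqxx; congr (_ * _)%E.
  by rewrite !big_seq; apply: eq_bigr => q qK; rewrite CcK.
have PB c : fine (P (block (p :: K) (Cc c))) =
    fine (P [set w | pair_value p w = c]) * fine (P (block K C)).
  rewrite PBe fineM// fin_num_measure//.
  - exact: (measurable_pair X p (measurable_level c)).
  - exact: measurable_block.
transitivity (\sum_(c <- V) (h c * ((\prod_(q <- L) value_mean h q) *
   (fine (P [set w | pair_value p w = c]) * fine (P (block K C)))))%:E)%E.
  apply: eq_bigr => c _.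
  under eq_integral do rewrite EFinM.
  rewrite ge0_integralZl//; first by rewrite IH// PB EFinM.
    by apply/measurable_EFinP; exact: mterm.
    by move=> w _; rewrite lee_fin.
  by rewrite lee_fin.
rewrite sumEFin; congr (_%:E).
rewrite big_cons /value_mean mulr_suml mulr_suml; apply: eq_bigr => c _.
ring.
Qed.

Lemma integral_prod_values (h : R -> R) L : (forall c, 0 <= h c) -> uniq (pair_indices L) ->
  (\int[P]_w (\prod_(p <- L) h (pair_value p w))%:E = (\prod_(p <- L) value_mean h p)%:E)%E.
Proof.
move=> h0 uL.
have := @integral_block_product h L [::] (fun _ => setT) h0 (fun _ => measurableT).
rewrite cats0 => /(_ uL).
have -> : block [::] (fun _ => setT) = setT by apply/seteqP; split.
rewrite probability_setT mulr1 => <-.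
by apply: eq_integral => w _; rewrite indicT mulr1.
Qed.

Lemma integral_value (h : R -> R) p : (forall c, 0 <= h c) -> p.1 != p.2 ->
  (\int[P]_w (h (pair_value p w))%:E = (value_mean h p)%:E)%E.
Proof.
move=> h0 pp; have := @integral_prod_values h [:: p] h0; rewrite /= inE pp big_seq1 => /(_ isT) <-.
by apply: eq_integral => w _; rewrite big_seq1.
Qed.

Lemma value_mean1 p : p.1 != p.2 -> value_mean (fun=> 1) p = 1.
Proof.
move=> pp; have := @integral_value (fun=> 1) p (fun _ => ler01) pp.
by rewrite integral_cst_probability => -[].
Qed.

End finite_valued.

(** * Exponential moments of bounded variables *)

Section mgf.
Context {R : realType}.

(** For [y > 1/2] already [y <= 2 y^2]. Otherwise [e^y <= 1 / (1 - y) <= 1 + y + 2 y^2], the second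
    inequality being [y^2 (1 - 2 y) >= 0]. *)
Lemma expR_le_sqr (y : R) : expR y <= y + expR (2 * y ^+ 2).
Proof.
have q := expR_ge1Dx (2 * y ^+ 2).
have [y2|y2] := leP y 2^-1; last first.
  have : expR y <= expR (2 * y ^+ 2) by rewrite ler_expR; nra.
  lra.
apply: le_trans (_ : 1 + y + 2 * y ^+ 2 <= _); last by lra.
have e0 := expR_gt0 y; have := expR_ge1Dx (- y); rewrite expRN -(ler_pM2r e0) mulVf ?gt_eqF// => h.
have y1 : 0 < 1 - y by lra.
rewrite -(ler_pM2l y1) (le_trans h)//.
have -> : (1 - y) * (1 + y + 2 * y ^+ 2) = 1 + y ^+ 2 * (1 - 2 * y) by ring.
have : 0 <= y ^+ 2 * (1 - 2 * y) by rewrite mulr_ge0 ?sqr_ge0//; lra.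
lra.
Qed.

(** After [expR_le_sqr] the linear term has mean zero, and [|c - tau| <= 2] turns [2 y^2] into
    [8 theta^2]. *)
Lemma mgf_le (V : seq R) (q : R -> R) (tau theta : R) :
  (forall c, c \in V -> `|c| <= 1) -> `|tau| <= 1 -> (forall c, 0 <= q c) ->
  \sum_(c <- V) q c = 1 -> \sum_(c <- V) c * q c = tau ->
  \sum_(c <- V) expR (theta * (c - tau)) * q c <= expR (8 * theta ^+ 2).
Proof.
move=> V1 t1 q0 q1 qt.
apply: (@le_trans _ _ (\sum_(c <- V) (theta * (c - tau) + expR (8 * theta ^+ 2)) * q c)).
  rewrite big_seq [leRHS]big_seq; apply: ler_sum => c cV; rewrite ler_wpM2r//.
  apply: le_trans (expR_le_sqr _) _; rewrite lerD2l ler_expR.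
  have c2 : (c - tau) ^+ 2 <= 4.
    by move: (V1 _ cV) t1; rewrite !ler_norml => /andP[? ?] /andP[? ?]; nra.
  have := sqr_ge0 theta; rewrite exprMn; nra.
have -> : \sum_(c <- V) (theta * (c - tau) + expR (8 * theta ^+ 2)) * q c =
    theta * (\sum_(c <- V) c * q c - tau * \sum_(c <- V) q c) +
    expR (8 * theta ^+ 2) * \sum_(c <- V) q c.
  rewrite !mulr_sumr -sumrB mulr_sumr -big_split; apply: eq_bigr => c _ /=; ring.
by rewrite q1 qt !mulr1 subrr mulr0 add0r.
Qed.

End mgf.

(** * Decomposition of pairs into matchings *)

Section matchings.
Variable m : nat.
Local Notation I := 'I_m.+1.

(* The fibres of (i, j) |-> i + j in Z/n split the pairs i < j into n matchings. *)
Definition matching (r : I) : seq (I * I) := [seq (i, r - i) | i : I <- enum 'I_m.+1 & (i < (r - i)%R)%N].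

Lemma mem_pair_indices_refl (r : I) (s : seq I) x :
  x \in pair_indices [seq (i, r - i) | i <- s] -> x \in s \/ r - x \in s.
Proof.
elim: s => //= i s IH; rewrite !inE => /or3P[/eqP->|/eqP->|/IH[]->].
- by left; rewrite eqxx.
- by right; rewrite subKr eqxx.
- by left; rewrite orbT.
- by right; rewrite orbT.
Qed.

(** The map [i |-> r - i] is an involution, and the filter keeps the smaller element of each orbit
    of size two. *)
Lemma uniq_matching r : uniq (pair_indices (matching r)).
Proof.
rewrite /matching; have : uniq [seq i : I <- enum 'I_m.+1 | (i < (r - i)%R)%N].
  by rewrite filter_uniq// enum_uniq.
have : forall i : I, i \in [seq i : I <- enum 'I_m.+1 | (i < (r - i)%R)%N] -> (i < (r - i)%R)%N.
  by move=> i; rewrite mem_filter => /andP[].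
elim: [seq _ : I <- _ | _] => // i s IH lt_s; rewrite cons_uniq => /andP[iS us].
have ir : (i < (r - i)%R)%N by apply: lt_s; rewrite inE eqxx.
have ss k : k \in s -> (k < (r - k)%R)%N by move=> ks; apply: lt_s; rewrite inE ks orbT.
have nr : r - i \notin s.
  by apply/negP => /ss; rewrite subKr => /(ltn_trans ir); rewrite ltnn.
rewrite map_cons -[pair_indices _]/(i :: (r - i) :: pair_indices [seq (i, r - i) | i <- s]).
rewrite !cons_uniq (IH ss us) andbT inE negb_or -andbA; apply/and3P; split.
- by apply/eqP => e; move: ir; rewrite -e ltnn.
- by apply/negP => /mem_pair_indices_refl[]; apply/negP.
- by apply/negP => /mem_pair_indices_refl[]; rewrite ?subKr; apply/negP.
Qed.

Lemma matching_lt r p : p \in matching r -> (p.1 < p.2)%N.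
Proof. by move=> /mapP[i]; rewrite mem_filter => /andP[ir _] ->. Qed.

Lemma size_matching r : (size (matching r) <= m.+1)%N.
Proof.
by rewrite size_map size_filter (leq_trans (count_size _ _))// -cardE card_ord.
Qed.

Lemma sum_matchings (V : nmodType) (G : I -> I -> V) :
  \sum_(i : I) \sum_(i' : I | (i < i')%N) G i i' = \sum_r \sum_(p <- matching r) G p.1 p.2.
Proof.
transitivity (\sum_(i : I) \sum_(r | (i < (r - i)%R)%N) G i (r - i)).
  apply: eq_bigr => i _; rewrite (reindex_onto (fun r => r - i) (fun i' => i' + i))/=.
    by apply: eq_bigl => r; rewrite subrK eqxx andbT.
  by move=> r _; rewrite addrK.
rewrite (exchange_big_dep xpredT)//=; apply: eq_bigr => r _.
by rewrite big_map big_filter big_enum_cond.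
Qed.

End matchings.

Lemma count_increasing_pairs (n : nat) :
  ((\sum_(i < n) \sum_(i' < n | (i < i')%N) 1).*2 = n * n.-1)%N.
Proof.
rewrite (exchange_big_dep xpredT)//=.
rewrite (eq_bigr (fun i : 'I_n => i : nat)) => [|i _]; last first.
  by rewrite -(big_ord_widen n (fun=> 1%N) (ltnW (ltn_ord i))) sum1_card card_ord.
elim: n => [|[|n] IH]; first by rewrite big_ord0.
- by rewrite big_ord1.
- by rewrite big_ord_recr/= doubleD IH -muln2 -mulnDr addn2 mulnC.
Qed.

Section jensen.
Context {R : realType}.

(** Each [expR (y r)] lies above the tangent at the mean [a], and the linear terms cancel in the
    sum. *)
Lemma expR_jensen (m : nat) (y : 'I_m.+1 -> R) :
  expR (m.+1%:R^-1 * \sum_r y r) <= m.+1%:R^-1 * \sum_r expR (y r).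
Proof.
set a := _^-1 * _; have n0 : 0 < m.+1%:R :> R by rewrite ltr0n.
rewrite -(ler_pM2l n0) mulrA divff ?gt_eqF// mul1r.
apply: le_trans (_ : \sum_r expR a * (1 + (y r - a)) <= _); last first.
  apply: ler_sum => r _; rewrite -[in leRHS](subrKC a (y r)) expRD ler_pM2l ?expR_gt0//.
  exact: expR_ge1Dx.
rewrite -mulr_sumr big_split/= sumrB !sumr_const card_ord -[_ *+ _]mulr_natr.
rewrite mulrC ler_wpM2l ?expR_ge0//.
have : a * m.+1%:R = \sum_r y r by rewrite /a mulrAC mulVf ?mul1r// gt_eqF.
rewrite -[a *+ _]mulr_natr; lra.
Qed.

End jensen.

(** * Exponential moments, tails and variance of the sample tau *)

Section kendall_mgf.
Context {disp : measure_display} {Omega : measurableType disp} {R : realType}.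
Variables (P : probability Omega R) (m d : nat) (X : 'I_m.+2 -> {RV P >-> d.-tuple R}).
Hypothesis indX : mutually_independent X.
Local Notation T := (d.-tuple R).
Variables (j k : 'I_d) (tau : R).

Definition concordance (z : T * T) : R :=
  Num.sg ((tnth z.1 j - tnth z.2 j) * (tnth z.1 k - tnth z.2 k)).

Hypothesis tauE : forall i i', i != i' ->
  (\int[P]_w (concordance (X i w, X i' w))%:E = tau%:E)%E.
Hypothesis tau1 : `|tau| <= 1.

Let V : seq R := [:: -1; 0; 1].

Let uV : uniq V.
Proof.
have h1 : ((-1 : R) == 0) = false by apply/eqP; lra.
have h2 : ((-1 : R) == 1) = false by apply/eqP; lra.
have h3 : ((0 : R) == 1) = false by apply/eqP; lra.
by rewrite /V /= !inE h1 h2 h3.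
Qed.

Let gV z : concordance z \in V.
Proof. by rewrite /concordance; case: sgrP => _; rewrite !inE eqxx ?orbT. Qed.

Lemma measurable_concordance : measurable_fun setT concordance.
Proof.
apply: (measurableT_comp (@measurable_sg R)); apply: measurable_funM; apply: measurable_funB.
- exact: (measurableT_comp (measurable_tnth j) measurable_fst).
- exact: (measurableT_comp (measurable_tnth j) measurable_snd).
- exact: (measurableT_comp (measurable_tnth k) measurable_fst).
- exact: (measurableT_comp (measurable_tnth k) measurable_snd).
Qed.

Local Notation pv := (pair_value X concordance).
Local Notation vmean := (value_mean X concordance V).
Let mg := measurable_concordance.

(** [integral_value] takes nonnegative functions, so it is applied to [|c + 1|], which is [c + 1] on
    the values [-1], [0], [1]; the total mass is then subtracted. *)
Lemma concordance_mean p : p.1 != p.2 ->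
  \sum_(c <- V) c * fine (P [set w | pv p w = c]) = tau.
Proof.
move=> pp.
have v1 := value_mean1 indX mg uV gV pp.
have := integral_value indX mg uV gV (h := fun c => `|c + 1|) (fun _ => normr_ge0 _) pp.
have -> : (\int[P]_w `|pv p w + 1|%:E = (1 + tau)%:E)%E.
  have mpv : measurable_fun setT (pv p) := measurable_pair_value X mg p.
  have ig : P.-integrable setT (fun w => (pv p w)%:E).
    apply: (le_integrable measurableT (g := cst 1%:E)).
    - by apply/measurable_EFinP; exact: mpv.
    - move=> w _; rewrite /= lee_fin normr1; have := gV (X p.1 w, X p.2 w).
      by rewrite !inE -/(pv p w) => /or3P[]/eqP->; rewrite ?normrN ?normr0 ?normr1.
    - exact: finite_measure_integrable_cst.
  transitivity (\int[P]_w (cst 1%:E w + (pv p w)%:E))%E.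
    apply: eq_integral => w _; rewrite /cst -EFinD; congr EFin.
    rewrite addrC ger0_norm//; have := gV (X p.1 w, X p.2 w).
    rewrite !inE -/(pv p w) => /or3P[]/eqP->; lra.
  rewrite integralD//; last exact: finite_measure_integrable_cst.
  by rewrite integral_cst_probability tauE.
move=> [E]; move: v1; rewrite /value_mean in E *.
move: E; rewrite /V !big_cons !big_nil !addr0 addNr normr0 add0r normr1.
rewrite (_ : `|1 + 1 : R| = 2); last by rewrite ger0_norm//; lra.
lra.
Qed.

Lemma concordance_mgf theta p : p.1 != p.2 ->
  vmean (fun c => expR (theta * (c - tau))) p <= expR (8 * theta ^+ 2).
Proof.
move=> pp; apply: mgf_le => //.
- by move=> c; rewrite !inE => /or3P[]/eqP->; rewrite ?normrN ?normr0 ?normr1.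
- by move=> c; exact: fine_ge0.
- have := value_mean1 indX mg uV gV pp; rewrite /value_mean => E; rewrite -[RHS]E.
  by apply: eq_bigr => c _; rewrite mul1r.
- exact: concordance_mean.
Qed.

Local Notation n := (m.+2%:R : R).
Local Notation kt w := (kendall_tau (fun i => X i w) j k).

Lemma kendall_tau_matching w :
  kt w - tau = n^-1 * \sum_r (2 / (n - 1) * \sum_(p <- matching r) (pv p w - tau)).
Proof.
rewrite -mulr_sumr -(sum_matchings (fun i i' => pv (i, i') w - tau)).
under eq_bigr do rewrite sumrB.
rewrite sumrB.
have nE : n - 1 = m.+1%:R by rewrite -[m.+2%:R]natr1 addrK.
have c : \sum_(i < m.+2) \sum_(i' < m.+2 | (i < i')%N) tau = n * (n - 1) / 2 * tau.
  have := congr1 (fun x : nat => x%:R : R) (count_increasing_pairs m.+2).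
  rewrite -muln2 !natrM -[(m.+2).-1]/(m.+1) nE => <-.
  rewrite mulfK ?pnatr_eq0// natr_sum mulr_suml; apply: eq_bigr => i _.
  by rewrite natr_sum mulr_suml; apply: eq_bigr => i' _; rewrite mul1r.
have n1 : n - 1 != 0 by rewrite nE pnatr_eq0.
have n0 : m.+2%:R != 0 :> R by rewrite pnatr_eq0.
rewrite c /kendall_tau; move: n0 n1; rewrite /pair_value /concordance /=.
move: (m.+2%:R : R) => N n0 n1; field.
by rewrite n1 n0.
Qed.

Lemma measurable_kendall : measurable_fun setT (fun w => kt w - tau).
Proof.
under eq_fun do rewrite kendall_tau_matching.
apply: measurable_funM; first exact: measurable_cst.
apply: measurable_sum => r; apply: measurable_funM; first exact: measurable_cst.
apply: measurable_sum => p; apply: measurable_funB; last exact: measurable_cst.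
exact: (measurable_pair_value X mg p).
Qed.

(** Jensen over the [n] matchings leaves products over disjoint pairs with parameter
    [theta' = 2 theta / (n - 1)]. Each has at most [n] factors, giving the exponent
    [8 theta'^2 n = 32 theta^2 n / (n - 1)^2], and [n <= 2 (n - 1)] yields [128 theta^2 / n]. *)
Lemma kendall_mgf theta :
  (\int[P]_w (expR (theta * (kt w - tau)))%:E <= (expR (128 * theta ^+ 2 / n))%:E)%E.
Proof.
pose theta' := 2 * theta / (n - 1).
have mpv p : measurable_fun setT (fun w => expR (theta' * (pv p w - tau))).
  exact: (measurable_level_fun X mg uV gV (fun c => expR (theta' * (c - tau)))).
have mprod r : measurable_fun setT (fun w => \prod_(p <- matching r) expR (theta' * (pv p w - tau))).
  by apply: measurable_prod.
apply: (@le_trans _ _ (\int[P]_w (n^-1 *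
    \sum_r \prod_(p <- matching r) expR (theta' * (pv p w - tau)))%:E)%E).
  apply: ge0_le_integral => //.
  - apply/measurable_EFinP; apply: measurableT_comp => //.
    by apply: measurable_funM; [exact: measurable_cst|exact: measurable_kendall].
  - apply/measurable_EFinP; apply: measurable_funM; first exact: measurable_cst.
    by apply: measurable_sum.
  - move=> w _; rewrite lee_fin kendall_tau_matching mulrCA mulr_sumr.
    apply: le_trans (expR_jensen _) _; rewrite ler_pM2l ?invr_gt0//.
    apply: ler_sum => r _; rewrite le_eqVlt; apply/orP; left; apply/eqP.
    rewrite -expR_sum; congr expR; rewrite !mulr_sumr; apply: eq_bigr => p _.
    rewrite /theta'; ring.
under eq_integral do rewrite EFinM.
rewrite ge0_integralZl//; last 2 first.
- by apply/measurable_EFinP; apply: measurable_sum.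
- by move=> w _; rewrite lee_fin sumr_ge0// => r _; rewrite prodr_ge0// => p _; exact: expR_ge0.
under eq_integral do rewrite -sumEFin.
rewrite ge0_integral_sum//; last 2 first.
- by move=> r; apply/measurable_EFinP; exact: mprod.
- by move=> r w _; rewrite lee_fin prodr_ge0// => p _; exact: expR_ge0.
rewrite (eq_bigr (fun r => (\prod_(p <- matching r) vmean (fun c => expR (theta' * (c - tau))) p)%:E)); last first.
  move=> r _; apply: (integral_prod_values indX mg uV gV (h := fun c => expR (theta' * (c - tau)))).
    by move=> c; exact: expR_ge0.
  exact: uniq_matching.
rewrite sumEFin -EFinM lee_fin.
have n0 : 0 < n by rewrite ltr0n.
rewrite ler_pdivrMl//.
apply: (@le_trans _ _ (\sum_(r < m.+2) expR (128 * theta ^+ 2 / n))); last first.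
  by rewrite sumr_const card_ord -[leLHS]mulr_natl.
apply: ler_sum => r _.
apply: (@le_trans _ _ (\prod_(p <- matching r) expR (8 * theta' ^+ 2))).
  rewrite big_seq [leRHS]big_seq; apply: ler_prod => p pm.
  rewrite sumr_ge0/=; last by move=> c _; rewrite mulr_ge0 ?expR_ge0 ?fine_ge0.
  by apply: concordance_mgf; have := matching_lt pm; rewrite ltn_neqAle => /andP[].
rewrite big_const_seq count_predT iter_mulr_1 -expRM_natl ler_expR.
have n2 : 2 <= n by rewrite ler_nat.
have sz : (size (matching r))%:R <= n by rewrite ler_nat; exact: size_matching.
move: n0 n2 sz; rewrite /theta'; move: (size _)%:R (m.+2%:R : R) => a N N0 N2 aN.
have N1 : 0 < (N - 1) ^+ 2 by rewrite exprn_gt0//; lra.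
rewrite (_ : a * _ = 32 * theta ^+ 2 * a / (N - 1) ^+ 2); last by field; lra.
rewrite ler_pdivrMr// [leRHS]mulrAC ler_pdivlMr//.
have t0 := sqr_ge0 theta.
rewrite (_ : _ * N = theta ^+ 2 * (32 * a * N)); last by ring.
rewrite (_ : 128 * _ * _ = theta ^+ 2 * (128 * (N - 1) ^+ 2)); last by ring.
by rewrite ler_wpM2l//; nra.
Qed.

Lemma kendall_upper_tail (s x : R) : (s = 1 \/ s = -1) -> 0 < x ->
  (P [set w | (x <= s * (kt w - tau))%R] <= (expR (- (n * x ^+ 2 / 512)))%:E)%E.
Proof.
move=> s1 x0; set A := [set w | _].
have n0 : 0 < n by rewrite ltr0n.
have mA : measurable A.
  rewrite -[A]setTI; apply: (measurable_fun_le measurableT); first exact: measurable_cst.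
  by apply: measurable_funM; [exact: measurable_cst|exact: measurable_kendall].
(* The minimizer of [128 t^2 / n - t x], with minimum [- n x^2 / 512]. *)
pose t := n * x / 256.
have t0 : 0 < t by apply: divr_gt0; [exact: mulr_gt0|exact: ltr0n].
have h : ((expR (t * x))%:E * P A <= (expR (128 * t ^+ 2 / n))%:E)%E.
  have -> : t ^+ 2 = (t * s) ^+ 2 by case: s1 => ->; ring.
  apply: le_trans (kendall_mgf (t * s)).
  have mE : measurable_fun setT (fun w => (expR (t * s * (kt w - tau)))%:E).
    apply/measurable_EFinP; apply: measurableT_comp => //.
    by apply: measurable_funM; [exact: measurable_cst|exact: measurable_kendall].
  rewrite -integral_cst//.
  apply: (@le_trans _ _ (\int[P]_(w in A) (expR (t * s * (kt w - tau)))%:E)%E).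
    apply: ge0_le_integral => //.
    - by move=> w _; rewrite lee_fin expR_ge0.
    - exact: measurable_funTS.
    - by move=> w Aw; rewrite lee_fin ler_expR -mulrA ler_pM2l.
  by apply: ge0_subset_integral => // w _; rewrite lee_fin expR_ge0.
rewrite -(@lee_pmul2l _ (expR (t * x))%:E)//; last by rewrite lte_fin expR_gt0.
apply: le_trans h _; rewrite -EFinM -expRD lee_fin ler_expR.
rewrite le_eqVlt; apply/orP; left; apply/eqP; rewrite /t; field.
by rewrite gt_eqF.
Qed.

Lemma kendall_tail x : 0 < x ->
  (P [set w | (x <= `|kt w - tau|)%R] <= (2 * expR (- (n * x ^+ 2 / 512)))%:E)%E.
Proof.
move=> x0.
have mA s : measurable [set w | x <= s * (kt w - tau)].
  rewrite -[X in measurable X]setTI; apply: (measurable_fun_le measurableT); first exact: measurable_cst.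
  by apply: measurable_funM; [exact: measurable_cst|exact: measurable_kendall].
have -> : [set w | x <= `|kt w - tau|] =
    [set w | x <= 1 * (kt w - tau)] `|` [set w | x <= (-1) * (kt w - tau)].
  by apply/seteqP; split => w /=; rewrite mul1r mulN1r ler_normr => /orP.
apply: le_trans (measureU2 _ _ _) _ => //.
rewrite mulr2n mulrDl mul1r EFinD leeD//; apply: kendall_upper_tail => //; by [left|right].
Qed.

(** At [theta] equal to plus or minus [sqrt n] the exponential moment is at most [expR 128], and a
    square is at most [4] times the sum of the two exponentials. *)
Lemma kendall_second_moment :
  (\int[P]_w ((kt w - tau) ^+ 2)%:E <= (8 * expR 128 / n)%:E)%E.
Proof.
have n0 : 0 < n by rewrite ltr0n.
pose t := Num.sqrt n.
have t2 : t ^+ 2 = n by rewrite sqr_sqrtr// ltW.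
have mk := measurable_kendall.
have me (s : R) : measurable_fun setT (fun w => (expR (s * (kt w - tau)))%:E).
  apply/measurable_EFinP; apply: measurableT_comp => //.
  by apply: measurable_funM; first exact: measurable_cst.
apply: (@le_trans _ _ (\int[P]_w ((4 / n)%:E * ((expR (t * (kt w - tau)))%:E + (expR (- t * (kt w - tau)))%:E)))%E).
  apply: ge0_le_integral.
  - exact: measurableT.
  - by move=> w _; rewrite lee_fin sqr_ge0.
  - apply/measurable_EFinP; exact: measurable_funX.
  - by apply: emeasurable_funM; [exact: measurable_cst|exact: emeasurable_funD].
  move=> w _; rewrite -EFinD -EFinM lee_fin mulrAC ler_pdivlMr// -t2 -exprMn mulNr [_ * t]mulrC.
  move: (t * _) => y.
  (* From [e^z = (e^(z/2))^2 >= (1 + z/2)^2 >= z^2 / 4]. *)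
  have sq (z : R) : 0 <= z -> z ^+ 2 <= 4 * expR z.
    move=> z0; have := expR_ge1Dx (z / 2) => h.
    have -> : expR z = expR (z / 2) ^+ 2 by rewrite -expRM_natl; congr expR; field.
    by nra.
  have [y0|y0] := leP 0 y.
    by have := sq _ y0; have := expR_gt0 (- y); lra.
  have yN : 0 <= - y by lra.
  by have := sq _ yN; rewrite sqrrN; have := expR_gt0 y; lra.
rewrite ge0_integralZl//; last 2 first.
- exact: emeasurable_funD.
- by move=> w _; rewrite -EFinD lee_fin addr_ge0 ?expR_ge0.
rewrite ge0_integralD//.
have e (s : R) : s ^+ 2 = n -> (\int[P]_w (expR (s * (kt w - tau)))%:E <= (expR 128)%:E)%E.
  move=> s2; apply: le_trans (kendall_mgf s) _; rewrite s2 mulfK// gt_eqF//.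
apply: (@le_trans _ _ ((4 / n)%:E * ((expR 128)%:E + (expR 128)%:E))%E).
  rewrite lee_pmul2l ?lte_fin ?divr_gt0// leeD// e// sqrrN//.
rewrite -EFinD -EFinM lee_fin le_eqVlt; apply/orP; left; apply/eqP; ring.
Qed.

End kendall_mgf.

(** * Measurability through finitely many signs, union bound *)

Section finite_events.
Context {disp : measure_display} {Omega : measurableType disp} {R : realType}.
Variable P : probability Omega R.

Lemma measurable_finite_pattern (A : finType) (c : Omega -> A) :
  (forall a, measurable (c @^-1` [set a])) -> forall Q : set A, measurable (c @^-1` Q).
Proof.
move=> mc Q; have -> : c @^-1` Q = \bigcup_(a in Q) (c @^-1` [set a]).
  by apply/seteqP; split => w /=; [exists (c w)|move=> [a Qa /= ->]].
by apply: fin_bigcup_measurable => //; exact: finite_finset.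
Qed.

Lemma measurable_finite_family (I A : finType) (c : I -> Omega -> A) :
  (forall i a, measurable (c i @^-1` [set a])) ->
  forall Q : set {ffun I -> A}, measurable [set w | Q [ffun i => c i w]].
Proof.
move=> mc Q; apply: (measurable_finite_pattern (c := fun w => [ffun i => c i w])) => a.
have -> : (fun w => [ffun i => c i w]) @^-1` [set a] = \bigcap_(i in setT) (c i @^-1` [set a i]).
  apply/seteqP; split => w /=; first by move=> <- i _; rewrite ffunE.
  by move=> H; apply/ffunP => i; rewrite ffunE; exact: H.
by apply: fin_bigcap_measurable => //; exact: finite_finset.
Qed.

Lemma probability_union_le (I : finType) (A : I -> set Omega) : (forall i, measurable (A i)) ->
  (P [set w | exists i, A i w] <= \sum_i P (A i))%E.
Proof.
move=> mA.
have -> : [set w | exists i, A i w] = \big[setU/set0]_(i <- index_enum I) A i.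
  rewrite -bigcup_seq; apply/seteqP; split => w /=; last by move=> [i _ Ai]; exists i.
  by move=> [i Ai]; exists i => //=; exact: mem_index_enum.
elim: (index_enum I) => [|i s IH]; first by rewrite !big_nil measure0.
rewrite !big_cons; apply: le_trans (measureU2 _ _ _) _ => //.
  by apply: bigsetU_measurable.
by rewrite leeD2l.
Qed.

Lemma probability_ge (E : set Omega) (e : R) : measurable E ->
  (P (~` E) <= e%:E)%E -> ((1 - e)%:E <= P E)%E.
Proof.
move=> mE; rewrite probability_setC//.
have : P E \is a fin_num by exact: fin_num_measure.
by case: (P E) => // r _; rewrite -EFinB !lee_fin; lra.
Qed.

End finite_events.

Lemma sin_lipschitz {R : realType} (x y : R) : `|sin x - sin y| <= `|x - y|.
Proof.
wlog yx : x y / y <= x => [H|].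
  by have [/H//|/ltW/H] := leP y x; rewrite distrC [`|y - x|]distrC.
have [c _ ->] := @MVT_segment R sin cos y x yx (fun z _ => is_derive_sin z)
  (continuous_subspaceT (@continuous_sin R)).
by rewrite normrM ler_piMl//; have := cos_max c.
Qed.

Section kendall_events.
Context {disp : measure_display} {Omega : measurableType disp} {R : realType}.
Variables (P : probability Omega R) (n d : nat) (X : 'I_n -> {RV P >-> d.-tuple R}).
Local Notation Smx w := (kendall_mx (fun i => X i w)).

(** Kendall's matrix is a function of finitely many signs, so [Q] may be arbitrary, in particular a
    statement about [estimator], whose values are chosen minimizers. *)
Lemma measurable_kendall_event (Q : set 'M[R]_d) : measurable [set w | Q (Smx w)].
Proof.
pose I : finType := (('I_n * 'I_n) * ('I_d * 'I_d))%type.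
pose y (x : I) w := (tnth (X x.1.1 w) x.2.1 - tnth (X x.1.2 w) x.2.1) *
                    (tnth (X x.1.1 w) x.2.2 - tnth (X x.1.2 w) x.2.2).
have mX i l : measurable_fun setT (fun w => tnth (X i w) l).
  exact: (measurableT_comp (measurable_tnth l) (measurable_RV X i)).
have my x : measurable_fun setT (y x) by apply: measurable_funM; apply: measurable_funB.
(* The truth values of [0 <= y] and [y <= 0] encode the sign of [y], recovered by [sgn] as their
   difference. *)
pose c (x : I) w := (0 <= y x w, y x w <= 0).
have mbool (f g : Omega -> R) (b : bool) : measurable_fun setT f -> measurable_fun setT g ->
    measurable [set w | (f w <= g w) = b].
  move=> mf mg; have m1 : measurable [set w | f w <= g w].
    by rewrite -[X in measurable X]setTI; exact: measurable_fun_le.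
  case: b => //; rewrite (_ : [set w | _] = ~` [set w | f w <= g w]); first exact: measurableC.
  by apply/seteqP; split => w /=; [move=> -> |move/negP/negbTE].
have mc x a : measurable (c x @^-1` [set a]).
  rewrite (_ : c x @^-1` [set a] = [set w | (0 <= y x w) = a.1] `&` [set w | (y x w <= 0) = a.2]).
    by apply: measurableI; apply: mbool => //; exact: measurable_cst.
  by case: a => a b; apply/seteqP; split => w /=; [move=> [-> ->]|move=> [<- <-]].
pose sgn (a : bool * bool) : R := a.1%:R - a.2%:R.
pose F (a : {ffun I -> bool * bool}) : 'M[R]_d :=
  \matrix_(j, k) if j == k then 1 else sin (2 / (n%:R * (n%:R - 1)) *
    (\sum_(i < n) \sum_(i' < n | (i < i')%N) sgn (a ((i, i'), (j, k)))) * pi / 2).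
have -> : [set w | Q (Smx w)] = [set w | (Q \o F) [ffun x => c x w]].
  suff E w : F [ffun x => c x w] = Smx w by apply/seteqP; split => w /=; rewrite E.
  apply/matrixP => j k; rewrite !mxE; case: eqP => // _; congr (sin (_ * _ * _ / _)).
  apply: eq_bigr => i _; apply: eq_bigr => i' _; rewrite ffunE /c /sgn /y /=.
  by case: sgrP => h; rewrite ?lexx ?subrr// ?(ltW h)// ?leNgt ?h/= ?subr0 ?sub0r.
exact: (measurable_finite_family mc).
Qed.

End kendall_events.

(** * From tau to the entries of Kendall's matrix *)

Section kendall_distance.
Context {disp : measure_display} {Omega : measurableType disp} {R : realType}.
Variables (P : probability Omega R) (n d : nat) (X : 'I_n -> {RV P >-> d.-tuple R}).
Variable Sigma : 'M[R]_d.
Hypothesis corr : correlation_mx Sigma.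
Local Notation Smx w := (kendall_mx (fun i => X i w)).
Local Notation tau j k := (1 - 2 * acos (Sigma j k) / pi).

(** [1 - 2 acos rho / pi] inverts [sin (tau pi / 2) = rho]; the factor [2] bounds the Lipschitz
    constant [pi / 2]. *)
Lemma kendall_mx_dist w j k : j != k ->
  `|Smx w j k - Sigma j k| <= 2 * `|kendall_tau (fun i => X i w) j k - tau j k|.
Proof.
move=> jk; have /andP[r0 r1] := offdiag_correlation corr jk.
have pi0 := @pi_gt0 R.
have E : sin (tau j k * pi / 2) = Sigma j k.
  have -> : tau j k * pi / 2 = - (acos (Sigma j k) - pi / 2).
    by move: pi0; move: (@pi R) (acos _) => p a p0; field; rewrite gt_eqF.
  by rewrite sinN sinBpihalf opprK acosK// in_itv/= !ltW.
rewrite -{1}E.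
rewrite mxE (negbTE jk); apply: le_trans (sin_lipschitz _ _) _.
rewrite -!mulrBl -mulrA normrM mulrC ler_wpM2r//.
have := @pihalf_02 R; rewrite ger0_norm; lra.
Qed.

Lemma norm_tau_le1 j k : j != k -> `|tau j k| <= 1.
Proof.
move=> jk; have /andP[r0 r1] := offdiag_correlation corr jk.
have a0 : 0 <= acos (Sigma j k) by apply: acos_ge0; rewrite !ltW.
have a1 : acos (Sigma j k) <= pi by apply: acos_lepi; rewrite !ltW.
have pi0 := @pi_gt0 R; move: a0 a1 pi0; move: (acos _) (@pi R) => a p a0 ap p0.
have : 0 <= a / p by rewrite divr_ge0// ltW.
have : a / p <= 1 by rewrite ler_pdivrMr// mul1r.
rewrite ler_norml; lra.
Qed.

End kendall_distance.

Section kendall_concentration.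
Context {disp : measure_display} {Omega : measurableType disp} {R : realType}.
Variables (P : probability Omega R) (n d : nat) (X : 'I_n -> {RV P >-> d.-tuple R}).
Variables (f : 'I_d -> R -> R) (Sigma : 'M[R]_d).
Hypotheses (indX : mutually_independent X)
  (fi : forall j x y, x < y -> f j x < f j y)
  (corr : correlation_mx Sigma)
  (npn : forall i, nonparanormal f Sigma (X i)).
Local Notation Smx w := (kendall_mx (fun i => X i w)).
Local Notation tau j k := (1 - 2 * acos (Sigma j k) / pi).

Hypotheses (n0 : (0 < n)%N) (d1 : (1 < d)%N).
Variable lambda : R.
Hypothesis lambda_ge : 160 * Num.sqrt (ln d%:R / n%:R) <= lambda.

Let lnd : 2^-1 <= ln (d%:R : R).
Proof.
apply: (@le_trans _ _ (ln 2)); last by rewrite ler_ln ?posrE ?ltr0n ?ler_nat// ltnW.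
have : ln (1 + - 2^-1 : R) <= - 2^-1 by apply: le_ln1Dx; lra.
have -> : 1 + - 2^-1 = 2^-1 :> R by field.
by rewrite lnV ?posrE//; lra.
Qed.

Let lambda_sqr : 1600 * ln d%:R <= n%:R * (lambda / 4) ^+ 2.
Proof.
have nR : 0 < n%:R :> R by rewrite ltr0n.
have q0 : 0 <= ln (d%:R : R) / n%:R.
  by apply: divr_ge0; [exact: (le_trans _ lnd)|exact: ltW].
have s0 := sqrtr_ge0 (ln (d%:R : R) / n%:R).
have : (40 * Num.sqrt (ln d%:R / n%:R)) ^+ 2 <= (lambda / 4) ^+ 2.
  by move: lambda_ge s0; move: (Num.sqrt _) => q ? ?; rewrite ler_sqr ?nnegrE; lra.
rewrite exprMn sqr_sqrtr// mulrA ler_pdivrMr// [_ * n%:R]mulrC.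
apply: le_trans; rewrite ler_wpM2r//; first exact: (le_trans _ lnd).
by rewrite expr2; lra.
Qed.

(** An error of [lambda / 2] in the entry forces [lambda / 4] in tau. The constant [160] gives
    [n (lambda / 4)^2 >= 1600 ln d], and [1600 / 512 >= 3] produces the power [d^-3], enough for a
    union over [d^2] entries. *)
Lemma kendall_mx_tail j k : j != k ->
  (P [set w | (lambda / 2 < `|Smx w j k - Sigma j k|)%R] <= (2 * d%:R^-1 ^+ 3)%:E)%E.
Proof.
move=> jk; have dR : 0 < d%:R :> R by rewrite ltr0n ltnW.
have lam0 : 0 <= lambda by rewrite (le_trans _ lambda_ge)// mulr_ge0// sqrtr_ge0.
have t1 := norm_tau_le1 corr jk.
case: n n0 X indX npn lambda_sqr => [//|[|m]] _ Y indY npnY lsq.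
  (* For [n = 1] tau is [2 / 0 * 0 = 0] and the matrix entry is [0], so an error above [lambda / 2]
     would force [lambda < 2], whereas [lambda_sqr] with [ln d >= 1/2] makes [lambda] much larger:
     the event is empty. *)
  rewrite [X in P X](_ : _ = set0) ?measure0 ?lee_fin ?mulr_ge0 ?exprn_ge0 ?invr_ge0//.
  apply/seteqP; split => w //=; rewrite mxE (negbTE jk) /kendall_tau subrr mulr0 invr0 mulr0 !mul0r sin0.
  have := offdiag_correlation corr jk.
  rewrite sub0r normrN; case/andP => ? ?; have s1 : `|Sigma j k| < 1 by rewrite ltr_norml; apply/andP.
  move=> ls; have : (lambda / 4) ^+ 2 <= 1 ^+ 2 by rewrite ler_sqr ?nnegrE; lra.
  rewrite expr1n => l4; suff : (1 : R) < 1 by rewrite ltxx.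
  by move: lsq lnd; rewrite mul1r; move: (ln _) => L ? ?; lra.
have tauE i i' : i != i' -> (\int[P]_w (concordance j k (Y i w, Y i' w))%:E = (tau j k)%:E)%E.
  by move=> ii; exact: (expectation_sg_pair indY fi corr npnY).
have l0 : 0 < lambda.
  rewrite lt_neqAle lam0 andbT; apply/eqP => e.
  move: lsq lnd; rewrite -e mul0r expr0n mulr0; move: (ln _) => L ? ?.
  suff : (1 : R) < 1 by rewrite ltxx.
  lra.
have x0 : 0 < lambda / 4 by lra.
apply: (@le_trans _ _ (P [set w | (lambda / 4 <= `|kendall_tau (fun i => Y i w) j k - tau j k|)%R])).
  apply: le_measure; rewrite ?inE.
  - exact: (measurable_kendall_event Y (fun S => lambda / 2 < `|S j k - Sigma j k|)).
  - rewrite -[X in measurable X]setTI; apply: (measurable_fun_le measurableT).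
      exact: measurable_cst.
    exact: (measurableT_comp (@normr_measurable R setT) (measurable_kendall Y j k _)).
  - move=> w /=; have := kendall_mx_dist Y corr w jk; lra.
apply: le_trans (kendall_tail indY tauE t1 x0) _.
rewrite lee_fin ler_pM2l//.
have -> : d%:R^-1 ^+ 3 = expR (- (3 * ln d%:R)) :> R.
  by rewrite expRN expRM_natl lnK ?posrE// exprVn.
rewrite ler_expR; move: lsq lnd; move: (_ * (lambda / 4) ^+ 2) (ln _) => y L ? ?; lra.
Qed.

Lemma kendall_mx_concentration :
  ((1 - 8 / d%:R)%:E <= P [set w | forall j k, j != k -> (`|Smx w j k - Sigma j k| <= lambda / 2)%R])%E.
Proof.
have dR : 0 < d%:R :> R by rewrite ltr0n ltnW.
apply: probability_ge.
  exact: (measurable_kendall_event X (fun S => forall j k, j != k -> `|S j k - Sigma j k| <= lambda / 2)).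
pose A (p : 'I_d * 'I_d) := [set w | p.1 != p.2 /\ lambda / 2 < `|Smx w p.1 p.2 - Sigma p.1 p.2|].
have mA p : measurable (A p).
  exact: (measurable_kendall_event X (fun S => p.1 != p.2 /\ lambda / 2 < `|S p.1 p.2 - Sigma p.1 p.2|)).
rewrite [X in P X](_ : _ = [set w | exists p, A p w]); last first.
  apply/seteqP; split => w /=.
    by move=> /existsNP[j /existsNP[k /not_implyP[jk /negP]]]; rewrite -ltNge; exists (j, k).
  by move=> [p [pp lt]] H; have := H _ _ pp; rewrite leNgt lt.
apply: le_trans (probability_union_le P mA) _.
apply: (@le_trans _ _ (\sum_(p : 'I_d * 'I_d) (2 * d%:R^-1 ^+ 3)%:E)%E).
  apply: lee_sum => p _; have [pp|pp] := eqVneq p.1 p.2.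
    rewrite (_ : A p = set0) ?measure0 ?lee_fin ?mulr_ge0 ?exprn_ge0 ?invr_ge0 ?ltW//.
    by apply/seteqP; split => w // -[]; rewrite pp eqxx.
  rewrite (_ : A p = [set w | lambda / 2 < `|Smx w p.1 p.2 - Sigma p.1 p.2|]); first exact: kendall_mx_tail.
  by apply/seteqP; split => w; [move=> []|].
(* The [d^2] terms [2 / d^3] add up to [2 / d], within the stated [8 / d]. *)
rewrite sumEFin lee_fin sumr_const card_prod card_ord -[_ *+ _]mulr_natr natrM.
rewrite (_ : 2 * _ * _ = 2 / d%:R); last by move: dR; move: (d%:R : R) => x x0; field; lra.
by rewrite ler_wpM2r ?invr_ge0 ?ltW//; lra.
Qed.

End kendall_concentration.

Section kendall_moment.
Context {disp : measure_display} {Omega : measurableType disp} {R : realType}.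
Variables (P : probability Omega R) (m d : nat) (X : 'I_m.+2 -> {RV P >-> d.-tuple R}).
Variables (f : 'I_d -> R -> R) (Sigma : 'M[R]_d).
Hypotheses (indX : mutually_independent X)
  (fi : forall j x y, x < y -> f j x < f j y)
  (corr : correlation_mx Sigma)
  (npn : forall i, nonparanormal f Sigma (X i)).
Local Notation Smx w := (kendall_mx (fun i => X i w)).
Local Notation tau j k := (1 - 2 * acos (Sigma j k) / pi).
Local Notation n := (m.+2%:R : R).

Let n0 : 0 < n. Proof. by rewrite ltr0n. Qed.

Lemma measurable_kendall_mx j k : j != k -> measurable_fun setT (fun w => Smx w j k - Sigma j k).
Proof.
move=> jk; under eq_fun do rewrite mxE (negbTE jk).
apply: measurable_funB; last exact: measurable_cst.
apply: (@measurableT_comp _ _ _ _ _ _ (@sin R)); first exact: (continuous_measurable_fun (@continuous_sin R)).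
apply: measurable_funM; last exact: measurable_cst.
apply: measurable_funM; last exact: measurable_cst.
have := @measurable_kendall _ _ _ _ _ _ X j k 0.
by under eq_fun do rewrite subr0.
Qed.

Lemma kendall_mx_second_moment j k : j != k ->
  (\int[P]_w ((Smx w j k - Sigma j k) ^+ 2)%:E <= (32 * expR 128 / n)%:E)%E.
Proof.
move=> jk.
have tauE i i' : i != i' -> (\int[P]_w (concordance j k (X i w, X i' w))%:E = (tau j k)%:E)%E.
  by move=> ii; exact: (expectation_sg_pair indX fi corr npn).
have mk2 : measurable_fun setT (fun w => (kendall_tau (fun i => X i w) j k - tau j k) ^+ 2).
  by apply: measurable_funX; exact: (measurable_kendall X j k (tau j k)).
apply: (@le_trans _ _ (\int[P]_w (4%:E * ((kendall_tau (fun i => X i w) j k - tau j k) ^+ 2)%:E))%E).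
  apply: ge0_le_integral.
  - exact: measurableT.
  - by move=> w _; rewrite lee_fin sqr_ge0.
  - by apply/measurable_EFinP; apply: measurable_funX; exact: measurable_kendall_mx.
  - by apply: emeasurable_funM; [exact: measurable_cst|apply/measurable_EFinP].
  move=> w _; rewrite -EFinM lee_fin -[leLHS]real_normK ?num_real// -[X in 4 * X]real_normK ?num_real//.
  have h := kendall_mx_dist X corr w jk; rewrite (_ : 4 * _ = (2 * `|kendall_tau (fun i => X i w) j k - tau j k|) ^+ 2).
    by rewrite ler_sqr ?nnegrE// mulr_ge0.
  by rewrite exprMn -natrX.
rewrite ge0_integralZl//; last 2 first.
- by apply/measurable_EFinP.
- by move=> w _; rewrite lee_fin sqr_ge0.
apply: (@le_trans _ _ (4%:E * (8 * expR 128 / n)%:E)%E).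
  rewrite lee_pmul2l//.
  exact: (kendall_second_moment indX tauE (norm_tau_le1 corr jk)).
by rewrite -EFinM lee_fin !mulrA -natrM.
Qed.

(** Second moments add over [E] whatever the dependence between entries, so no [ln d] is lost. *)
Lemma kendall_mx_markov (E : {set 'I_d * 'I_d}) (s : nat) (a : R) :
  (forall p, p \in E -> p.1 != p.2) -> (#|E| <= s)%N -> 0 < a ->
  (P [set w | (a * s%:R < n * \sum_(p in E) (Smx w p.1 p.2 - Sigma p.1 p.2) ^+ 2)%R] <=
   (32 * expR 128 / a)%:E)%E.
Proof.
move=> offE; case: s => [|s] Es a0.
  (* For [s = 0] Markov's inequality would divide by zero, but [E] is empty and the event reads
     [0 < 0]. *)
  rewrite [X in P X](_ : _ = set0) ?measure0 ?lee_fin ?mulr_ge0 ?expR_ge0 ?invr_ge0 ?ltW//.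
  move: Es; rewrite leqn0 cards_eq0 => /eqP ->.
  by apply/seteqP; split => w //=; rewrite big_set0 !mulr0 ltxx.
set A := [set w | _].
have mA : measurable A.
  exact: (measurable_kendall_event X (fun S => a * s.+1%:R < n * \sum_(p in E) (S p.1 p.2 - Sigma p.1 p.2) ^+ 2)).
have as0 : 0 < a * s.+1%:R by rewrite mulr_gt0.
have sum0 w : 0 <= \sum_(p in E) (Smx w p.1 p.2 - Sigma p.1 p.2) ^+ 2.
  by apply: sumr_ge0 => p _; exact: sqr_ge0.
pose g p w : \bar R := if p \in E then ((Smx w p.1 p.2 - Sigma p.1 p.2) ^+ 2)%:E else 0%E.
have g0 p w : (0 <= g p w)%E by rewrite /g; case: ifP => // _; rewrite lee_fin sqr_ge0.
have mg p : measurable_fun setT (g p).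
  rewrite /g; have [/offE pp|_] := boolP (p \in E); last exact: measurable_cst.
  by apply/measurable_EFinP; apply: measurable_funX; exact: measurable_kendall_mx.
have gE w : (\sum_p g p w = (\sum_(p in E) (Smx w p.1 p.2 - Sigma p.1 p.2) ^+ 2)%:E)%E.
  by rewrite -sumEFin [RHS]big_mkcond.
have intg : (\int[P]_w (\sum_p g p w) <= (s.+1%:R * (32 * expR 128 / n))%:E)%E.
  rewrite ge0_integral_sum//.
  apply: (@le_trans _ _ (\sum_(p in E) (32 * expR 128 / n)%:E)%E).
    rewrite [leRHS]big_mkcond; apply: lee_sum => p _; rewrite /g; have [/offE pp|_] := boolP (p \in E).
      exact: kendall_mx_second_moment.
    by rewrite integral0.
  rewrite sumEFin lee_fin sumr_const -[leLHS]mulr_natl ler_wpM2r ?ler_nat//.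
have h : ((a * s.+1%:R)%:E * P A <= (n * (s.+1%:R * (32 * expR 128 / n)))%:E)%E.
  rewrite -integral_cst// [leRHS]EFinM.
  apply: (@le_trans _ _ (\int[P]_w (n%:E * (\sum_p g p w)))%E); last first.
    rewrite ge0_integralZl//; first by rewrite lee_pmul2l ?lte_fin.
    - by apply: emeasurable_sum.
    - by move=> w _; exact: sume_ge0.
  apply: (@le_trans _ _ (\int[P]_(w in A) (n%:E * (\sum_p g p w)))%E).
    apply: ge0_le_integral => //.
    - by move=> w _; rewrite lee_fin ltW.
    - by apply: emeasurable_funM; [exact: measurable_cst|apply: measurable_funTS; exact: emeasurable_sum].
    - by move=> w /= Aw; rewrite gE -EFinM lee_fin ltW.
  apply: ge0_subset_integral => //.
  - by apply: emeasurable_funM; [exact: measurable_cst|exact: emeasurable_sum].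
  - by move=> w _; apply: mule_ge0; [rewrite lee_fin ltW|exact: sume_ge0].
rewrite -(@lee_pmul2l _ (a * s.+1%:R)%:E)//.
apply: le_trans h _; rewrite -EFinM lee_fin le_eqVlt; apply/orP; left; apply/eqP.
by move: n0 a0; move: (m.+2%:R : R) (expR 128) (s.+1%:R) => N e S N0 A0; field; rewrite !gt_eqF.
Qed.

End kendall_moment.

Lemma kendall_mx_markov_ge2 (disp : measure_display) (Omega : measurableType disp) (R : realType)
    (P : probability Omega R) (n d : nat) (X : 'I_n -> {RV P >-> d.-tuple R})
    (f : 'I_d -> R -> R) (Sigma : 'M[R]_d) (E : {set 'I_d * 'I_d}) (s : nat) (a : R) :
  (2 <= n)%N -> mutually_independent X -> (forall j x y, x < y -> f j x < f j y) ->
  correlation_mx Sigma -> (forall i, nonparanormal f Sigma (X i)) ->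
  (forall p, p \in E -> p.1 != p.2) -> (#|E| <= s)%N -> 0 < a ->
  (P [set w | (a * s%:R < n%:R *
      \sum_(p in E) (kendall_mx (fun i => X i w) p.1 p.2 - Sigma p.1 p.2) ^+ 2)%R] <=
   (32 * expR 128 / a)%:E)%E.
Proof.
case: n X => [|[|m]] // X _ ind fi corr npn offE Es a0.
exact: (kendall_mx_markov ind fi corr npn offE Es a0).
Qed.

(** * Probability bounds for the estimator *)

Section rates.
Context {R : realType}.

(** The sample size constant is [c^2] with [c = 1 + 12 k2 / eps2^3]: it yields
    [lambda sqrt s <= k2 / c], after which the claim is [12 k2 < c eps2^3], strict thanks to the
    summand [1]. The modulus is there because the constant is fixed before [eps2 > 0] is known. *)
Lemma lambda_smallness (k2 eps2 nu lambda : R) (n d s : nat) :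
  0 < k2 -> 0 < eps2 -> 0 <= nu <= eps2^-1 -> (0 < n)%N -> 0 <= lambda ->
  lambda <= k2 * Num.sqrt (ln d%:R / n%:R) ->
  (1 + 12 * k2 / `|eps2| ^+ 3) ^+ 2 * (s%:R * ln d%:R) <= n%:R ->
  6 * nu ^+ 2 * (lambda * Num.sqrt s%:R) < eps2 / 2.
Proof.
move=> k0 e0 /andP[nu0 nu1] n0 l0 lk.
rewrite gtr0_norm//.
have [c cdef] : exists c, c = 1 + 12 * k2 / eps2 ^+ 3 by eexists.
rewrite -cdef => cs.
have nR : 0 < n%:R :> R by rewrite ltr0n.
have c1 : 0 < c by rewrite cdef ltr_wpDr// divr_ge0// ?mulr_ge0 ?exprn_ge0// ltW.
have L0 : 0 <= ln (d%:R : R) / n%:R.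
  rewrite divr_ge0//; case: (d) => [|d']; first by rewrite ln0.
  by rewrite ln_ge0// ler1n.
have ls : lambda * Num.sqrt s%:R <= k2 / c.
  apply: (@le_trans _ _ (k2 * Num.sqrt (ln d%:R / n%:R) * Num.sqrt s%:R)).
    by rewrite ler_wpM2r ?sqrtr_ge0.
  rewrite -mulrA ler_pM2l// -(ler_pM2r c1) mulVf ?gt_eqF//.
  rewrite -(@ler_sqr _ _ 1) ?nnegrE//; last first.
    by rewrite !mulr_ge0 ?sqrtr_ge0// ltW.
  rewrite expr1n 2!exprMn !sqr_sqrtr//.
  have -> : ln d%:R / n%:R * s%:R * c ^+ 2 = (c ^+ 2 * (s%:R * ln d%:R)) / n%:R by ring.
  by rewrite ler_pdivrMr// mul1r.
have n2 : nu ^+ 2 <= eps2^-1 ^+ 2 by rewrite ler_sqr ?nnegrE ?invr_ge0// ltW.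
apply: (@le_lt_trans _ _ (6 * eps2^-1 ^+ 2 * (k2 / c))).
  by apply: ler_pM => //; rewrite ?mulr_ge0 ?sqr_ge0 ?sqrtr_ge0// ler_pM2l.
have cE : c * eps2 ^+ 3 = eps2 ^+ 3 + 12 * k2.
  by rewrite cdef mulrDl mul1r mulfVK// expf_neq0// gt_eqF.
have e3 : 0 < eps2 ^+ 3 by rewrite exprn_gt0.
rewrite (_ : 6 * _ * _ = 6 * k2 * eps2 / (c * eps2 ^+ 3)); last by field; rewrite !gt_eqF.
rewrite cE ltr_pdivrMr; last by lra.
rewrite mulrDr; have : 0 < eps2 / 2 * eps2 ^+ 3 by rewrite mulr_gt0// divr_gt0.
lra.
Qed.

(** The condition on [T] gives [2^-T lambda sqrt n <= 2], whence [12 = 6 * 2]. After [T.+1]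
    iterations the exponent is [T], since halving starts at the first iterate. *)
Lemma error_rate (nu eps2 lambda a g : R) (n s T : nat) :
  0 < eps2 -> 0 <= nu <= eps2^-1 -> 0 < lambda -> (0 < n)%N -> 0 <= a -> 0 <= g ->
  n%:R * g ^+ 2 <= a * s%:R ->
  ln (lambda * Num.sqrt n%:R) <= T.+1%:R * ln 2 ->
  8 * nu ^+ 2 * g + 2^-1 ^+ T * (6 * nu ^+ 2 * (lambda * Num.sqrt s%:R)) <=
  (8 * Num.sqrt a + 12) * eps2^-1 ^+ 2 * Num.sqrt (s%:R / n%:R).
Proof.
move=> e0 /andP[nu0 nu1] l0 n0 a0 g0 ga lT.
have nR : 0 < n%:R :> R by rewrite ltr0n.
have n2 : nu ^+ 2 <= eps2^-1 ^+ 2 by rewrite ler_sqr ?nnegrE ?invr_ge0// ltW.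
set q := Num.sqrt (s%:R / n%:R).
have q0 : 0 <= q by exact: sqrtr_ge0.
have gq : g <= Num.sqrt a * q.
  rewrite -sqrtrM// -[g]ger0_norm// -sqrtr_sqr ler_sqrt; last first.
    by apply: mulr_ge0 => //; apply: divr_ge0.
  by rewrite mulrA ler_pdivlMr// mulrC.
have sq : Num.sqrt s%:R = q * Num.sqrt n%:R.
  by rewrite /q -sqrtrM ?divr_ge0// mulfVK// gt_eqF.
have l2 : 2^-1 ^+ T * (lambda * Num.sqrt n%:R) <= 2.
  have ln0 : 0 < lambda * Num.sqrt n%:R by rewrite mulr_gt0 ?sqrtr_gt0.
  have : lambda * Num.sqrt n%:R <= 2 ^+ T.+1.
    by rewrite -[leLHS]lnK ?posrE// -[X in X ^+ _]lnK ?posrE// -expRM_natl ler_expR.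
  by rewrite exprVn ler_pdivrMl ?exprn_gt0// -exprSr.
have h1 : 8 * nu ^+ 2 * g <= 8 * eps2^-1 ^+ 2 * (Num.sqrt a * q).
  by apply: ler_pM => //; rewrite ?mulr_ge0 ?sqr_ge0// ler_pM2l.
have h2 : 2^-1 ^+ T * (6 * nu ^+ 2 * (lambda * Num.sqrt s%:R)) <= 12 * eps2^-1 ^+ 2 * q.
  rewrite sq; have : 0 <= 2^-1 ^+ T :> R by rewrite exprn_ge0// invr_ge0.
  move: l2; move: (2^-1 ^+ T) => y l2 y0.
  rewrite (_ : y * _ = (nu ^+ 2 * (6 * q)) * (y * (lambda * Num.sqrt n%:R))); last by ring.
  rewrite (_ : 12 * _ * _ = (eps2^-1 ^+ 2 * (6 * q)) * 2); last first.
    by ring.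
  apply: ler_pM => //.
  - by rewrite mulr_ge0 ?sqr_ge0 ?mulr_ge0.
  - by rewrite !mulr_ge0 ?sqrtr_ge0// ltW.
  - by rewrite ler_wpM2r ?mulr_ge0.
apply: le_trans (lerD h1 h2) _; rewrite le_eqVlt; apply/orP; left; apply/eqP; ring.
Qed.

(** If [n = 0] or [d <= 1], the upper bound on [lambda] is zero by the conventions for division by
    zero and for [ln 0], or by [ln 1 = 0]. *)
Lemma sample_sizes (k lambda : R) (n d : nat) : 0 < lambda ->
  lambda <= k * Num.sqrt (ln d%:R / n%:R) -> (0 < n)%N && (1 < d)%N.
Proof.
move=> l0; case: n => [|n]; first by rewrite invr0 mulr0 sqrtr0 mulr0 leNgt l0.
case: d => [|[|d]] //; first by rewrite ln0// mul0r sqrtr0 mulr0 leNgt l0.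
by rewrite ln1 mul0r sqrtr0 mulr0 leNgt l0.
Qed.

End rates.

(** * Combination of the deterministic and probabilistic bounds *)

Section main_deterministic.
Context {R : realType} (M eps2 alpha k2 : R).
Context (n d s : nat) (lambda : R) (w : R -> R) (Sigma S : 'M[R]_d).
Hypothesis d_gt0 : (0 < d)%N.
Hypothesis n_gt0 : (0 < n)%N.
Hypothesis Sigma_corr : correlation_mx Sigma.
Hypothesis lambda_gt0 : 0 < lambda.
Hypothesis A1 : assumption1 M eps2 s Sigma.
Hypothesis A2 : assumption2 alpha lambda Sigma w.
Hypothesis A3 : assumption3 alpha lambda Sigma.
Hypothesis S_sym : S^T = S.
Hypothesis S_diag : forall i, S i i = 1.
Hypothesis S_close : forall i j, i != j -> `|S i j - Sigma i j| <= lambda / 2.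
Hypothesis k2_gt0 : 0 < k2.
Hypothesis sample_size : (1 + 12 * k2 / `|eps2| ^+ 3) ^+ 2 * (s%:R * ln d%:R) <= n%:R.
Hypothesis lambda_le : lambda <= k2 * Num.sqrt (ln d%:R / n%:R).

Let Th := invmx Sigma.
Let hat := estimator w lambda S.

Let eps2_gt0 : 0 < eps2. Proof. by case: A1. Qed.

Let nu_bounds : 0 <= spectral_norm Th <= eps2^-1.
Proof.
rewrite spectral_norm_ge0 /Th; move: d_gt0 Sigma_corr A1; case: d Sigma => // d' Sig _ cS a1.
exact: (spectral_le_eps2 cS a1).
Qed.

Let lambda_small : 6 * spectral_norm Th ^+ 2 * (lambda * Num.sqrt s%:R) < eps2 / 2.
Proof.
exact: (lambda_smallness k2_gt0 eps2_gt0 nu_bounds n_gt0 (ltW lambda_gt0) lambda_le sample_size).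
Qed.

Lemma estimator_step l :
  is_argmin (@posdef R d) (penalized_loss S (weight_mx w lambda (hat l))) (hat l.+1) /\
  frobenius_norm (hat l.+1 - Th) <= 4 * spectral_norm Th ^+ 2 *
      frobenius_norm (restrict_mx (off_support Th) (grad_loss S Th))
    + 1 / 2 * frobenius_norm (hat l - Th).
Proof.
move: d_gt0 Sigma_corr A1 A2 A3 S_sym S_diag S_close lambda_small; rewrite /hat /Th.
case: d Sigma S => [//|d'] Sig S' _ cS a1 a2 a3 sS dS clS sm; split.
  exact: (estimator_argmin_card cS lambda_gt0 a1 a2 sS dS clS sm l).1.
exact: (estimator_contraction cS lambda_gt0 a1 a2 a3 sS dS clS sm l).
Qed.

Lemma estimator_rate a T : 0 <= a ->
  n%:R * \sum_(p in off_support Th) (S p.1 p.2 - Sigma p.1 p.2) ^+ 2 <= a * s%:R ->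
  ln (lambda * Num.sqrt n%:R) <= T.+1%:R * ln 2 ->
  frobenius_norm (hat T.+1 - Th) <=
    (8 * Num.sqrt a + 12) * eps2^-1 ^+ 2 * Num.sqrt (s%:R / n%:R).
Proof.
move=> a0 ga lT.
apply: le_trans (_ : 8 * spectral_norm Th ^+ 2 *
    frobenius_norm (restrict_mx (off_support Th) (grad_loss S Th)) +
  2^-1 ^+ T * (6 * spectral_norm Th ^+ 2 * (lambda * Num.sqrt s%:R)) <= _).
  move: d_gt0 Sigma_corr A1 A2 A3 S_sym S_diag S_close lambda_small; rewrite /hat /Th.
  case: d Sigma S => [//|d'] Sig S' _ cS a1 a2 a3 sS dS clS sm.
  exact: (estimator_error cS lambda_gt0 a1 a2 a3 sS dS clS sm).
apply: (error_rate eps2_gt0 nu_bounds lambda_gt0 n_gt0 a0 (frob_ge0 _) _ lT).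
rewrite frob_restrict_sqr; apply: le_trans ga; rewrite le_eqVlt; apply/orP; left; apply/eqP.
by congr (_ * _); apply: eq_bigr => p _; rewrite /grad_loss /Th invmxK !mxE.
Qed.

End main_deterministic.

Section main.
Context {R : realType} (M eps2 alpha k2 : R).
Context (n d s : nat) (lambda : R) (w : R -> R) (f : 'I_d -> R -> R) (Sigma : 'M[R]_d).
Context (disp : measure_display) (Omega : measurableType disp) (P : probability Omega R).
Context (X : 'I_n -> {RV P >-> d.-tuple R}).
Hypothesis st : setting M eps2 alpha s lambda w f Sigma X.
Hypothesis k2_gt0 : 0 < k2.
Hypothesis sample_size : (1 + 12 * k2 / `|eps2| ^+ 3) ^+ 2 * (s%:R * ln d%:R) <= n%:R.
Hypothesis lambda_le : lambda <= k2 * Num.sqrt (ln d%:R / n%:R).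
Hypothesis lambda_ge : 160 * Num.sqrt (ln d%:R / n%:R) <= lambda.

Local Notation Smx om := (kendall_mx (fun i => X i om)).
Let Th := invmx Sigma.

Lemma kendall_mx_sym om : (Smx om)^T = Smx om.
Proof.
apply/matrixP => j k; rewrite !mxE eq_sym; case: eqP => // _.
congr (sin (_ * _ * _ / _)); apply: eq_bigr => i _; apply: eq_bigr => i' _.
by rewrite [X in Num.sg X]mulrC.
Qed.

Lemma kendall_mx_diag om i : Smx om i i = 1.
Proof. by rewrite mxE eqxx. Qed.

Let close := [set om | forall j k, j != k -> `|Smx om j k - Sigma j k| <= lambda / 2].

Let measurable_close : measurable close.
Proof.
exact: (measurable_kendall_event X (fun S => forall j k, j != k -> `|S j k - Sigma j k| <= lambda / 2)).
Qed.

Lemma contraction_probability T :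
  ((1 - 8 / d%:R)%:E <= P [set omega | (
      let S := Smx omega in
      let Theta_hat := estimator w lambda S in
      forall l : nat, (1 <= l <= T)%N ->
        is_argmin (@posdef R d)
          (penalized_loss S (weight_mx w lambda (Theta_hat l.-1))) (Theta_hat l) /\
        frobenius_norm (Theta_hat l - Th) <=
          4 * spectral_norm Th ^+ 2 *
            frobenius_norm (restrict_mx (off_support Th) (grad_loss S Th))
          + 1 / 2 * frobenius_norm (Theta_hat l.-1 - Th))%R])%E.
Proof.
have [[]] := (st, andP (sample_sizes (lambda_gt0 st) lambda_le)) => fi corr npn ind l0 a1 a2 a3 [n0 d1].
apply: le_trans (kendall_mx_concentration ind fi corr npn n0 d1 lambda_ge) _.
apply: le_measure; rewrite ?inE.
- exact: measurable_close.
- exact: (measurable_kendall_event X (fun S => forall l : nat, (1 <= l <= T)%N ->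
        is_argmin (@posdef R d)
          (penalized_loss S (weight_mx w lambda (estimator w lambda S l.-1))) (estimator w lambda S l) /\
        frobenius_norm (estimator w lambda S l - Th) <=
          4 * spectral_norm Th ^+ 2 *
            frobenius_norm (restrict_mx (off_support Th) (grad_loss S Th))
          + 1 / 2 * frobenius_norm (estimator w lambda S l.-1 - Th))).
move=> om cl /= [//|l] _.
exact: (estimator_step (ltnW d1) n0 corr l0 a1 a2 a3 (kendall_mx_sym om) (kendall_mx_diag om) cl
  k2_gt0 sample_size lambda_le).
Qed.

(** Intersects the entrywise event, failing with probability at most [8 / d], with the Markov event
    for the gradient on the support, failing with at most [32 expR 128 / a]. *)
Lemma rate_probability (a : R) T : 0 < a -> (2 <= n)%N -> (1 <= T)%N ->
  ln (lambda * Num.sqrt n%:R) <= T%:R * ln 2 ->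
  ((1 - (8 / d%:R + 32 * expR 128 / a))%:E <= P [set omega | (
      frobenius_norm (estimator w lambda (Smx omega) T - Th) <=
      (8 * Num.sqrt a + 12) * eps2^-1 ^+ 2 * Num.sqrt (s%:R / n%:R))%R])%E.
Proof.
move=> a0 n2 T1 lT.
have [[]] := (st, andP (sample_sizes (lambda_gt0 st) lambda_le)) => fi corr npn ind l0 a1 a2 a3 [n0 d1].
pose small := [set om | n%:R * \sum_(p in off_support Th) (Smx om p.1 p.2 - Sigma p.1 p.2) ^+ 2 <= a * s%:R].
have msmall : measurable small.
  exact: (measurable_kendall_event X (fun S =>
    n%:R * \sum_(p in off_support Th) (S p.1 p.2 - Sigma p.1 p.2) ^+ 2 <= a * s%:R)).
have mI : measurable (close `&` small) by exact: measurableI.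
apply: le_trans (_ : P (close `&` small) <= _)%E; last first.
  apply: le_measure; rewrite ?inE.
  - exact: mI.
  - exact: (measurable_kendall_event X (fun S => frobenius_norm (estimator w lambda S T - Th) <=
      (8 * Num.sqrt a + 12) * eps2^-1 ^+ 2 * Num.sqrt (s%:R / n%:R))).
  move=> om [cl sm] /=; case: (T) T1 lT => // T' _ lT.
  exact: (estimator_rate (ltnW d1) n0 corr l0 a1 a2 a3 (kendall_mx_sym om) (kendall_mx_diag om) cl
    k2_gt0 sample_size lambda_le (ltW a0) sm lT).
have hclose : (P (~` close) <= (8 / d%:R)%:E)%E.
  rewrite (probability_setC P measurable_close).
  have := kendall_mx_concentration ind fi corr npn n0 d1 lambda_ge.
  have : P close \is a fin_num by exact: fin_num_measure.
  rewrite -/close; case: (P close) => // r _; rewrite -EFinB !lee_fin; lra.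
apply: probability_ge => //; rewrite setCI EFinD.
apply: le_trans (measureU2 _ _ _) _; [exact: measurableC|exact: measurableC|].
apply: leeD.
  exact: hclose.
have offE p : p \in off_support Th -> p.1 != p.2 by rewrite inE => /andP[].
have card : (#|off_support Th| <= s)%N by case: a1.
rewrite (_ : ~` small = [set om | a * s%:R <
   n%:R * \sum_(p in off_support Th) (Smx om p.1 p.2 - Sigma p.1 p.2) ^+ 2]); last first.
  by apply/seteqP; split => om /=; rewrite ltNge => /negP.
exact: (kendall_mx_markov_ge2 n2 ind fi corr npn offE card a0).
Qed.

End main.

Theorem theorem4p3 (R : realType) (M eps2 alpha : R) :
  (* k1, k2: constants of lambda ~ sqrt (log d / n), the lower one large enough;
     Cn: constant of the sample size condition *)
  exists2 k0 : R, 0 < k0 &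
  forall k1 k2 : R, k0 <= k1 -> k1 <= k2 ->
  exists2 Cn : R, 0 < Cn &
  (forall (n d s : nat) (lambda : R) (w : R -> R)
      (f : 'I_d -> R -> R) (Sigma : 'M[R]_d)
      (disp : measure_display) (Omega : measurableType disp)
      (P : probability Omega R) (X : 'I_n -> {RV P >-> d.-tuple R}) (T : nat),
    setting M eps2 alpha s lambda w f Sigma X ->
    Cn * (s%:R * ln d%:R) <= n%:R ->
    k1 * Num.sqrt (ln d%:R / n%:R) <= lambda <= k2 * Num.sqrt (ln d%:R / n%:R) ->
    let Theta := invmx Sigma in
    ((1 - 8 / d%:R)%:E <= P [set omega | (
      let S := kendall_mx (fun i => X i omega) in
      let Theta_hat := estimator w lambda S in
      forall l : nat, (1 <= l <= T)%N ->
        is_argmin (@posdef R d)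
          (penalized_loss S (weight_mx w lambda (Theta_hat l.-1))) (Theta_hat l) /\
        frobenius_norm (Theta_hat l - Theta) <=
          4 * spectral_norm Theta ^+ 2 *
            frobenius_norm (restrict_mx (off_support Theta) (grad_loss S Theta))
          + 1 / 2 * frobenius_norm (Theta_hat l.-1 - Theta))%R])%E)
  /\
  (* CT, kl: constants of T >~ log (lambda sqrt n) >~ log log d *)
  (exists2 CT : R, 0 < CT &
   forall kl : R, 0 < kl ->
   forall delta : R, 0 < delta ->
   exists (B : R) (n0 d0 : nat),
   forall (n d s : nat) (lambda : R) (w : R -> R)
      (f : 'I_d -> R -> R) (Sigma : 'M[R]_d)
      (disp : measure_display) (Omega : measurableType disp)
      (P : probability Omega R) (X : 'I_n -> {RV P >-> d.-tuple R}) (T : nat),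
    setting M eps2 alpha s lambda w f Sigma X ->
    Cn * (s%:R * ln d%:R) <= n%:R ->
    k1 * Num.sqrt (ln d%:R / n%:R) <= lambda <= k2 * Num.sqrt (ln d%:R / n%:R) ->
    (n0 <= n)%N -> (d0 <= d)%N -> (1 <= T)%N ->
    CT * ln (lambda * Num.sqrt n%:R) <= T%:R ->
    kl * ln (ln d%:R) <= ln (lambda * Num.sqrt n%:R) ->
    ((1 - delta)%:E <= P [set omega | (
      let S := kendall_mx (fun i => X i omega) in
      frobenius_norm (estimator w lambda S T - invmx Sigma)
        <= B * Num.sqrt (s%:R / n%:R))%R])%E).
Proof.
exists 160 => // k1 k2 k01 k12.
have k2_gt0 : 0 < k2 by apply: (@lt_le_trans _ _ 160); [|exact: (le_trans k01 k12)].
exists ((1 + 12 * k2 / `|eps2| ^+ 3) ^+ 2).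
  by rewrite exprn_gt0// ltr_wpDr// divr_ge0// ?exprn_ge0// mulr_ge0// ltW.
have lower (n d : nat) (lambda : R) : k1 * Num.sqrt (ln d%:R / n%:R) <= lambda ->
    160 * Num.sqrt (ln d%:R / n%:R) <= lambda.
  by apply: le_trans; rewrite ler_wpM2r// sqrtr_ge0.
split.
  move=> n d s lambda w f Sigma disp Omega P X T st ss /andP[lge lle].
  exact: (contraction_probability st k2_gt0 ss lle (lower _ _ _ lge) T).
have l2 : 0 < ln (2 : R) by rewrite ln_gt0// ltr1n.
(* Each iteration halves the excess error, so [T * ln 2 >= ln (lambda * sqrt n)] suffices. *)
exists (ln 2)^-1; first by rewrite invr_gt0.
move=> kl kl0 delta delta0.
(* Makes the Markov failure probability [delta / 2]. *)
pose a : R := 64 * expR 128 / delta.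
have a0 : 0 < a by rewrite divr_gt0// mulr_gt0// expR_gt0.
(* The bound on [d] makes [8 / d <= delta / 2]; [n >= 2] because tau divides by [n - 1]. *)
exists ((8 * Num.sqrt a + 12) * eps2^-1 ^+ 2), 2, (Num.bound (16 / delta)).
move=> n d s lambda w f Sigma disp Omega P X T st ss /andP[lge lle] n2 dd T1 lT _.
have lT' : ln (lambda * Num.sqrt n%:R) <= T%:R * ln 2 by rewrite -ler_pdivrMr// mulrC.
apply: le_trans (rate_probability st k2_gt0 ss lle (lower _ _ _ lge) a0 n2 T1 lT').
rewrite lee_fin lerD2l lerN2.
have dge : 16 / delta <= d%:R.
  apply: (@le_trans _ _ (Num.bound (16 / delta))%:R); last by rewrite ler_nat.
  by rewrite ltW// archi_boundP// divr_ge0// ltW.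
have d0 : 0 < d%:R :> R by apply: lt_le_trans dge; rewrite divr_gt0.
have h1 : 8 / d%:R <= delta / 2.
  by rewrite ler_pdivrMr// mulrAC ler_pdivlMr// mulrC -ler_pdivrMl// mulrC; lra.
have h2 : 32 * expR 128 / a = delta / 2.
  by rewrite /a; move: (expR 128 : R) (expR_gt0 (128 : R)) => e e0; field; rewrite !gt_eqF.
lra.
Qed.
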